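(* Let $m\ge2$, let $1\le\ell<m$ be fixed, let ${\bf 0}\le{\bf s}\le{\bf r}$ (componentwise) and $f\in{\bf H}^{\bf s}(\boldsymbol\Omega)$. Set $$\beta=\min_{1\le i\le\ell}\left\{\frac{s_i}{n_i}\right\}+\min_{\ell<i\le m}\left\{\frac{s_i}{n_i}\right\},$$ and let $P_1$ and $P_2$ count how often the first and the second minimum, respectively, is attained (i.e. the number of indices attaining it). Then, for every rank $R\ge2$, there exists a rank-$R$ approximation $$f_R(\boldsymbol{x}_1,\ldots,\boldsymbol{x}_m)=\sum_{r=1}^R g_r^{(1)}(\boldsymbol{x}_1,\ldots,\boldsymbol{x}_\ell)\,g_r^{(2)}(\boldsymbol{x}_{\ell+1},\ldots,\boldsymbol{x}_m)\in L^2(\boldsymbol\Omega),$$ with $g_r^{(1)}\in L^2(\Omega_1\times\cdots\times\Omega_\ell)$ and $g_r^{(2)}\in L^2(\Omega_{\ell+1}\times\cdots\times\Omega_m)$, such that $$\|f-f_R\|_{L^2(\boldsymbol\Omega)}\le C\,R^{-\beta}\,(\log R)^{(m-1)/2+\beta(\max\{P_1,P_2\}-1)}\,\|f\|_{{\bf H}^{\bf s}(\boldsymbol\Omega)}.$$ The constant $C$ depends on $s_i$ and $n_i$, $i=1,\ldots,m$ (and on the given domains and spaces), but not on the rank $R$ nor on $f$.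
   Context: Let $\Omega_i\subset\mathbb{R}^{n_i}$, $n_i\in\mathbb{N}$, $i=1,\ldots,m$, be sufficiently smooth, bounded domains and $\boldsymbol\Omega:=\Omega_1\times\cdots\times\Omega_m$. For ${\bf s}=(s_1,\ldots,s_m)\ge{\bf0}$, ${\bf H}^{\bf s}(\boldsymbol\Omega):=H^{s_1}(\Omega_1)\otimes\cdots\otimes H^{s_m}(\Omega_m)$ is the Hilbert space tensor product of the usual Sobolev spaces with the standard cross norm. For each $i=1,\ldots,m$ there is given a nested sequence of finite dimensional subspaces $V_0^{(i)}\subset V_1^{(i)}\subset\cdots\subset L^2(\Omega_i)$ of piecewise polynomial functions with $\dim V_j^{(i)}\sim2^{jn_i}$, dense union in $L^2(\Omega_i)$, and polynomial exactness $r_i\in\mathbb{N}$ (the maximal order of polynomials locally contained in $V_j^{(i)}$), such that $$\inf_{v_j\in V_j^{(i)}}\|u-v_j\|_{L^2(\Omega_i)}\lesssim2^{-js}\|u\|_{H^s(\Omega_i)},\quad u\in H^s(\Omega_i),\ 0\le s\le r_i,$$ uniformly in $j$; set ${\bf r}:=(r_1,\ldots,r_m)$. Complement spaces $W_j^{(i)}$ with $V_j^{(i)}=V_{j-1}^{(i)}\oplus W_j^{(i)}$, $W_0^{(i)}:=V_0^{(i)}$, are spanned by wavelets $\psi_{j,k}^{(i)}$, $k\in\nabla_j^{(i)}$, whose collection over all $j\ge0$ is a Riesz basis of $L^2(\Omega_i)$ with biorthogonal dual basis $\widetilde\psi_{j,k}^{(i)}$. The projections $Q_j^{(i)}u:=\sum_{k\in\nabla_j^{(i)}}(u,\widetilde\psi_{j,k}^{(i)})_{L^2(\Omega_i)}\psi_{j,k}^{(i)}$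 onto $W_j^{(i)}$ satisfy $\|Q_j^{(i)}u\|_{L^2(\Omega_i)}\lesssim2^{-js}\|u\|_{H^s(\Omega_i)}$ for $0\le s\le r_i$, uniformly in $j$. *)

(* Defs.v *)
From HB Require Import structures.
From mathcomp Require Import all_boot all_order all_algebra.
From mathcomp Require Import all_classical all_reals all_analysis.
Set Implicit Arguments.
Unset Strict Implicit.
Unset Printing Implicit Defensive.
Import Order.TTheory GRing.Theory Num.Theory.
Import numFieldNormedType.Exports.
Local Open Scope classical_set_scope.
Local Open Scope ring_scope.

(* The product sigma-algebra coincides with the Borel sets of R^n. *)
Section measurable_rV.
Context (R : realType) (n : nat).

Let coord (i : 'I_n) (x : 'rV[R]_n) : R := x ord0 i.

Let rV_set0 : g_sigma_preimage coord set0.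
Proof. exact: sigma_algebra0. Qed.

Let rV_setC A : g_sigma_preimage coord A -> g_sigma_preimage coord (~` A).
Proof. exact: sigma_algebraC. Qed.

Let rV_bigcup (F : (set 'rV[R]_n)^nat) :
  (forall i, g_sigma_preimage coord (F i)) ->
  g_sigma_preimage coord (\bigcup_i (F i)).
Proof. exact: sigma_algebra_bigcup. Qed.

HB.instance Definition _ :=
  @isMeasurable.Build (measure_tuple_display default_measure_display)
    'rV[R]_n (g_sigma_preimage coord) rV_set0 rV_setC rV_bigcup.

Lemma measurable_coord i :
  measurable_fun [set: 'rV[R]_n] (fun x : 'rV[R]_n => x ord0 i).
Proof.
move=> _ Y mY; rewrite setTI; apply: sub_sigma_algebra => /=.
rewrite -bigcup_seq/=; exists i => /=; first by rewrite mem_index_enum.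
by exists Y => //; rewrite setTI.
Qed.

Lemma measurable_fun_rV d (T : measurableType d) (f : T -> 'rV[R]_n) :
  (forall i, measurable_fun [set: T] (fun t => f t ord0 i)) ->
  measurable_fun [set: T] f.
Proof.
move=> mf.
suff sub : g_sigma_preimage (fun i => coord i \o f) `<=` measurable.
  move=> _ A mA; rewrite setTI; apply: sub.
  rewrite g_sigma_preimage_comp; exists A => //; exact: setTI.
apply: smallest_sub; first exact: sigma_algebra_measurable.
rewrite -bigcup_seq/=; apply: bigcup_sub => i _ A [B mB <-].
exact: mf.
Qed.

End measurable_rV.

Lemma product_sigma_finite d1 d2 (T1 : measurableType d1)
    (T2 : measurableType d2) (R : realType)
    (m1 : {sigma_finite_measure set T1 -> \bar R})
    (m2 : {sigma_finite_measure set T2 -> \bar R}) :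
  sigma_finite setT (m1 \x m2)%E.
Proof.
have /sigma_finiteP[F [TF ndF Foo]] := sigma_finiteT m1.
have /sigma_finiteP[G [TG ndG Goo]] := sigma_finiteT m2.
exists (fun n => F n `*` G n).
  rewrite -setXTT TF TG predeqE => -[x y]; split.
    move=> [/= [n _ Fnx] [k _ Gky]]; exists (maxn n k) => //; split.
    - by move: x Fnx; exact/subsetPset/ndF/leq_maxl.
    - by move: y Gky; exact/subsetPset/ndG/leq_maxr.
  by move=> [n _ []/= ? ?]; split; exists n.
move=> k; have [? ?] := Foo k; have [? ?] := Goo k.
split; first exact: measurableX.
by rewrite product_measure1E// lte_mul_pinfty// ge0_fin_numE.
Qed.

Section lebesgue_rV_step.
Context (R : realType) (n : nat)
  (mu : {sigma_finite_measure set 'rV[R]_n -> \bar R}).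

Definition consrV (p : R * 'rV[R]_n) : 'rV[R]_n.+1 :=
  row_mx p.1%:M p.2 : 'rV_(1 + n).

Definition unconsrV (x : 'rV[R]_n.+1) : R * 'rV[R]_n :=
  (x ord0 ord0, rsubmx (x : 'rV_(1 + n))).

Lemma unconsrVK : cancel unconsrV consrV.
Proof.
move=> x; apply/rowP => i; rewrite /consrV /unconsrV /= mxE.
case: splitP => j ij; last first.
  by rewrite mxE; congr (x _ _); apply/val_inj.
by rewrite mxE !ord1 /= mulr1n; congr (x _ _); apply/val_inj; rewrite /= ij ord1.
Qed.

Lemma consrVK : cancel consrV unconsrV.
Proof.
move=> [t v]; rewrite /consrV /unconsrV /= row_mxKr; congr pair.
rewrite mxE; case: splitP => [j _|//]; by rewrite mxE !ord1 mulr1n.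
Qed.

Lemma measurable_consrV : measurable_fun setT consrV.
Proof.
apply: measurable_fun_rV => i; rewrite /consrV.
under eq_fun do rewrite mxE.
case: (fintype.split (i : 'I_(1 + n))) => j.
  under eq_fun do rewrite mxE !ord1 eqxx mulr1n.
  exact: measurable_fst.
by apply: (measurableT_comp (measurable_coord j)); exact: measurable_snd.
Qed.

Lemma measurable_unconsrV : measurable_fun setT unconsrV.
Proof.
apply/measurable_fun_pairP; split; first exact: measurable_coord.
apply: measurable_fun_rV => i /=; under eq_fun do rewrite mxE.
exact: measurable_coord.
Qed.

Definition lebesgue_rV_step : set 'rV[R]_n.+1 -> \bar R :=
  pushforward (lebesgue_measure \x mu)%E consrV.

Let step0 : lebesgue_rV_step set0 = 0%E.
Proof. by rewrite /lebesgue_rV_step /pushforward preimage_set0 measure0. Qed.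

Let step_ge0 A : (0 <= lebesgue_rV_step A)%E.
Proof. by rewrite /lebesgue_rV_step /pushforward; exact: measure_ge0. Qed.

Let step_additive : semi_sigma_additive lebesgue_rV_step.
Proof.
have := @measure_semi_sigma_additive _ _ _
  (measure_function_pushforward__canonical__measure_function_Measure
    (lebesgue_measure \x mu)%E measurable_consrV).
exact.
Qed.

HB.instance Definition _ :=
  isMeasure.Build _ _ _ lebesgue_rV_step step0 step_ge0 step_additive.

Let step_sigma_finite : sigma_finite setT lebesgue_rV_step.
Proof.
have [F FT Foo] := product_sigma_finite lebesgue_measure mu.
exists (fun i => unconsrV @^-1` F i).
  by rewrite -preimage_bigcup -FT preimage_setT.
move=> i; have [mF Fi] := Foo i; split.
  by rewrite -[X in measurable X]setTI; exact: measurable_unconsrV.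
rewrite /lebesgue_rV_step /pushforward -comp_preimage.
by rewrite (_ : unconsrV \o consrV = id)//; apply/funext => p; exact: consrVK.
Qed.

HB.instance Definition _ :=
  Measure_isSigmaFinite.Build _ _ _ lebesgue_rV_step step_sigma_finite.

End lebesgue_rV_step.

Fixpoint lebesgue_rV (R : realType) (n : nat) :
    {sigma_finite_measure set 'rV[R]_n -> \bar R} :=
  if n is n'.+1 then lebesgue_rV_step (lebesgue_rV R n')
  else dirac (0 : 'rV[R]_0).

(* Elements of L^2(D) are represented by functions on the whole of R^n, of
   which only the values on D matter ([u \_ D] is u extended by 0 outside D);
   equality in L^2(D) is [ae_eq (lebesgue_rV R n) D], and subspaces of L^2(D)
   are sets of functions closed under it. *)

Section L2.
Context {R : realType} {n : nat}.
Implicit Types (D : set 'rV[R]_n) (u v : 'rV[R]_n -> R).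

Definition L2 D : set ('rV[R]_n -> R) :=
  [set u | u \_ D \in Lfun (lebesgue_rV R n) 2%:E].

Definition norm2 D u : R :=
  fine ('N[lebesgue_rV R n]_(2%:E) [EFin \o (u \_ D)])%E.

Definition dot2 D u v : R := \int[lebesgue_rV R n]_(x in D) (u x * v x).

Definition span_ae D (I : finType) (b : I -> 'rV[R]_n -> R) :
    set ('rV[R]_n -> R) :=
  [set u | L2 D u /\ exists c : I -> R,
    ae_eq (lebesgue_rV R n) D u (fun x => \sum_k c k * b k x)].

Definition has_dim D (V : set ('rV[R]_n -> R)) (d : nat) : Prop :=
  exists b : 'I_d -> 'rV[R]_n -> R,
    [/\ forall k, L2 D (b k),
        forall c : 'I_d -> R,
          ae_eq (lebesgue_rV R n) D (fun x => \sum_k c k * b k x) (cst 0) ->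
          forall k, c k = 0
      & V = span_ae D b].

Definition direct_sum_ae D (V1 V2 V : set ('rV[R]_n -> R)) : Prop :=
  V = [set u | L2 D u /\ exists v1 v2,
        [/\ V1 v1, V2 v2 & ae_eq (lebesgue_rV R n) D u (v1 \+ v2)]] /\
  forall u, V1 u -> V2 u -> ae_eq (lebesgue_rV R n) D u (cst 0).

End L2.

Section smooth.
Context {R : realType} {n : nat}.
Implicit Types (D U : set 'rV[R]_n) (f : 'rV[R]_n -> R).

Definition partial (i : 'I_n) f : 'rV[R]_n -> R :=
  fun x => 'D_(delta_mx ord0 i) f x.

Definition partials (a : seq 'I_n) f : 'rV[R]_n -> R := foldr partial f a.

Definition is_Ck U (k : nat) f : Prop :=
  forall a : seq 'I_n, (size a <= k)%N ->
    (forall x, U x -> {for x, continuous (partials a f)}) /\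
    ((size a < k)%N -> forall i x, U x ->
      derivable (partials a f) x (delta_mx ord0 i)).

Definition test_function D f : Prop :=
  (forall k, is_Ck setT k f) /\
  exists K, [/\ compact K, K `<=` D & forall x, ~ K x -> f x = 0].

(* The C^k boundary is given locally by a defining function rho with nonzero
   gradient; for k >= 1 this is equivalent to D being locally the subgraph of
   a C^k function. *)
Definition Ck_domain (k : nat) D : Prop :=
  [/\ open D, connected D, D !=set0, bounded_set D &
    forall x, (closure D `\` D) x ->
      exists U rho,
        [/\ open U, U x, is_Ck U k rho,
            forall y, U y -> exists i, partial i rho y != 0
          & D `&` U = [set y | U y /\ rho y < 0]]].

End smooth.

Section sobolev.
Context {R : realType} {n : nat}.
Implicit Types (D : set 'rV[R]_n) (u v w : 'rV[R]_n -> R) (a : 'I_n -> nat).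

Definition mi_partials a : ('rV[R]_n -> R) -> 'rV[R]_n -> R :=
  partials (flatten [seq nseq (a i) i | i <- enum 'I_n]).

Definition weak_derivative D a u w : Prop :=
  L2 D w /\ forall phi, test_function D phi ->
    dot2 D u (mi_partials a phi) = (- 1) ^+ (\sum_i a i)%N * dot2 D w phi.

Definition euclid (x : 'rV[R]_n) : R := Num.sqrt (\sum_i x ord0 i ^+ 2).

Definition slobodeckij_kernel (sigma : R) u v (z : 'rV[R]_n * 'rV[R]_n) : R :=
  (u z.1 - u z.2) * (v z.1 - v z.2) /
  euclid (z.1 - z.2) `^ (n%:R + sigma *+ 2).

Definition slobodeckij D sigma u v : R :=
  \int[(lebesgue_rV R n \x lebesgue_rV R n)%E]_(z in D `*` D)
    slobodeckij_kernel sigma u v z.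

Definition slobodeckij_finite D sigma u : Prop :=
  (\int[(lebesgue_rV R n \x lebesgue_rV R n)%E]_(z in D `*` D)
    (slobodeckij_kernel sigma u u z)%:E < +oo)%E.

(* H^s(D) for real s >= 0 carries the Sobolev-Slobodeckij norm. *)
Definition int_part (s : R) : nat := Num.truncn s.
Definition frac_part (s : R) : R := s - (int_part s)%:R.

(* An element of H^s(D) is a function together with its weak derivatives
   [sder a], |a| <= int_part s; these are determined by the function up to
   equality a.e. on D, and the values [sder a] for |a| > int_part s are
   irrelevant. *)
Record sobolev D (s : R) := Sobolev {
  sfun :> 'rV[R]_n -> R;
  sder : ('I_n -> nat) -> 'rV[R]_n -> R;
  sobolev_L2 : L2 D sfun;
  sobolev_der : forall a, (\sum_i a i <= int_part s)%N ->
    weak_derivative D a sfun (sder a);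
  sobolev_frac : 0 < frac_part s ->
    forall a, (\sum_i a i)%N = int_part s ->
    slobodeckij_finite D (frac_part s) (sder a) }.

Definition sob_dot D s (u v : sobolev D s) : R :=
  \sum_(a : {ffun 'I_n -> 'I_(int_part s).+1} | (\sum_i a i <= int_part s)%N)
    dot2 D (sder u (fun i => a i)) (sder v (fun i => a i)) +
  (if 0 < frac_part s then
    \sum_(a : {ffun 'I_n -> 'I_(int_part s).+1}
          | (\sum_i a i == int_part s)%N)
      slobodeckij D (frac_part s)
        (sder u (fun i => a i)) (sder v (fun i => a i))
   else 0).

Definition sob_norm D s (u : sobolev D s) : R := Num.sqrt (sob_dot u u).

End sobolev.

Section multiscale.
Context {R : realType} {n : nat}.

(* Order r means total degree < r. *)
Definition poly_order (r : nat) (p : 'rV[R]_n -> R) : Prop :=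
  exists c : {ffun 'I_n -> 'I_r} -> R,
    forall x, p x = \sum_(a : {ffun 'I_n -> 'I_r} | (\sum_i a i < r)%N)
                      c a * \prod_i x ord0 i ^+ a i.

Definition locally_contains N (cell : 'I_N -> set 'rV[R]_n)
    (V : set ('rV[R]_n -> R)) (r : nat) : Prop :=
  forall k p, poly_order r p ->
    exists2 v, V v & ae_eq (lebesgue_rV R n) (cell k) v p.

Record multiscale (D : set 'rV[R]_n) (r : nat) := Multiscale {
  msV : nat -> set ('rV[R]_n -> R);
  msW : nat -> set ('rV[R]_n -> R);
  ms_ncells : nat -> nat;
  ms_cell : forall j, 'I_(ms_ncells j) -> set 'rV[R]_n;
  ms_index : nat -> finType;
  psi : forall j, ms_index j -> 'rV[R]_n -> R;
  dpsi : forall j, ms_index j -> 'rV[R]_n -> R;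
  ms_dim : exists d : nat -> nat,
    (forall j, has_dim D (msV j) (d j)) /\
    exists c C : R, [/\ 0 < c, 0 < C &
      forall j, c * 2 ^+ (j * n) <= (d j)%:R <= C * 2 ^+ (j * n)];
  ms_nested : forall j, msV j `<=` msV j.+1;
  ms_dense : forall u, L2 D u -> forall e : R, 0 < e ->
    exists j, exists2 v, msV j v & norm2 D (u \- v) < e;
  (* the cells (j, k) form a mesh of D up to a null set *)
  ms_cell_open : forall j k, open (ms_cell (j := j) k) /\
    ms_cell k !=set0 /\ ms_cell k `<=` D;
  ms_cell_disjoint : forall j (k k' : 'I_(ms_ncells j)), k != k' ->
    ms_cell k `&` ms_cell k' = set0;
  ms_cell_cover : forall j, (lebesgue_rV R n).-negligible
    (D `\` \bigcup_(k : 'I_(ms_ncells j)) ms_cell k);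
  ms_piecewise : forall j v (k : 'I_(ms_ncells j)), msV j v ->
    exists q p, poly_order q p /\ ae_eq (lebesgue_rV R n) (ms_cell k) v p;
  ms_exact : forall j, locally_contains (ms_cell (j := j)) (msV j) r;
  ms_exact_max : forall r',
    (forall j, locally_contains (ms_cell (j := j)) (msV j) r') -> (r' <= r)%N;
  ms_jackson : forall s : R, 0 <= s <= r%:R -> exists C : R,
    forall j (u : sobolev D s),
      inf [set norm2 D (u \- v) | v in msV j] <=
        C * 2 `^ (- (j%:R * s)) * sob_norm u;
  ms_W0 : msW 0 = msV 0;
  ms_sum : forall j, direct_sum_ae D (msV j) (msW j.+1) (msV j.+1);
  ms_W_span : forall j, msW j = span_ae D (psi (j := j));
  psi_L2 : forall j (k : ms_index j), L2 D (psi k);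
  dpsi_L2 : forall j (k : ms_index j), L2 D (dpsi k);
  (* a family is a Riesz basis iff its span is dense and the L^2 norm of
     finite linear combinations is equivalent to the l^2 norm of coefficients;
     each index set being finite, finite combinations are those with j < J *)
  psi_riesz : exists c C : R, [/\ 0 < c, 0 < C &
    forall J (a : forall j, ms_index j -> R),
      c * \sum_(j < J) \sum_k a j k ^+ 2 <=
        norm2 D (fun x => \sum_(j < J) \sum_k a j k * psi k x) ^+ 2 <=
        C * \sum_(j < J) \sum_k a j k ^+ 2];
  psi_dense : forall u, L2 D u -> forall e : R, 0 < e ->
    exists J (a : forall j, ms_index j -> R),
      norm2 D (fun x => u x - \sum_(j < J) \sum_k a j k * psi k x) < e;
  psi_biorthogonal : forall j j' (k : ms_index j) (k' : ms_index j'),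
    dot2 D (psi k) (dpsi k') =
      (Tagged (fun j => ms_index j : Type) k ==
       Tagged (fun j => ms_index j : Type) k' :> {j & ms_index j})%:R;
  msQ_bound : forall s : R, 0 <= s <= r%:R -> exists C : R,
    forall j (u : sobolev D s),
      norm2 D (fun x => \sum_(k : ms_index j) dot2 D u (dpsi k) * psi k x) <=
        C * 2 `^ (- (j%:R * s)) * sob_norm u }.

End multiscale.

(* R^(n_1 + ... + n_m) is ['rV_(\sum_i n i)], and [submxrow x i] is the i-th
   block x_i of x. *)

Section products.
Context {R : realType} {m : nat}.
Variable n : 'I_m -> nat.

Definition prod_domain (Omega : forall i, set 'rV[R]_(n i)) :
    set 'rV[R]_(\sum_i n i) :=
  [set x | forall i, Omega i (submxrow x i)].

Definition blocks p (e : 'I_p -> 'I_m) (x : 'rV[R]_(\sum_i n i)) :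
    'rV[R]_(\sum_k n (e k)) :=
  \mxrow_(k < p) submxrow x (e k).

Variables (Omega : forall i, set 'rV[R]_(n i)) (s : 'I_m -> R).
Arguments Omega : clear implicits.

Record alg_tensor := AlgTensor {
  trank : nat;
  tfactor : 'I_trank -> forall i, sobolev (Omega i) (s i) }.

Definition tfun (t : alg_tensor) (x : 'rV[R]_(\sum_i n i)) : R :=
  \sum_(q < trank t) \prod_i tfactor q i (submxrow x i).

Definition tdot (t t' : alg_tensor) : R :=
  \sum_(q < trank t) \sum_(q' < trank t')
    \prod_i sob_dot (tfactor q i) (tfactor q' i).

Definition tnorm (t : alg_tensor) : R := Num.sqrt (tdot t t).

Definition tdist (t t' : alg_tensor) : R :=
  Num.sqrt (tdot t t - tdot t t' *+ 2 + tdot t' t').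

(* The completion of the algebraic tensor product, realised inside
   L^2(Omega_1 x ... x Omega_m): its elements are the L^2 limits of Cauchy
   sequences of algebraic tensors.  The completion embeds injectively in L^2,
   so that the limit of the norms depends on the limit function only. *)
Definition tensor_approx (f : 'rV[R]_(\sum_i n i) -> R)
    (t : nat -> alg_tensor) : Prop :=
  [/\ L2 (prod_domain Omega) f,
      forall e : R, 0 < e -> exists K, forall k k', (K <= k)%N -> (K <= k')%N ->
        tdist (t k) (t k') < e
    & (fun k => norm2 (prod_domain Omega) (f \- tfun (t k))) @ \oo --> (0 : R)].

Definition mixed_sobolev (f : 'rV[R]_(\sum_i n i) -> R) : Prop :=
  exists t, tensor_approx f t.

Definition mixed_norm (f : 'rV[R]_(\sum_i n i) -> R) : R :=
  get [set N : R | exists2 t, tensor_approx f t &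
                              (fun k => tnorm (t k)) @ \oo --> N].

End products.

(* On a nonempty finite family the infimum is the minimum. *)
Definition family_min (R : realType) p (a : 'I_p -> R) : R := inf (range a).

Definition min_count (R : realType) p (a : 'I_p -> R) : nat :=
  #|[pred k | a k == family_min a]|.

(* With indices starting from 0, the groups 1..l and l+1..m of the variables
   are {0, ..., l - 1} and {l, ..., m - 1}. *)

Definition group1 l m (lm : (l < m)%N) (k : 'I_l) : 'I_m :=
  widen_ord (ltnW lm) k.

Definition group2 l m (lm : (l < m)%N) (k : 'I_(m - l)) : 'I_m :=
  cast_ord (subnKC (ltnW lm)) (rshift l k).

(* Main.v *)
Require Import Defs.
From HB Require Import structures.
From mathcomp Require Import all_boot all_order all_algebra.
From mathcomp Require Import all_classical all_reals all_analysis.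
From mathcomp Require Import measurable_realfun zify ring lra.
Set Implicit Arguments.
Unset Strict Implicit.
Unset Printing Implicit Defensive.
Import Order.TTheory GRing.Theory Num.Theory.
Import numFieldNormedType.Exports.
Local Open Scope classical_set_scope.
Local Open Scope ring_scope.

(** The approximation truncates a tensor product wavelet expansion in each of
    the two groups of variables separately. Within a group, keep the wavelets
    of the level multi-indices [j] with [\sum_i j_i s_i <= a J], where [a] is
    the minimal ratio [s_i / n_i] of the group. If [P'] and [P''] denote the
    truncations of the groups, then [f] is approximated by
    [P' f + (I - P') P'' f]. Every product in this sum has a factor among the
    wavelets kept in one of the groups, so the rank is at most the sum, rather
    than the product, of the dimensions of the two ranges, whereas the error
    [(I - P') (I - P'') f] decays like the product of the two tails.

    In a group where [P] variables attain the minimal ratio, at most of order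
    [2 ^ J (1 + J) ^ (P - 1)] wavelets are kept ([sparse_grid_dim]): there are
    of order [2 ^ (\sum_i j_i n_i)] wavelets of level [j], and levels can be
    exchanged at no cost only between variables of minimal ratio. The sum of
    [4 ^ (- \sum_i j_i s_i)] over the dropped levels of a group of [p]
    variables is of order [4 ^ (- a J) (1 + J) ^ (p - 1)]
    ([sparse_grid_tail]). If [a] is zero, nothing is kept in the group and
    its tail is merely bounded ([group_tail]). Altogether the error is
    [2 ^ (- beta J) (1 + J) ^ ((m - 2) / 2)] for a rank of order
    [2 ^ J (1 + J) ^ (max P1 P2 - 1)], and taking the largest admissible [J]
    gives the rate ([choose_level]).

    All estimates are known in one variable only. What carries them to tensor
    products is the Schur product theorem: entrywise products of positive
    semidefinite kernels are monotone for the Loewner order ([psd_prod_le]).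
    The Gram matrix of tensor products is the entrywise product of the Gram
    matrices of the factors ([dot2_tensor]), so the upper Riesz bound of the
    wavelets passes to their tensor products ([tpartial_riesz]). The decay of
    the wavelet coefficients in the Sobolev norm is an inequality between two
    quadratic forms ([level_form_decay]), so on an algebraic tensor the energy
    of the coefficients outside both truncations is bounded by the two tails
    times the square of the cross norm ([tcoef_tail]).

    This proves the estimate for algebraic tensors
    ([low_rank_approx_level]), up to an arbitrarily small error due to the
    restriction to finitely many levels. An element [f] of the completion is
    then replaced by an algebraic tensor that is close to [f] in L2, and whose
    norm is less than twice that of [f]. *)

(** * Positive semidefinite kernels *)

Lemma discriminant_le (R : realFieldType) (A B D : R) : 0 <= D ->
  (forall t, 0 <= A + 2 * t * B + t ^+ 2 * D) -> B ^+ 2 <= A * D.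
Proof.
move=> D0 h; have [Dz|Dz] := eqVneq D 0.
  suff -> : B = 0 by rewrite Dz mulr0 expr0n.
  apply/eqP; apply: contraT => B0; have := h (- (A + 1) / (2 * B)).
  rewrite Dz mulr0 addr0 (_ : _ + _ = -1) ?ler0N1//.
  by field.
have Dp : 0 < D by rewrite lt_def Dz.
have := h (- B / D).
rewrite (_ : _ + _ = (A * D - B ^+ 2) / D).
  by rewrite pmulr_lge0 ?invr_gt0// subr_ge0.
by field.
Qed.

Section Psd.
Context {R : rcfType} {Q : finType}.
Implicit Types (A B : Q -> Q -> R) (x : Q -> R).

Definition qform A x : R := \sum_p \sum_q x p * x q * A p q.

Definition psd A : Prop :=
  (forall p q, A p q = A q p) /\ forall x, 0 <= qform A x.

(** The Loewner order. *)
Definition psd_le A B : Prop := psd (fun p q => B p q - A p q).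

Lemma eq_qform A B x : A =2 B -> qform A x = qform B x.
Proof. by move=> AB; apply: eq_bigr => p _; apply: eq_bigr => q _; rewrite AB. Qed.

Lemma qformD A B x : qform (fun p q => A p q + B p q) x = qform A x + qform B x.
Proof.
rewrite /qform -big_split/=; apply: eq_bigr => p _.
by rewrite -big_split/=; apply: eq_bigr => q _; rewrite mulrDr.
Qed.

Lemma qformZ c A x : qform (fun p q => c * A p q) x = c * qform A x.
Proof.
rewrite /qform mulr_sumr; apply: eq_bigr => p _.
by rewrite mulr_sumr; apply: eq_bigr => q _; rewrite mulrCA.
Qed.

Lemma qformB A B x : qform (fun p q => A p q - B p q) x = qform A x - qform B x.
Proof.
rewrite -[- qform B x]mulN1r -qformZ -qformD.
by apply: eq_qform => p q; rewrite mulN1r.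
Qed.

Lemma qform_rank1 (v : Q -> R) x :
  qform (fun p q => v p * v q) x = (\sum_p x p * v p) ^+ 2.
Proof.
rewrite expr2 mulr_suml; apply: eq_bigr => p _.
by rewrite mulr_sumr; apply: eq_bigr => q _; rewrite mulrACA.
Qed.

Lemma eq_psd A B : A =2 B -> psd A -> psd B.
Proof.
move=> AB [sA pA]; split=> [p q|x]; first by rewrite -!AB.
by rewrite -(eq_qform _ AB).
Qed.

Lemma psdD A B : psd A -> psd B -> psd (fun p q => A p q + B p q).
Proof.
move=> [sA pA] [sB pB]; split=> [p q|x]; first by rewrite sA sB.
by rewrite qformD addr_ge0.
Qed.

Lemma psdZ c A : 0 <= c -> psd A -> psd (fun p q => c * A p q).
Proof.
move=> c0 [sA pA]; split=> [p q|x]; first by rewrite sA.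
by rewrite qformZ mulr_ge0.
Qed.

Lemma psd0 : psd (fun _ _ => 0).
Proof.
by split=> // x; rewrite /qform big1// => p _; rewrite big1// => q _; rewrite mulr0.
Qed.

Lemma psd_rank1 (v : Q -> R) : psd (fun p q => v p * v q).
Proof. by split=> [p q|x]; [exact: mulrC|rewrite qform_rank1 sqr_ge0]. Qed.

Lemma psd_sum (I : Type) (r : seq I) (P : pred I) (F : I -> Q -> Q -> R) :
  (forall i, P i -> psd (F i)) -> psd (fun p q => \sum_(i <- r | P i) F i p q).
Proof.
move=> pF; elim: r => [|i r IH].
  by apply: eq_psd psd0 => p q; rewrite big_nil.
case Pi : (P i); last by apply: eq_psd IH => p q; rewrite big_cons Pi.
by apply: eq_psd (psdD (pF i Pi) IH) => p q; rewrite big_cons Pi.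
Qed.

Lemma psd_leP A B : psd_le A B -> forall x, qform A x <= qform B x.
Proof. by move=> [_ AB] x; rewrite -subr_ge0 -qformB. Qed.

Lemma psd_le_refl A : psd_le A A.
Proof. by apply: eq_psd psd0 => p q; rewrite subrr. Qed.

Lemma psd_le_trans A B C : psd_le A B -> psd_le B C -> psd_le A C.
Proof. by move=> AB BC; apply: eq_psd (psdD BC AB) => p q; rewrite subrKA. Qed.

Lemma psd_le_sum (I : Type) (r : seq I) (P : pred I) (F G : I -> Q -> Q -> R) :
  (forall i, P i -> psd_le (F i) (G i)) ->
  psd_le (fun p q => \sum_(i <- r | P i) F i p q)
         (fun p q => \sum_(i <- r | P i) G i p q).
Proof.
move=> FG; apply: eq_psd (psd_sum r FG) => p q.
by rewrite sumrB.
Qed.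

Lemma psd_diag_ge0 A p : psd A -> 0 <= A p p.
Proof.
move=> [_ /(_ (fun q => (q == p)%:R))]; rewrite /qform (bigD1 p)//= (bigD1 p)//=.
rewrite eqxx !mul1r !big1 ?addr0// => q /negbTE qp; last by rewrite qp mulr0 mul0r.
by rewrite big1// => q' _; rewrite qp !mul0r.
Qed.

Lemma qform2 A p q a b : psd A -> p != q ->
  qform A (fun k => a * (k == p)%:R + b * (k == q)%:R) =
  a ^+ 2 * A p p + 2 * a * b * A p q + b ^+ 2 * A q q.
Proof.
move=> [sA _] pq.
have E (F : Q -> R) :
    \sum_k (a * (k == p)%:R + b * (k == q)%:R) * F k = a * F p + b * F q.
  rewrite (eq_bigr (fun k => a * ((k == p)%:R * F k) + b * ((k == q)%:R * F k)));
    last by move=> k _; rewrite mulrDl !mulrA.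
  rewrite big_split/= -!mulr_sumr; congr (_ * _ + _ * _).
    rewrite (bigD1 p)//= eqxx mul1r big1 ?addr0// => k /negbTE ->.
    by rewrite mul0r.
  rewrite (bigD1 q)//= eqxx mul1r big1 ?addr0// => k /negbTE ->.
  by rewrite mul0r.
rewrite /qform (eq_bigr (fun k => (a * (k == p)%:R + b * (k == q)%:R) *
   (a * A k p + b * A k q))); last first.
  move=> k _; rewrite -[in RHS]E mulr_sumr; apply: eq_bigr => k' _.
  by rewrite mulrA.
by rewrite E (sA q p); ring.
Qed.

(** Otherwise the form restricted to [p] and [q] would be affine and not
    constant in the weight of [p], hence unbounded below. *)
Lemma psd_diag0 A p q : psd A -> A p p = 0 -> A p q = 0.
Proof.
move=> pA App; have [<-//|pq] := eqVneq p q.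
apply/eqP; apply: contraT => Apq.
have := pA.2 (fun k => (- (A q q + 1) / (2 * A p q)) * (k == p)%:R +
  1 * (k == q)%:R).
rewrite qform2// App mulr0 add0r expr1n mul1r mulr1.
suff -> : 2 * (- (A q q + 1) / (2 * A p q)) * A p q + A q q = -1.
  by rewrite ler0N1.
by field.
Qed.

(** Cholesky: eliminating one index with a positive diagonal entry splits off
    a rank one form and strictly shrinks the support of the diagonal. *)
Lemma psd_gram A : psd A ->
  exists s : seq (Q -> R), forall p q, A p q = \sum_(v <- s) v p * v q.
Proof.
move: {2}(#|[pred p | A p p != 0]|) (leqnn #|[pred p | A p p != 0]|) => N.
elim: N A => [|N IH] A.
  rewrite leqn0 => /eqP/card0_eq A0 pA; exists [::] => p q; rewrite big_nil.
  by apply: psd_diag0 => //; have := A0 p; rewrite !inE => /negbT; rewrite negbK => /eqP.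
have [[p0 p0A]|noA] := pselect (exists p, A p p != 0); last first.
  move=> _ pA; exists [::] => p q; rewrite big_nil; apply: psd_diag0 => //.
  by apply/eqP; apply: contrapT => Ap; apply: noA; exists p; apply/negP.
move=> cA pA.
have a0 : 0 < A p0 p0 by rewrite lt_def p0A psd_diag_ge0.
have sA := pA.1.
pose B p q := A p q - A p p0 * A q p0 / A p0 p0.
have pB : psd B.
  split=> [p q|x]; first by rewrite /B sA [A p p0 * _]mulrC.
  have h (t : R) : 0 <= qform A x + 2 * t * (\sum_p x p * A p p0) + t ^+ 2 * A p0 p0.
    have := pA.2 (fun p => x p + t * (p == p0)%:R).
    rewrite /qform.
    have E y (F : Q -> R) : \sum_k (y k + t * (k == p0)%:R) * F k =
        \sum_k y k * F k + t * F p0.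
      rewrite (eq_bigr (fun k => y k * F k + t * ((k == p0)%:R * F k)));
        last by move=> k _; rewrite mulrDl !mulrA.
      rewrite big_split/= -!mulr_sumr; congr (_ + _ * _).
      rewrite (bigD1 p0)//= eqxx mul1r big1 ?addr0// => k /negbTE ->.
      by rewrite mul0r.
    rewrite (eq_bigr (fun k => (x k + t * (k == p0)%:R) *
      (\sum_q x q * A k q + t * A k p0))); last first.
      move=> k _; rewrite -E mulr_sumr; apply: eq_bigr => k' _.
      by rewrite mulrA.
    rewrite E => /le_trans; apply.
    rewrite (eq_bigr (fun k => \sum_q x k * x q * A k q + t * (x k * A k p0)));
      last first.
      move=> k _; rewrite mulrDr mulr_sumr mulrCA; congr (_ + _).
      by apply: eq_bigr => q _; rewrite mulrA.
    rewrite big_split/= -mulr_sumr.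
    rewrite [\sum_q x q * A p0 q](eq_bigr (fun q => x q * A q p0)).
      rewrite le_eqVlt; apply/orP; left; apply/eqP; ring.
    by move=> q _; rewrite (sA p0).
  have := h (- (\sum_p x p * A p p0) / A p0 p0).
  rewrite (_ : qform B x = qform A x - (A p0 p0)^-1 * (\sum_p x p * A p p0) ^+ 2).
    move/le_trans; apply; rewrite le_eqVlt; apply/orP; left; apply/eqP.
    by field.
  rewrite -qform_rank1 -qformZ -qformB; apply: eq_qform => p q.
  by rewrite /B [_ / _]mulrC.
have [|s sE] := IH B _ pB.
  rewrite -ltnS; apply: leq_trans cA; apply: proper_card.
  apply/properP; split; last first.
    exists p0; rewrite !inE ?p0A// negbK /B; apply/eqP; field.
    exact: p0A.
  apply/fintype.subsetP => p; rewrite !inE; apply: contra => /eqP Ap.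
  by rewrite /B Ap (psd_diag0 _ pA Ap) mul0r mul0r subr0.
exists ((fun p => A p p0 / Num.sqrt (A p0 p0)) :: s) => p q.
rewrite big_cons -sE /B mulf_div -expr2 sqr_sqrtr ?(ltW a0)//.
by rewrite addrC subrK.
Qed.

(** The Schur product theorem: a sum of rank one forms times [B] is a sum of
    rescalings of [B]. *)
Lemma psdM A B : psd A -> psd B -> psd (fun p q => A p q * B p q).
Proof.
move=> /psd_gram[s sE] pB; apply: (@eq_psd
  (fun p q => \sum_(v <- s) v p * v q * B p q)) => [p q|].
  by rewrite sE mulr_suml.
apply: psd_sum => v _; split=> [p q|x]; first by rewrite pB.1 [v p * _]mulrC.
have := pB.2 (fun p => x p * v p); rewrite /qform => /le_trans; apply.
by rewrite le_eqVlt; apply/orP; left; apply/eqP; apply: eq_bigr => p _;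
  apply: eq_bigr => q _; ring.
Qed.

(** Entrywise products of positive semidefinite kernels are monotone: the
    difference telescopes into Schur products of positive semidefinite
    kernels. *)
Lemma psd_prod_le (I : Type) (r : seq I) (A B : I -> Q -> Q -> R) :
  (forall i, psd (A i)) -> (forall i, psd_le (A i) (B i)) ->
  psd (fun p q => \prod_(i <- r) A i p q) /\
  psd_le (fun p q => \prod_(i <- r) A i p q) (fun p q => \prod_(i <- r) B i p q).
Proof.
move=> pA AB; elim: r => [|i r [pr lr]].
  split; last by apply: eq_psd psd0 => p q; rewrite !big_nil subrr.
  by apply: eq_psd (psd_rank1 (cst 1)) => p q; rewrite big_nil mulr1.
have pB : psd (B i).
  by apply: eq_psd (psdD (pA i) (AB i)) => p q; rewrite addrC subrK.
split; first by apply: eq_psd (psdM (pA i) pr) => p q; rewrite big_cons.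
apply: eq_psd (psdD (psdM (AB i) pr) (psdM pB lr)) => p q.
by rewrite !big_cons; ring.
Qed.

Lemma psd_le_prod (I : Type) (r : seq I) (A B : I -> Q -> Q -> R) :
  (forall i, psd (A i)) -> (forall i, psd_le (A i) (B i)) ->
  psd_le (fun p q => \prod_(i <- r) A i p q) (fun p q => \prod_(i <- r) B i p q).
Proof. by move=> pA AB; have [] := psd_prod_le r pA AB. Qed.

Lemma psd_prod (I : Type) (r : seq I) (A : I -> Q -> Q -> R) :
  (forall i, psd (A i)) -> psd (fun p q => \prod_(i <- r) A i p q).
Proof. by move=> pA; have [] := psd_prod_le r pA (fun i => psd_le_refl (A i)). Qed.
End Psd.

(** * Sparse grid sums *)

Section Slicing.
Context {R : realType} {p B : nat} (i0 : 'I_p).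
Implicit Types (j : {ffun 'I_p -> 'I_B}) (F : {ffun 'I_p -> 'I_B} -> R).

Definition upd j (x : 'I_B) : {ffun 'I_p -> 'I_B} :=
  [ffun i => if i == i0 then x else j i].

(** The slices in direction [i0] are indexed by the multi-indices whose [i0]
    coordinate is pinned to an arbitrary [z]. *)
Lemma sum_slice F (z : 'I_B) :
  \sum_j F j = \sum_(j : {ffun 'I_p -> 'I_B} | j i0 == z) \sum_x F (upd j x).
Proof.
rewrite (partition_big (fun j => upd j z)
  (fun j : {ffun 'I_p -> 'I_B} => j i0 == z)) /=; last first.
  by move=> j _; rewrite ffunE eqxx.
apply: eq_bigr => j /eqP jz.
rewrite (reindex_onto (upd j) (fun j' : {ffun 'I_p -> 'I_B} => j' i0)) /=; last first.
  move=> j' /eqP j'j; apply/ffunP => i; rewrite !ffunE; case: eqP => [->//|/eqP ii].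
  by rewrite -j'j ffunE (negbTE ii).
apply: eq_bigl => x; rewrite ffunE eqxx eqxx andbT; apply/eqP/ffunP => i.
by rewrite !ffunE; case: eqP => // ->; rewrite jz.
Qed.

(** The remaining coordinates vary freely over the slices, so the sum of the
    bounds distributes into a product of sums over one coordinate. *)
Lemma le_sum_slice F (G : 'I_p -> 'I_B -> R) (E : R) : 0 <= E ->
  (forall i x, 0 <= G i x) ->
  (forall j, \sum_x F (upd j x) <= E * \prod_(i | i != i0) G i (j i)) ->
  \sum_j F j <= E * \prod_(i | i != i0) \sum_x G i x.
Proof.
move=> E0 G0 FE.
have RHS0 : 0 <= E * \prod_(i | i != i0) \sum_x G i x.
  by rewrite mulr_ge0// prodr_ge0// => i _; exact: sumr_ge0.
have [B0|B0] := posnP B.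
  rewrite big1// => j _; exfalso.
  by have := ltn_ord (j i0); rewrite [X in (_ < X)%N]B0.
pose z : 'I_B := Ordinal B0.
rewrite (sum_slice F z).
apply: le_trans (ler_sum _ (fun j _ => FE j)) _.
rewrite -mulr_sumr ler_wpM2l//.
pose G' i x : R := if i == i0 then (x == z)%:R else G i x.
have -> : \prod_(i | i != i0) \sum_x G i x = \prod_i \sum_x G' i x.
  have EG : \sum_x G' i0 x = 1.
    rewrite (bigD1 z)//= big1 /G' ?eqxx ?addr0//.
    by move=> x /negbTE ->; rewrite ?eqxx.
  rewrite [RHS](bigD1 i0)//= EG mul1r.
  by apply: eq_bigr => i /negbTE ii; apply: eq_bigr => x _; rewrite /G' ii.
rewrite bigA_distr_bigA/= big_mkcond le_eqVlt; apply/orP; left; apply/eqP.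
apply: eq_bigr => j _; rewrite [RHS](bigD1 i0)//= {1}/G' eqxx.
case: ifP => _; last by rewrite mul0r.
by rewrite mul1r; apply: eq_bigr => i /negbTE; rewrite /G' => ->.
Qed.

End Slicing.

Section Geometric.
Context {R : realType}.

Lemma geo_sum (q : R) B : 0 < q -> q < 1 -> \sum_(x < B) q ^+ x <= (1 - q)^-1.
Proof.
move=> q0 q1; have q1' : 0 < 1 - q by rewrite subr_gt0.
elim: B => [|B IH]; first by rewrite big_ord0 invr_ge0 ltW.
rewrite big_ord_recl expr0 (eq_bigr (fun x : 'I_B => q * q ^+ x)); last first.
  by move=> x _; rewrite exprS.
rewrite -mulr_sumr.
have -> : (1 - q)^-1 = 1 + q * (1 - q)^-1 by field; rewrite gt_eqF.
by rewrite lerD2l ler_pM2l.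
Qed.

(** A geometric sum is governed by its largest term. *)
Lemma geo_tail (q M : R) B (P : pred nat) : 0 < q -> q < 1 -> 0 <= M ->
  (forall x, P x -> q ^+ x <= M) ->
  \sum_(x < B | P x) q ^+ x <= M / (1 - q).
Proof.
move=> q0 q1; have q1' : 0 < 1 - q by rewrite subr_gt0.
elim: B P M => [|B IH] P M M0 PM.
  by rewrite big_ord0 divr_ge0// ltW.
case P0 : (P 0%N).
  apply: (@le_trans _ _ (\sum_(x < B.+1) q ^+ x)).
    rewrite [leLHS]big_mkcond; apply: ler_sum => x _; case: ifP => // _.
    by rewrite exprn_ge0// ltW.
  apply: le_trans (geo_sum _ q0 q1) _.
  apply: ler_peMl; first by rewrite invr_ge0 ltW.
  by have := PM 0%N P0; rewrite expr0.
rewrite big_mkcond big_ord_recl/= P0 add0r -big_mkcond/=.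
rewrite (eq_bigr (fun x : 'I_B => q * q ^+ x)); last first.
  by move=> x _; rewrite exprS.
rewrite -mulr_sumr -ler_pdivlMl// mulrA.
apply: (IH (fun x => P x.+1)); first by rewrite mulr_ge0// invr_ge0 ltW.
by move=> x /PM; rewrite exprS -ler_pdivlMl.
Qed.

(** Twice the largest term bounds the sum, as each term is at least twice the
    previous one. *)
Lemma geo_head (g M : R) B (P : pred nat) : 2 <= g -> 0 <= M ->
  (forall x, P x -> g ^+ x <= M) -> \sum_(x < B | P x) g ^+ x <= 2 * M.
Proof.
move=> g2 M0; have g0 : 0 <= g by apply: le_trans g2.
have full N : \sum_(x < N.+1) g ^+ x <= 2 * g ^+ N.
  elim: N => [|N IH]; first by rewrite big_ord1 expr0; lra.
  rewrite big_ord_recr/=; apply: le_trans (lerD IH (lexx _)) _.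
  have : 2 * g ^+ N <= g ^+ N.+1 by rewrite exprS ler_wpM2r// exprn_ge0.
  by lra.
elim: B => [|B IH] PM; first by rewrite big_ord0 mulr_ge0.
case PB : (P B); last first.
  by rewrite big_mkcond big_ord_recr/= PB addr0 -big_mkcond; exact: IH.
apply: le_trans (_ : \sum_(x < B.+1) g ^+ x <= _).
  rewrite [leLHS]big_mkcond; apply: ler_sum => x _; case: ifP => // _.
  exact: exprn_ge0.
by apply: le_trans (full B) _; rewrite ler_pM2l//; exact: PM.
Qed.

End Geometric.

Section Counting.
Context {R : realType} {p : nat} (n : 'I_p -> nat) (s : 'I_p -> R).
Variables (a : R) (i0 : 'I_p).
Hypotheses (a0 : 0 < a) (n0 : forall i, (0 < n i)%N)
  (sa : forall i, a * (n i)%:R <= s i) (si0 : s i0 = a * (n i0)%:R).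

Definition wlevel B (j : {ffun 'I_p -> 'I_B}) : R := \sum_i (j i)%:R * s i.

Let s0 i : 0 < s i.
Proof. by apply: lt_le_trans (sa i); rewrite mulr_gt0// ltr0n. Qed.

Let L : R := ln 2.
Let L0 : 0 < L. Proof. by rewrite ln_gt0// ltr1n. Qed.

Let pow2E (x : R) : 2 `^ x = expR (x * L).
Proof. by rewrite /powR pnatr_eq0. Qed.

Let wlevel_upd B (j : {ffun 'I_p -> 'I_B}) x :
  wlevel (upd i0 j x) = x%:R * s i0 + \sum_(i | i != i0) (j i)%:R * s i.
Proof.
rewrite /wlevel (bigD1 i0)//= ffunE eqxx; congr (_ + _).
by apply: eq_bigr => i /negbTE ii; rewrite ffunE ii.
Qed.

Let prod_upd B (j : {ffun 'I_p -> 'I_B}) x (h : 'I_p -> nat -> R) :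
  \prod_i h i (upd i0 j x i) = h i0 x * \prod_(i | i != i0) h i (j i).
Proof.
rewrite (bigD1 i0)//= ffunE eqxx; congr (_ * _).
by apply: eq_bigr => i /negbTE ii; rewrite ffunE ii.
Qed.

Let minimal i := s i == a * (n i)%:R.

Let expR_nat (x : R) (k : nat) : expR x ^+ k = expR (k%:R * x).
Proof. by rewrite mulrC expRM_natr. Qed.

Let card_minimal (x : R) :
  \prod_(i | (i != i0) && minimal i) x = x ^+ (#|minimal|.-1).
Proof.
rewrite prodr_const; congr (_ ^+ _).
rewrite [in RHS](cardD1 i0) /=.
have -> : i0 \in minimal by apply/eqP.
rewrite add1n /=; apply: eq_card => i; by rewrite !inE.
Qed.

(** Sum first over the coordinate [i0] that attains the minimal ratio: the
    geometric sum is governed by its last term, which leaves a factor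
    [2 ^ (n i - s i / a) <= 1] per unit of every other coordinate. The sum over
    such a coordinate is bounded if the factor is less than 1; it has at most
    [1 + J] terms if the coordinate attains the minimal ratio too. *)
Lemma sparse_grid_dim : exists2 C : R, 0 < C & forall (J B : nat),
  \sum_(j : {ffun 'I_p -> 'I_B} | wlevel j <= a * J%:R)
     \prod_i 2 ^+ (j i * n i) <= C * 2 ^+ J * (1 + J%:R) ^+ (#|minimal|.-1).
Proof.
pose h i : R := expR (((n i)%:R - s i / a) * L).
have h1 i : ~~ minimal i -> h i < 1.
  move=> mi; rewrite -expR0 ltr_expR pmulr_llt0// subr_lt0 ltr_pdivlMr//.
  by rewrite mulrC lt_def sa andbT.
have h1' i : minimal i -> h i = 1.
  by move=> /eqP mi; rewrite /h mi mulrAC mulfV ?gt_eqF// mul1r subrr mul0r expR0.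
pose c : R := \prod_(i | (i != i0) && ~~ minimal i) (1 - h i)^-1.
have c0 : 0 < c by apply: prodr_gt0 => i /andP[_ /h1 hi]; rewrite invr_gt0 subr_gt0.
exists (2 * c) => [|J B]; first by rewrite mulr_gt0.
rewrite big_mkcond/=.
pose G i (x : 'I_B) : R := if (x <= J)%N then h i ^+ x else 0.
have G0 i x : 0 <= G i x by rewrite /G; case: ifP => // _; rewrite exprn_ge0// expR_ge0.
apply: le_trans (@le_sum_slice _ _ _ i0 _ G (2 * 2 ^+ J) _ G0 _) _.
- by rewrite mulr_ge0// exprn_ge0.
- move=> j; set y := \sum_(i | i != i0) (j i)%:R * s i.
  rewrite -big_mkcond/=.
  under eq_bigl do rewrite wlevel_upd -/y.
  under eq_bigr do rewrite (prod_upd _ _ (fun i x => 2 ^+ (x * n i))).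
  rewrite -mulr_suml.
  have [jJ|jJ] := boolP [forall i, (i != i0) ==> (j i <= J)%N]; last first.
    rewrite big1 ?mul0r.
      by rewrite mulr_ge0 ?prodr_ge0// mulr_ge0// exprn_ge0.
    move=> x; move: jJ; rewrite negb_forall => /existsP[i].
    rewrite negb_imply -ltnNge => /andP[ii iJ] le; exfalso.
    move: le; rewrite leNgt => /negP; apply.
    apply: lt_le_trans (_ : (j i)%:R * s i <= _).
      rewrite mulrC; apply: lt_le_trans (_ : (j i)%:R * a <= _).
        by rewrite ltr_pM2r// ltr_nat.
      rewrite ler_wpM2l//; apply: le_trans (sa i).
      by rewrite ler_peMr ?(ltW a0)// ler1n.
    rewrite /y (bigD1 i)//= addrCA lerDl addr_ge0//.
      by rewrite mulr_ge0// ltW.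
    by apply: sumr_ge0 => k _; rewrite mulr_ge0// ltW.
  have {}jJ i : i != i0 -> (j i <= J)%N by move/forallP: jJ => /(_ i)/implyP.
  pose M : R := expR ((J%:R - y / a) * L).
  have HM : \sum_(x < B | x%:R * s i0 + y <= a * J%:R) (2 ^+ (x * n i0) : R) <= 2 * M.
    under eq_bigr do rewrite mulnC exprM.
    apply: (@geo_head _ _ M B (fun x => x%:R * s i0 + y <= a * J%:R)).
    - rewrite -[leLHS]expr1 ler_weXn2l ?ler1n//.
    - exact: expR_ge0.
    move=> x; rewrite si0 -exprM /M => H.
    have -> : 2 = expR L :> R by rewrite lnK// posrE.
    rewrite expR_nat ler_expR ler_pM2r//.
    rewrite -(ler_pM2l a0) mulrBr mulrCA mulfV ?gt_eqF// mulr1 natrM.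
    by move: H; rewrite -lerBrDr; congr (_ <= _); ring.
  apply: le_trans (ler_wpM2r _ HM) _.
    by apply: prodr_ge0 => i _; rewrite exprn_ge0.
  rewrite -!mulrA ler_pM2l// /M mulrBl expRD.
  rewrite (_ : expR (J%:R * L) = 2 ^+ J); last by rewrite -expR_nat lnK// posrE.
  rewrite -mulrA ler_wpM2l ?exprn_ge0//.
  rewrite /y mulr_suml -mulNr -sumrN mulr_suml expR_sum -big_split/=.
  rewrite le_eqVlt; apply/orP; left; apply/eqP; apply: eq_bigr => i ii.
  rewrite /G jJ// /h expR_nat.
  have -> : 2 = expR L :> R by rewrite lnK// posrE.
  rewrite expR_nat -expRD natrM; congr expR.
  by ring.
rewrite [leRHS](_ : _ = 2 * 2 ^+ J * (c * (1 + J%:R) ^+ (#|minimal|.-1)));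
  last by ring.
apply: ler_wpM2l; first by rewrite mulr_ge0// exprn_ge0.
rewrite (bigID minimal)/= mulrC; apply: ler_pM.
- by apply: prodr_ge0 => i _; exact: sumr_ge0.
- by apply: prodr_ge0 => i _; exact: sumr_ge0.
- apply: ler_prod => i /andP[_ mi]; rewrite sumr_ge0//=.
  apply: le_trans (geo_sum B (expR_gt0 _) (h1 i mi)).
  by apply: ler_sum => x _; rewrite /G; case: ifP.
- rewrite -card_minimal; apply: ler_prod => i /andP[_ mi]; rewrite sumr_ge0//=.
  rewrite /G h1'//; under eq_bigr do rewrite expr1n.
  apply: (@le_trans _ _ (\sum_(x < J.+1) 1)); last first.
    by rewrite sumr_const card_ord -natr1 addrC.
  have [BJ|BJ] := leqP B J.+1.
    rewrite (big_ord_widen J.+1 (fun x => if (x <= J)%N then 1 else 0) BJ).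
    by rewrite big_mkcond; apply: ler_sum => x _; case: ifP => // _; case: ifP.
  by rewrite (big_ord_widen B (fun=> 1) (ltnW BJ)) [leRHS]big_mkcond/=.
Qed.

Lemma decay_expr i (x : nat) :
  (2 `^ (- (x%:R * s i))) ^+ 2 = expR (- (2 * L * (x%:R * s i))).
Proof. by rewrite pow2E expR_nat; congr expR; ring. Qed.

(** [1 / (1 - exp (- t)) <= 1 + 1 / t]. *)
Let geo_inv (t : R) : 0 < t -> (1 - expR (- t))^-1 <= 1 + t^-1.
Proof.
move=> t0; have e1 : 1 + t <= expR t := expR_ge1Dx t.
have h : expR (- t) <= (1 + t)^-1.
  by rewrite expRN lef_pV2 ?posrE ?expR_gt0 ?addr_gt0.
have -> : 1 + t^-1 = (1 - (1 + t)^-1)^-1.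
  have -> : 1 - (1 + t)^-1 = t / (1 + t) by field; rewrite gt_eqF ?addr_gt0.
  by field; rewrite !gt_eqF ?addr_gt0// ?divr_gt0 ?addr_gt0.
have p1 : (1 + t)^-1 < 1 by rewrite invf_lt1 ?addr_gt0// ltrDl.
by rewrite lef_pV2 ?posrE ?subr_gt0 ?(le_lt_trans h)// lerD2l lerN2.
Qed.

(** Beyond the threshold [X = a J], the geometric sum over the coordinate [i0]
    leaves [4 ^ (- max (X, y))], [y] being the level of the remaining
    coordinates, and [max (X, y) >= (1 - d) X + d y] with [d = 1 / (1 + J)]
    makes the sum over these coordinates a product of geometric series, each
    of order [1 + J], at the cost of a bounded factor. *)
Lemma sparse_grid_tail : exists2 C : R, 0 < C & forall (J B : nat),
  \sum_(j : {ffun 'I_p -> 'I_B} | ~~ (wlevel j <= a * J%:R))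
     \prod_i (2 `^ (- ((j i)%:R * s i))) ^+ 2 <=
  C * (2 `^ (- (a * J%:R))) ^+ 2 * (1 + J%:R) ^+ p.-1.
Proof.
pose T : R := 2 * L.
have T0 : 0 < T by rewrite mulr_gt0.
pose q : R := expR (- (T * s i0)).
have q0 : 0 < q by exact: expR_gt0.
have q1 : q < 1 by rewrite -expR0 ltr_expR oppr_lt0 mulr_gt0.
pose c : R := \prod_(i | i != i0) (1 + (T * s i)^-1).
have c0 : 0 < c by apply: prodr_gt0 => i _; rewrite addr_gt0// invr_gt0 mulr_gt0.
exists (expR (T * a) / (1 - q) * c) => [|J B].
  by rewrite mulr_gt0// divr_gt0 ?expR_gt0// subr_gt0.
rewrite big_mkcond/=.
pose X : R := a * J%:R.
pose d : R := (1 + J%:R)^-1.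
have J1 : 0 < 1 + J%:R :> R by rewrite ltr_pwDl.
have d0 : 0 < d by rewrite invr_gt0.
have d1 : d <= 1 by rewrite invf_le1// lerDl.
pose G i (x : 'I_B) : R := expR (- (T * d * s i)) ^+ x.
have G0 i x : 0 <= G i x by rewrite exprn_ge0// expR_ge0.
pose E : R := expR (T * a) / (1 - q) * expR (- (T * X)).
have E0 : 0 <= E by rewrite mulr_ge0 ?expR_ge0// divr_ge0 ?expR_ge0// subr_ge0 ltW.
apply: le_trans (@le_sum_slice _ _ _ i0 _ G E E0 G0 _) _.
- move=> j; set y := \sum_(i | i != i0) (j i)%:R * s i.
  rewrite -big_mkcond/=.
  under eq_bigl do rewrite wlevel_upd -/y.
  under eq_bigr do rewrite (prod_upd _ _ (fun i x => (2 `^ (- (x%:R * s i))) ^+ 2)).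
  rewrite -mulr_suml.
  pose M : R := expR (T * ((1 - d) * (y - X))).
  have HM : \sum_(x < B | ~~ (x%:R * s i0 + y <= X)) (2 `^ (- (x%:R * s i0))) ^+ 2
      <= M / (1 - q).
    rewrite (eq_bigr (fun x : 'I_B => q ^+ x)); last first.
      by move=> x _; rewrite decay_expr /q expR_nat; congr expR; rewrite /T; ring.
    apply: (@geo_tail _ _ M B (fun x => ~~ (x%:R * s i0 + y <= X))) => //.
      exact: expR_ge0.
    move=> x; rewrite -ltNge => H; rewrite /q /M expR_nat ler_expR.
    rewrite (_ : _ * - _ = T * - (x%:R * s i0)); last by ring.
    rewrite ler_pM2l//.
    have x0 : 0 <= x%:R * s i0 by rewrite mulr_ge0// ltW.
    have [yX|yX] := leP 0 (y - X).
      apply: (@le_trans _ _ 0); first by rewrite oppr_le0.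
      by rewrite mulr_ge0// subr_ge0.
    apply: (@le_trans _ _ (y - X)); first by move: H; lra.
    by rewrite mulrBl mul1r lerDl oppr_ge0 nmulr_lle0// ltW.
  apply: le_trans (ler_wpM2r _ HM) _.
    by apply: prodr_ge0 => i _; rewrite sqr_ge0.
  rewrite (eq_bigr (fun i => expR (- (T * ((j i)%:R * s i))))); last first.
    by move=> i _; rewrite decay_expr.
  have -> : \prod_(i | i != i0) G i (j i) =
      \prod_(i | i != i0) expR (- (T * d * ((j i)%:R * s i))).
    by apply: eq_bigr => i _; rewrite /G expR_nat; congr expR; ring.
  rewrite -!expR_sum !sumrN -!mulr_sumr -/y.
  have -> : M / (1 - q) * expR (- (T * y)) =
      expR (T * ((1 - d) * (y - X)) - T * y) / (1 - q) by rewrite expRD /M; ring.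
  have -> : E * expR (- (T * d * y)) =
      expR (T * a - T * X - T * d * y) / (1 - q) by rewrite !expRD /E; ring.
  rewrite ler_pM2r ?invr_gt0 ?subr_gt0// ler_expR.
  rewrite -subr_ge0 (_ : _ - _ = T * (a - d * X)); last by ring.
  apply: mulr_ge0; first exact: ltW.
  rewrite subr_ge0 /X mulrCA ler_piMr ?(ltW a0)// /d mulrC ler_pdivrMr// mul1r.
  by rewrite lerDr.
- rewrite [leRHS](_ : _ = E * (c * (1 + J%:R) ^+ p.-1)); last first.
    by rewrite (_ : (2 `^ (- (a * J%:R))) ^+ 2 = expR (- (T * X)));
      [rewrite /E|rewrite pow2E expR_nat; congr expR; rewrite /T /X]; ring.
  apply: ler_wpM2l => //.
  have -> : (1 + J%:R) ^+ p.-1 = \prod_(i < p | i != i0) (1 + J%:R) :> R.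
    by rewrite prodr_const cardC1 card_ord.
  rewrite /c -big_split/=; apply: ler_prod => i _; rewrite sumr_ge0//=.
  have t0 : 0 < T * d * s i by rewrite !mulr_gt0.
  apply: le_trans (geo_sum B (expR_gt0 _) _) _.
    by rewrite -expR0 ltr_expR oppr_lt0.
  apply: le_trans (geo_inv t0) _.
  rewrite (_ : (T * d * s i)^-1 = (T * s i)^-1 * (1 + J%:R)); last first.
    by rewrite /d; field; rewrite !gt_eqF.
  by rewrite mulrDl mul1r lerD2r lerDl.
Qed.

End Counting.

(** * Square integrable functions on a set *)

Section L2Theory.
Context {R : realType} {n : nat}.
Implicit Types (D : set 'rV[R]_n) (u v w : 'rV[R]_n -> R).
Local Notation mu := (lebesgue_rV R n).

Lemma L2P D u : L2 D u <-> measurable_fun setT (u \_ D) /\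
  mu.-integrable setT (EFin \o (fun x => (u \_ D) x ^+ 2)).
Proof.
rewrite /L2 /=; split=> [uL|[mu_ iu]].
  split; last exact: Lfun2_integrable_sqr.
  by move: uL => /sub_Lfun_mfun; rewrite inE.
rewrite inE; apply/andP; split; first by rewrite inE.
rewrite inE /= /finite_norm unlock /=; apply: poweR_lty.
under eq_integral do rewrite powR_mulrn// real_normK ?num_real//.
have /integrableP[_] := iu; congr (_ < _)%E; apply: eq_integral => x _.
by rewrite /= ger0_norm ?sqr_ge0.
Qed.

Lemma L2_measurable D u : L2 D u -> measurable_fun setT (u \_ D).
Proof. by move/L2P => -[]. Qed.

Lemma patchE0 D u x : (u \_ D) x = if x \in D then u x else 0.
Proof. by rewrite patchE. Qed.

Lemma patchD D u v : (u \+ v) \_ D = (u \_ D) \+ (v \_ D).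
Proof. by apply/funext => x; rewrite /= !patchE0; case: ifP => //=; rewrite addr0. Qed.

Lemma patchZ D c u : (c \*o u) \_ D = c \*o (u \_ D).
Proof. by apply/funext => x; rewrite /= !patchE0; case: ifP => //=; rewrite mulr0. Qed.

Lemma patchM D u v : (u \* v) \_ D = (u \_ D) \* (v \_ D).
Proof. by apply/funext => x; rewrite /= !patchE0; case: ifP => //=; rewrite mulr0. Qed.

Lemma patch_cst0 D : (cst 0 : 'rV[R]_n -> R) \_ D = cst 0.
Proof. by apply/funext => x; rewrite patchE0; case: ifP. Qed.

Lemma L20 D : L2 D (cst 0).
Proof.
apply/L2P; rewrite patch_cst0; split; first exact: measurable_cst.
rewrite (_ : _ \o _ = cst 0%E); first exact: integrable0.
by apply/funext => x; rewrite /= expr0n.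
Qed.

Lemma L2D D u v : L2 D u -> L2 D v -> L2 D (u \+ v).
Proof.
rewrite /L2/= patchD => uL vL.
have h12 : (1 <= 2%:E :> \bar R)%E by rewrite lee_fin ler1n.
exact: (Lfun_addr_closed mu h12).2.
Qed.

Lemma L2Z D c u : L2 D u -> L2 D (c \*o u).
Proof.
rewrite /L2/= patchZ => /(@Lfun_scale _ _ _ mu _ c) H.
rewrite (_ : _ \*o _ = c \o* (u \_ D)); first by apply: H; rewrite ler1n.
by apply/funext => x /=; rewrite mulrC.
Qed.

Lemma L2_sum D (I : Type) (s : seq I) (P : pred I) (F : I -> 'rV[R]_n -> R) :
  (forall i, P i -> L2 D (F i)) -> L2 D (fun x => \sum_(i <- s | P i) F i x).
Proof.
move=> FL; elim: s => [|i s IH].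
  by rewrite (_ : (fun _ => _) = cst 0); [exact: L20|apply/funext => x; rewrite big_nil].
case Pi : (P i); last first.
  by rewrite (_ : (fun _ => _) = (fun x => \sum_(i <- s | P i) F i x))//;
    apply/funext => x; rewrite big_cons Pi.
rewrite (_ : (fun _ => _) = F i \+ (fun x => \sum_(i <- s | P i) F i x)).
  by apply: L2D => //; exact: FL.
by apply/funext => x; rewrite big_cons Pi.
Qed.

Lemma L2_lin D (I : Type) (s : seq I) (P : pred I) (a : I -> R)
    (F : I -> 'rV[R]_n -> R) :
  (forall i, P i -> L2 D (F i)) -> L2 D (fun x => \sum_(i <- s | P i) a i * F i x).
Proof. by move=> FL; apply: L2_sum => i Pi; exact: L2Z (FL i Pi). Qed.

Lemma L2B D u v : L2 D u -> L2 D v -> L2 D (u \- v).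
Proof.
move=> uL vL; rewrite (_ : u \- v = u \+ (-1) \*o v); first exact: L2D (L2Z _ _).
by apply/funext => x /=; rewrite mulN1r.
Qed.

Lemma L2_integrable D u v : L2 D u -> L2 D v ->
  mu.-integrable setT (EFin \o ((u \* v) \_ D)).
Proof.
move=> uL vL; rewrite patchM; apply/Lfun1_integrable.
exact: Lfun2_mul_Lfun1.
Qed.

Lemma dot2E D u v : dot2 D u v = \int[mu]_x ((u \* v) \_ D) x.
Proof. by rewrite /dot2 Rintegral_mkcond. Qed.

Lemma dot2C D u v : dot2 D u v = dot2 D v u.
Proof. by apply: eq_Rintegral => x _; rewrite mulrC. Qed.

Lemma dot2Dl D u v w : L2 D u -> L2 D v -> L2 D w ->
  dot2 D (u \+ v) w = dot2 D u w + dot2 D v w.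
Proof.
move=> uL vL wL; rewrite !dot2E -RintegralD//; [|exact: L2_integrable..].
by apply: eq_Rintegral => x _; rewrite /= !patchE0; case: ifP => _; rewrite /= ?addr0// mulrDl.
Qed.

Lemma dot2Zl D c u v : L2 D u -> L2 D v -> dot2 D (c \*o u) v = c * dot2 D u v.
Proof.
move=> uL vL; rewrite !dot2E -RintegralZl//; last exact: L2_integrable.
by apply: eq_Rintegral => x _; rewrite /= !patchE0; case: ifP => _; rewrite /= ?mulr0// mulrA.
Qed.

Lemma subE_addZ u v : u \- v = u \+ (-1) \*o v.
Proof. by apply/funext => x /=; rewrite mulN1r. Qed.

Lemma dot2Bl D u v w : L2 D u -> L2 D v -> L2 D w ->
  dot2 D (u \- v) w = dot2 D u w - dot2 D v w.
Proof.
by move=> uL vL wL; rewrite subE_addZ dot2Dl ?dot2Zl ?mulN1r//; exact: L2Z.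
Qed.

Lemma dot20l D u : dot2 D (cst 0) u = 0.
Proof.
rewrite dot2E (_ : _ \_ _ = cst 0) ?Rintegral_cst ?mul0r//.
by apply/funext => x; rewrite patchE0; case: ifP => //=; rewrite mul0r.
Qed.

Lemma dot2_suml D (I : Type) (s : seq I) (P : pred I) (a : I -> R)
    (F : I -> 'rV[R]_n -> R) w : (forall i, P i -> L2 D (F i)) -> L2 D w ->
  dot2 D (fun x => \sum_(i <- s | P i) a i * F i x) w =
  \sum_(i <- s | P i) a i * dot2 D (F i) w.
Proof.
move=> FL wL; elim: s => [|i s IH].
  rewrite big_nil (_ : (fun _ => _) = cst 0) ?dot20l//.
  by apply/funext => x; rewrite big_nil.
rewrite big_cons; case: ifPn => Pi; last first.
  rewrite -IH; congr (dot2 D _ w); apply/funext => x.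
  by rewrite big_cons (negbTE Pi).
rewrite -IH -dot2Zl -?dot2Dl//; try exact: FL.
- by congr (dot2 D _ w); apply/funext => x; rewrite big_cons Pi.
- exact: L2Z (FL i Pi).
- exact: L2_lin.
Qed.

Lemma dot2_sumr D (I : Type) (s : seq I) (P : pred I) (a : I -> R)
    (F : I -> 'rV[R]_n -> R) w : (forall i, P i -> L2 D (F i)) -> L2 D w ->
  dot2 D w (fun x => \sum_(i <- s | P i) a i * F i x) =
  \sum_(i <- s | P i) a i * dot2 D w (F i).
Proof.
move=> FL wL; rewrite dot2C dot2_suml//.
by apply: eq_bigr => i _; rewrite dot2C.
Qed.

Lemma dot2_ge0 D u : 0 <= dot2 D u u.
Proof. by apply: Rintegral_ge0 => x _; rewrite -expr2 sqr_ge0. Qed.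

(** Integrability is not required: if the integral of [u ^+ 2] diverges, both
    sides take the default value 0. *)
Lemma norm2E D u : norm2 D u = Num.sqrt (dot2 D u u).
Proof.
rewrite /norm2 /dot2 /Rintegral unlock /=.
rewrite [in RHS]integral_mkcond.
rewrite [X in (X `^ _)%E](_ : _ =
  (\int[mu]_x ((fun x => (u x * u x)%:E) \_ D) x)%E); last first.
  apply: eq_integral => x _.
  rewrite powR_mulrn// real_normK ?num_real// patchE0 patchE.
  by case: ifP => _; rewrite ?expr2// mulr0.
set I := (\int[mu]_x _)%E.
have : (0 <= I)%E.
  apply: integral_ge0 => x _; rewrite patchE; case: ifP => // _.
  by rewrite lee_fin -expr2 sqr_ge0.
case: I => [r r0||//]; last by rewrite poweRyr ?sqrtr0// invr_neq0// pnatr_eq0.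
by rewrite poweR_EFin /= powR12_sqrt.
Qed.

Lemma norm2_ge0 D u : 0 <= norm2 D u.
Proof. by rewrite norm2E sqrtr_ge0. Qed.

Lemma norm2_sqr D u : norm2 D u ^+ 2 = dot2 D u u.
Proof. by rewrite norm2E sqr_sqrtr// dot2_ge0. Qed.

Lemma norm2_lin_sqr D (I : finType) (a : I -> R) (F : I -> 'rV[R]_n -> R) :
  (forall i, L2 D (F i)) ->
  norm2 D (fun x => \sum_i a i * F i x) ^+ 2 =
  qform (fun i j => dot2 D (F i) (F j)) a.
Proof.
move=> FL; rewrite norm2_sqr dot2_suml//; last exact: L2_lin.
apply: eq_bigr => i _; rewrite dot2_sumr// mulr_sumr.
by apply: eq_bigr => j _; rewrite mulrA.
Qed.

Lemma psd_dot2 D (I : finType) (F : I -> 'rV[R]_n -> R) :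
  (forall i, L2 D (F i)) -> psd (fun i j => dot2 D (F i) (F j)).
Proof.
move=> FL; split=> [p q|x]; first exact: dot2C.
by rewrite -norm2_lin_sqr// sqr_ge0.
Qed.

Lemma dot2_CS D u v : L2 D u -> L2 D v -> `|dot2 D u v| <= norm2 D u * norm2 D v.
Proof.
move=> uL vL.
have h (t : R) : 0 <= dot2 D u u + 2 * t * dot2 D u v + t ^+ 2 * dot2 D v v.
  rewrite (_ : _ + _ = dot2 D (u \+ t \*o v) (u \+ t \*o v)) ?dot2_ge0//.
  have tv : L2 D (t \*o v) by exact: L2Z.
  have utv : L2 D (u \+ t \*o v) by exact: L2D.
  rewrite dot2Dl// dot2Zl// ![dot2 D _ (_ \+ _)]dot2C !dot2Dl// !dot2Zl//.
  by rewrite (dot2C D v u); ring.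
rewrite -[_ * _]ger0_norm ?mulr_ge0 ?norm2_ge0// -ler_sqr ?nnegrE//.
rewrite !real_normK ?num_real// exprMn !norm2_sqr.
exact: discriminant_le (dot2_ge0 _ _) h.
Qed.

Lemma norm2D D u v : L2 D u -> L2 D v ->
  norm2 D (u \+ v) <= norm2 D u + norm2 D v.
Proof.
move=> uL vL; rewrite -ler_sqr ?nnegrE ?addr_ge0 ?norm2_ge0//.
have uv := L2D uL vL.
rewrite sqrrD !norm2_sqr dot2Dl// ![dot2 D _ (_ \+ _)]dot2C !dot2Dl//.
rewrite (dot2C D v u).
have := le_trans (ler_norm _) (dot2_CS uL vL).
by lra.
Qed.

Lemma norm2Z D c u : L2 D u -> norm2 D (c \*o u) = `|c| * norm2 D u.
Proof.
move=> uL; rewrite !norm2E (dot2Zl c uL (L2Z c uL)) dot2C (dot2Zl c uL uL).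
by rewrite mulrA -expr2 sqrtrM ?sqr_ge0// sqrtr_sqr.
Qed.

Lemma norm2_leB D u v : L2 D u -> L2 D v ->
  norm2 D (u \- v) <= norm2 D u + norm2 D v.
Proof.
move=> uL vL; rewrite subE_addZ; apply: le_trans (norm2D uL (L2Z _ vL)) _.
by rewrite norm2Z// normrN1 mul1r.
Qed.

Lemma norm2BC D u v : norm2 D (u \- v) = norm2 D (v \- u).
Proof.
rewrite !norm2E; congr Num.sqrt; apply: eq_Rintegral => x _ /=.
by ring.
Qed.

Lemma norm2_triangle D u v w : L2 D u -> L2 D v -> L2 D w ->
  norm2 D (u \- w) <= norm2 D (u \- v) + norm2 D (v \- w).
Proof.
move=> uL vL wL; rewrite (_ : u \- w = (u \- v) \+ (v \- w)).
  by apply: norm2D; exact: L2B.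
by apply/funext => x /=; rewrite addrA subrK.
Qed.

Lemma ae_eq_dot2 D u v w : L2 D u -> L2 D v -> L2 D w -> ae_eq mu D u v ->
  dot2 D u w = dot2 D v w.
Proof.
move=> uL vL wL uv; rewrite !dot2E; congr fine.
apply: ae_eq_integral => //.
- by have /integrableP[] := L2_integrable uL wL.
- by have /integrableP[] := L2_integrable vL wL.
apply: filterS uv => x uv _ /=; rewrite !patchE0; case: ifPn => // xD.
by rewrite /= uv// -in_setE.
Qed.

Lemma ae_eq_norm2 D u v : L2 D u -> L2 D v -> ae_eq mu D u v ->
  norm2 D u = norm2 D v.
Proof.
move=> uL vL uv; rewrite !norm2E; congr Num.sqrt.
by rewrite (ae_eq_dot2 uL vL uL uv) dot2C (ae_eq_dot2 uL vL vL uv).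
Qed.

Lemma ae_eq_norm2B D u v w : L2 D u -> L2 D v -> L2 D w -> ae_eq mu D u v ->
  norm2 D (w \- u) = norm2 D (w \- v).
Proof.
move=> uL vL wL uv; apply: ae_eq_norm2; [exact: L2B..|].
by apply: filterS uv => x uv /uv /= ->.
Qed.

End L2Theory.

(** * Lebesgue measure on a product of blocks *)

Section ProductLebesgue.
Context {R : realType}.
Local Open Scope ereal_scope.

Lemma measurable_row_mx p q :
  measurable_fun setT (fun z : 'rV[R]_p * 'rV[R]_q => row_mx z.1 z.2).
Proof.
apply: measurable_fun_rV => i; under eq_fun do rewrite mxE.
case: (fintype.split i) => j.
  exact: (measurableT_comp (measurable_coord j) measurable_fst).
exact: (measurableT_comp (measurable_coord j) measurable_snd).
Qed.

Lemma ge0_integral_rVS n (f : 'rV[R]_n.+1 -> \bar R) :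
  measurable_fun setT f -> (forall x, 0 <= f x) ->
  \int[lebesgue_rV R n.+1]_x f x =
  \int[lebesgue_measure]_t \int[lebesgue_rV R n]_x f (consrV (t, x)).
Proof.
move=> mf f0.
have mfc : measurable_fun setT (f \o @consrV R n).
  by apply: measurableT_comp => //; exact: measurable_consrV.
have f0c z : 0 <= (f \o @consrV R n) z by exact: f0.
rewrite -[RHS](@fubini_tonelli1 _ _ _ _ _ lebesgue_measure (lebesgue_rV R n)
  (f \o @consrV R n) mfc f0c).
rewrite [LHS](_ : _ = \int[pushforward (lebesgue_measure \x lebesgue_rV R n)
  (@consrV R n)]_x f x)//.
by rewrite ge0_integral_pushforward//; exact: measurable_consrV.
Qed.

Lemma row_mx_consrV p q t (a : 'rV[R]_p) (b : 'rV[R]_q) :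
  row_mx (consrV (t, a)) b = consrV (t, row_mx a b) :> 'rV[R]_(p.+1 + q).
Proof.
rewrite /consrV /=.
have := @row_mxA R 1 1 p q t%:M a b; rewrite /=; move: (esym _) => e.
rewrite (eq_irrelevance e (erefl (p + q).+1)) => ->.
by rewrite castmx_id.
Qed.

Lemma row_mx0l q (a : 'rV[R]_0) (b : 'rV[R]_q) : row_mx a b = b :> 'rV[R]_(0 + q).
Proof.
apply/rowP => i; rewrite mxE; case: splitP => [[]//|k ik].
by congr (b _ _); apply/val_inj.
Qed.

Lemma ge0_integral_rV_add p q (f : 'rV[R]_(p + q) -> \bar R) :
  measurable_fun setT f -> (forall x, 0 <= f x) ->
  \int[lebesgue_rV R (p + q)]_x f x =
  \int[lebesgue_rV R p]_a \int[lebesgue_rV R q]_b f (row_mx a b).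
Proof.
elim: p f => [|p IH] f mf f0.
  rewrite [RHS]integral_dirac//; last first.
    apply: (@measurable_fun_fubini_tonelli_F _ _ _ _ _ _
      (f \o (fun z : 'rV[R]_0 * 'rV[R]_q => row_mx z.1 z.2))).
      by apply: measurableT_comp => //; exact: measurable_row_mx.
    by move=> x; exact: f0.
  rewrite diracT mul1e; apply: eq_integral => b _.
  by rewrite row_mx0l.
rewrite [LHS](@ge0_integral_rVS (p + q))//.
have mfr : measurable_fun setT
    (f \o (fun z : 'rV[R]_p.+1 * 'rV[R]_q => row_mx z.1 z.2)).
  by apply: measurableT_comp => //; exact: measurable_row_mx.
rewrite [RHS]ge0_integral_rVS; last 2 first.
- apply: (@measurable_fun_fubini_tonelli_F _ _ _ _ _ _ _ mfr).
  by move=> x; exact: f0.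
- by move=> x; apply: integral_ge0.
apply: eq_integral => t _.
have mft : measurable_fun setT (fun z : 'rV[R]_(p + q) => f (consrV (t, z))).
  apply: measurableT_comp => //.
  apply: (measurableT_comp (measurable_consrV (n := p + q))).
  exact: measurable_pair1.
rewrite (IH _ mft (fun z => f0 _)).
apply: eq_integral => a _; apply: eq_integral => b _.
by rewrite row_mx_consrV.
Qed.

Local Notation rmx p q := (fun z : 'rV[R]_p * 'rV[R]_q => row_mx z.1 z.2).

(** Lebesgue measure is built one coordinate at a time; peeling off the
    coordinates of the first block by Tonelli exhibits the product measure. *)
Lemma lebesgue_rV_add p q (A : set 'rV[R]_(p + q)) : measurable A ->
  lebesgue_rV R (p + q) A =
  pushforward (lebesgue_rV R p \x lebesgue_rV R q) (rmx p q) A.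
Proof.
move=> mA; have mrA : measurable (rmx p q @^-1` A).
  by rewrite -[X in measurable X]setTI; exact: measurable_row_mx.
have -> : lebesgue_rV R (p + q) A = \int[lebesgue_rV R (p + q)]_x (\1_A x)%:E.
  by rewrite integral_indic// setIT.
rewrite /pushforward.
have <- : \int[lebesgue_rV R p \x lebesgue_rV R q]_z
    (\1_(rmx p q @^-1` A) z)%:E =
    (lebesgue_rV R p \x lebesgue_rV R q) (rmx p q @^-1` A).
  by rewrite integral_indic// setIT.
rewrite ge0_integral_rV_add//; last exact/measurable_EFinP/measurable_indic.
rewrite (fubini_tonelli1 (EFin \o \1_(rmx p q @^-1` A)))//.
exact/measurable_EFinP/measurable_indic.
by move=> z; rewrite lee_fin.
Qed.

Lemma integrable_mulX d1 d2 (T1 : measurableType d1) (T2 : measurableType d2)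
    (m1 : {sigma_finite_measure set T1 -> \bar R})
    (m2 : {sigma_finite_measure set T2 -> \bar R}) (h : T1 -> R) (g : T2 -> R) :
  m1.-integrable setT (EFin \o h) -> m2.-integrable setT (EFin \o g) ->
  (m1 \x m2).-integrable setT (fun z => (h z.1 * g z.2)%:E) /\
  (\int[m1 \x m2]_z (h z.1 * g z.2)%R = \int[m1]_x h x * \int[m2]_y g y)%R.
Proof.
move=> ih ig.
have /measurable_EFinP mh := measurable_int _ ih.
have /measurable_EFinP mg := measurable_int _ ig.
have mhg : measurable_fun setT (fun z : T1 * T2 => (h z.1 * g z.2)%:E).
  apply/measurable_EFinP/measurable_funM.
    exact: (measurableT_comp mh measurable_fst).
  exact: (measurableT_comp mg measurable_snd).
have i12 : (m1 \x m2).-integrable setT (fun z => (h z.1 * g z.2)%:E).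
  apply/integrable12ltyP => //=.
  rewrite (_ : \int[m1]_x _ =
      \int[m1]_x (`|h x|%:E * \int[m2]_y `|g y|%:E)); last first.
    apply: eq_integral => x _.
    rewrite -ge0_integralZl//; last exact/measurable_EFinP/measurableT_comp.
    by apply: eq_integral => y _; rewrite /= normrM EFinM.
  have [_ gy] := integrableP _ _ _ ig.
  have [_ hy] := integrableP _ _ _ ih.
  rewrite ge0_integralZr//; [|exact/measurable_EFinP/measurableT_comp|exact: integral_ge0].
  by apply: lte_mul_pinfty => //; [exact: integral_ge0|rewrite ge0_fin_numE//; exact: integral_ge0].
split=> //; apply: EFin_inj.
rewrite EFinM /Rintegral fineK ?integrable_fin_num// !fineK ?integrable_fin_num//.
rewrite -(integral12_prod_meas1 i12)/=.
rewrite -[X in _ = _ * X]fineK ?integrable_fin_num// -integralZr//.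
apply: eq_integral => x _; rewrite fineK ?integrable_fin_num// /fubini_F/=.
rewrite -integralZl//.
Qed.

Lemma integral_castmx N N' (e : N = N') (g : 'rV[R]_N' -> R) :
  (lebesgue_rV R N).-integrable setT (fun x => (g (castmx (erefl, e) x))%:E) ->
  (lebesgue_rV R N').-integrable setT (EFin \o g) /\
  (\int[lebesgue_rV R N']_x g x =
   \int[lebesgue_rV R N]_x g (castmx (erefl, e) x))%R.
Proof.
move: g; case: _ / e => g H; split; last by apply: eq_Rintegral => x _; rewrite castmx_id.
by rewrite (_ : _ \o _ = (fun x => (g (castmx (erefl, erefl N) x))%:E))//;
   apply/funext => x; rewrite castmx_id.
Qed.

Let row_measure p q := measure_function_pushforward__canonical__measure_function_Measure
  (lebesgue_rV R p \x lebesgue_rV R q) (measurable_row_mx (p := p) (q := q)).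

Lemma integrable_rV_mul p q (h : 'rV[R]_p -> R) (g : 'rV[R]_q -> R) :
  (lebesgue_rV R p).-integrable setT (EFin \o h) ->
  (lebesgue_rV R q).-integrable setT (EFin \o g) ->
  (lebesgue_rV R (p + q)).-integrable setT
     (fun z => (h (lsubmx z) * g (rsubmx z))%:E) /\
  (\int[lebesgue_rV R (p + q)]_z (h (lsubmx z) * g (rsubmx z)) =
   \int[lebesgue_rV R p]_x h x * \int[lebesgue_rV R q]_y g y)%R.
Proof.
move=> ih ig; have [iX IX] := integrable_mulX ih ig.
pose F := fun z : 'rV[R]_(p + q) => (h (lsubmx z) * g (rsubmx z))%:E.
have /measurable_EFinP mh := measurable_int _ ih.
have /measurable_EFinP mg := measurable_int _ ig.
have mF : measurable_fun setT F.
  apply/measurable_EFinP/measurable_funM.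
    apply: (measurableT_comp mh); apply: measurable_fun_rV => i.
    by under eq_fun do rewrite mxE; exact: measurable_coord.
  apply: (measurableT_comp mg); apply: measurable_fun_rV => i.
  by under eq_fun do rewrite mxE; exact: measurable_coord.
have FE : F \o (rmx p q) = fun z => (h z.1 * g z.2)%:E.
  by apply/funext => z; rewrite /F/= row_mxKl row_mxKr.
have iFr : (lebesgue_rV R p \x lebesgue_rV R q).-integrable setT (F \o rmx p q).
  by rewrite FE.
split.
  have := integrable_pushforward (measurable_row_mx (p := p) (q := q)) mF iFr measurableT.
  move=> /integrableP[_ fin]; apply/integrableP; split => //.
  by rewrite (eq_measure_integral (row_measure p q) (fun A mA _ => lebesgue_rV_add mA)).
rewrite -IX; congr fine.
rewrite (eq_measure_integral (row_measure p q) (fun A mA _ => lebesgue_rV_add mA)).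
rewrite (integral_pushforward (measurable_row_mx (p := p) (q := q)) mF iFr)//.
by rewrite FE.
Qed.

Lemma submxrow_ord0 m (n : 'I_m.+1 -> nat) N
    (e : (n ord0 + N = \sum_i n i)%N) (z : 'rV[R]_(n ord0 + N)) :
  submxrow (castmx (erefl, e) z) ord0 = lsubmx z.
Proof.
apply/rowP => j; rewrite !mxE castmxE cast_ord_id; congr (z _ _); apply/val_inj.
by rewrite [LHS]tagnat.RankEsum big_pred0 ?add0n.
Qed.

Lemma submxrow_lift0 m (n : 'I_m.+1 -> nat)
    (e : (n ord0 + \sum_(i < m) n (lift ord0 i) = \sum_i n i)%N)
    (z : 'rV[R]_(n ord0 + \sum_(i < m) n (lift ord0 i))) i :
  submxrow (castmx (erefl, e) z) (lift ord0 i) = submxrow (rsubmx z) i.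
Proof.
apply/rowP => j; rewrite !mxE castmxE cast_ord_id; congr (z _ _); apply/val_inj.
rewrite [LHS]tagnat.RankEsum [X in _ = (_ + X)%N]tagnat.RankEsum big_mkcond big_ord_recl /= -addnA; congr (_ + (_ + _))%N.
by rewrite [RHS]big_mkcond; apply: eq_bigr => k _.
Qed.

(** Induction on the number of blocks, the first one being split off by
    Fubini. *)
Lemma integral_prod_rV m (n : 'I_m -> nat) (h : forall i, 'rV[R]_(n i) -> R) :
  (forall i, (lebesgue_rV R (n i)).-integrable setT (EFin \o h i)) ->
  (lebesgue_rV R (\sum_i n i)).-integrable setT
     (fun x => (\prod_i h i (submxrow x i))%:E) /\
  (\int[lebesgue_rV R (\sum_i n i)]_x (\prod_i h i (submxrow x i)) =
  \prod_i \int[lebesgue_rV R (n i)]_y h i y)%R.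
Proof.
elim: m n h => [|m IH] n h ih.
  have P0 (F : 'I_0 -> R) : (\prod_i F i = 1)%R by exact: big_ord0.
  have [] := @integral_castmx _ _ (esym (big_ord0 _ _ _ n))
    (fun x => \prod_i h i (submxrow x i))%R.
    apply/integrableP; split.
      rewrite (_ : (fun _ => _) = cst 1%:E); first exact: measurable_cst.
      by apply/funext => x; rewrite P0.
    rewrite integral_dirac//.
      by rewrite diracT mul1e P0 abse1 ltry.
    rewrite (_ : (fun _ => _) = cst 1%:E); first exact: measurable_cst.
    by apply/funext => x; rewrite P0 abse1.
  move=> i1 ->; split => //; rewrite [RHS]P0 /Rintegral integral_dirac//.
    by rewrite diracT mul1e P0.
  rewrite (_ : (fun _ => _) = cst 1%:E); first exact: measurable_cst.
  by apply/funext => x; rewrite P0.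
have e : (n ord0 + \sum_(i < m) n (lift ord0 i) = \sum_i n i)%N.
  by rewrite [RHS]big_ord_recl.
have [iP IP] := IH _ _ (fun i => ih (lift ord0 i)).
have [iM IM] := integrable_rV_mul (ih ord0) iP.
have E : (fun z => \prod_i h i (submxrow (castmx (erefl, e) z) i))%R =
  (fun z => h ord0 (lsubmx z) *
     \prod_i h (lift ord0 i) (submxrow (rsubmx z) i))%R.
  apply/funext => z; rewrite [LHS]big_ord_recl submxrow_ord0; congr (_ * _)%R.
  by apply: eq_bigr => i _; rewrite submxrow_lift0.
have [|iF ->] := @integral_castmx _ _ e (fun x => \prod_i h i (submxrow x i))%R.
  by move: iM; congr (integrable _ _ _); apply/funext => z;
    rewrite -(congr1 (fun f => f z) E).
split => //; rewrite [RHS]big_ord_recl -IP -IM.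
by apply: eq_Rintegral => z _; rewrite (congr1 (fun f => f z) E).
Qed.

End ProductLebesgue.

(** * Tensor products of functions *)

Section Tensor.
Context {R : realType} {m : nat} (n : 'I_m -> nat).
Variable Omega : forall i, set 'rV[R]_(n i).
Arguments Omega : clear implicits.
Implicit Types (u v : forall i, 'rV[R]_(n i) -> R).

Definition tensor u (x : 'rV[R]_(\sum_i n i)) : R := \prod_i u i (submxrow x i).

Lemma patch_tensor u : tensor u \_ (prod_domain Omega) =
  tensor (fun i => u i \_ (Omega i)).
Proof.
apply/funext => x; rewrite patchE0 /tensor; case: ifPn => xO.
  by apply: eq_bigr => i _; rewrite patchE0 mem_set//; exact: set_mem xO i.
have [i xi] : exists i, ~ Omega i (submxrow x i).
  by apply/existsNP => H; move: xO; rewrite mem_set.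
by rewrite (bigD1 i)//= patchE0 memNset// mul0r.
Qed.

Lemma measurable_submxrow i :
  measurable_fun setT (fun x : 'rV[R]_(\sum_i n i) => submxrow x i).
Proof.
apply: measurable_fun_rV => j.
have E : (fun x : 'rV[R]_(\sum_i n i) => submxrow x i ord0 j) =
    (fun x : 'rV[R]_(\sum_i n i) => x ord0 (tagnat.Rank i j)).
  by apply/funext => x; rewrite mxE.
by rewrite E; exact: measurable_coord.
Qed.

Lemma L2_tensor u : (forall i, L2 (Omega i) (u i)) ->
  L2 (prod_domain Omega) (tensor u).
Proof.
move=> uL; apply/L2P; rewrite patch_tensor; split.
  apply: (@measurable_prod _ _ _ _ _ _
    (fun i x => (u i \_ (Omega i)) (submxrow x i))) => i _.
  exact: (measurableT_comp (L2_measurable (uL i)) (@measurable_submxrow i)).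
have := (integral_prod_rV (h := fun i x => (u i \_ (Omega i)) x ^+ 2) _).1.
rewrite (_ : _ \o _ = fun x : 'rV[R]_(\sum_i n i) =>
   (\prod_i (u i \_ (Omega i)) (submxrow x i) ^+ 2)%:E).
  by apply => i; have [] := (L2P _ _).1 (uL i).
by apply/funext => x; rewrite /= /tensor prodrXl.
Qed.

Lemma dot2_tensor u v : (forall i, L2 (Omega i) (u i)) ->
  (forall i, L2 (Omega i) (v i)) ->
  dot2 (prod_domain Omega) (tensor u) (tensor v) =
  \prod_i dot2 (Omega i) (u i) (v i).
Proof.
move=> uL vL; rewrite dot2E patchM !patch_tensor.
have := (integral_prod_rV
  (h := fun i => (u i \* v i) \_ (Omega i)) _).2.
rewrite (eq_bigr _ (fun i _ => dot2E (Omega i) (u i) (v i))) => <-.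
  apply: eq_Rintegral => x _; rewrite /tensor /= -big_split/=.
  by apply: eq_bigr => i _; rewrite patchM.
by move=> i; exact: L2_integrable.
Qed.

End Tensor.

(** * Borel sets and cubes *)

Section BorelRV.
Context {R : realType} {n : nat}.
Implicit Types (D U K : set 'rV[R]_n) (f : 'rV[R]_n -> R).

Definition cube (c : 'rV[R]_n) (e : R) : set 'rV[R]_n :=
  [set y | forall i, `|c ord0 i - y ord0 i| < e].

Lemma measurable_cube c e : measurable (cube c e).
Proof.
rewrite (_ : cube c e = \bigcap_(i in [set: 'I_n])
    ((fun y : 'rV[R]_n => y ord0 i) @^-1` ball (c ord0 i) e)).
  apply: fin_bigcap_measurable; first exact: finite_finset.
  move=> i _; rewrite -[X in measurable X]setTI.
  by apply: measurable_coord => //; exact: measurable_ball.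
by apply/seteqP; split => y H i; [move=> _; exact: H|exact: (H i)].
Qed.

(** The measurable sets are generated by the coordinates; an open set is the
    countable union of the cubes with rational centre and radius [1 / k] that
    it contains. *)
Lemma measurable_open_rV U : open U -> measurable U.
Proof.
move=> oU.
pose q2r (q : 'rV[rat]_n) : 'rV[R]_n := \row_i ratr (q ord0 i).
pose F (p : 'rV[rat]_n * nat) : set 'rV[R]_n :=
  if `[< cube (q2r p.1) p.2.+1%:R^-1 `<=` U >]
  then cube (q2r p.1) p.2.+1%:R^-1 else set0.
have -> : U = \bigcup_p F p.
  apply/seteqP; split => [x Ux|x [p _]]; last first.
    by rewrite /F; case: ifPn => // /asboolP; apply.
  have /nbhs_ballP[e /= e0 eU] : nbhs x U by exact: open_nbhs_nbhs.
  have [k ke] : exists k : nat, k.+1%:R^-1 < e / 2 :> R.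
    exists (Num.truncn (e / 2)^-1).
    rewrite invf_plt ?posrE ?divr_gt0//.
    exact: truncnS_gt.
  have qx i : exists q : rat, `|ratr q - x ord0 i| < k.+1%:R^-1 :> R.
    have [|q] := @rat_in_itvoo R (x ord0 i - k.+1%:R^-1) (x ord0 i + k.+1%:R^-1).
      by rewrite ltrD2l gtrN ?invr_gt0.
    rewrite in_itv/= => /andP[q1 q2]; exists q.
    by rewrite ltr_distl q1 q2.
  have [q qP] := choice qx.
  have xc : cube (q2r (\row_i q i)) k.+1%:R^-1 x.
    by move=> i; rewrite !mxE; exact: qP.
  exists (\row_i q i, k) => //; rewrite /F /= asboolT//.
  move=> y yc; apply: eU; split=> // i j; rewrite ord1.
  rewrite /ball/=; apply: le_lt_trans (ler_distD (q2r (\row_i q i) ord0 j) _ _) _.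
  rewrite (splitr e); apply: ltrD; last by apply: lt_trans ke; exact: yc.
  by rewrite distrC; apply: lt_trans ke; exact: xc.
apply: countable_bigcupT_measurable; first exact: countableP.
by move=> p; rewrite /F; case: ifP => _ //; exact: measurable_cube.
Qed.

Lemma measurable_continuous_rV f : continuous f -> measurable_fun setT f.
Proof.
move=> /continuousP cf; apply: (measurability _ (RGenOpens.measurableE R)).
move=> _ [_ [a [b ->] <-]]; rewrite setTI; apply: measurable_open_rV.
exact/cf/interval_open.
Qed.

End BorelRV.

Lemma lebesgue_rV_cube_fin (R : realType) n (e : R) :
  (lebesgue_rV R n (cube 0 e) < +oo)%E.
Proof.
elim: n => [|n IH].
  by rewrite /lebesgue_rV /= diracE; case: (_ \in _); rewrite ltry.
rewrite [X in (X < _)%E](_ : _ =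
  (lebesgue_measure \x lebesgue_rV R n)%E (ball 0 e `*` cube 0 e)).
  rewrite product_measure1E//; [|exact: measurable_ball|exact: measurable_cube].
  rewrite lte_mul_pinfty// ?ge0_fin_numE//.
  have [e0|e0] := leP 0 e.
    apply: (@le_lt_trans _ _ (e *+ 2)%:E); last exact: ltry.
    by rewrite -(lebesgue_measure_ball 0 e0).
  rewrite (_ : ball 0 e = set0) ?measure0//.
  by apply/seteqP; split=> // x; rewrite /ball/= ltNge (le_trans (ltW e0)).
rewrite /lebesgue_rV /= /lebesgue_rV_step /pushforward; congr (_ _).
have c0 t (x : 'rV[R]_n) : consrV (t, x) ord0 ord0 = t.
  rewrite /consrV mxE; case: splitP => j // _.
  by rewrite mxE !ord1 eqxx mulr1n.
have cS t (x : 'rV[R]_n) i : consrV (t, x) ord0 (rshift 1 i) = x ord0 i.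
  by rewrite /consrV (row_mxEr (t%:M : 'M[R]_1) x ord0 i).
apply/seteqP; split => -[t x] /=; rewrite /cube/ball/=.
  move=> H; split=> [|i]; first by have := H ord0; rewrite c0 mxE.
  by have := H (rshift 1 i); rewrite cS !mxE.
move=> [tb H] i; rewrite -(splitK (i : 'I_(1 + n))).
case: (fintype.split _) => j; rewrite /unsplit.
  rewrite (_ : lshift n j = ord0) ?c0 ?mxE//.
  by apply/val_inj; rewrite /= !ord1.
by rewrite cS mxE; have := H j; rewrite mxE.
Qed.

(** * Square integrability of test functions *)

Section TestFunctions.
Context {R : realType} {n : nat}.
Implicit Types (D K : set 'rV[R]_n) (f : 'rV[R]_n -> R).

Lemma partials_vanish K f a : closed K -> (forall x, ~ K x -> f x = 0) ->
  forall x, ~ K x -> partials a f x = 0.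
Proof.
move=> cK f0; elim: a => [|i a IH] x Kx; first exact: f0.
transitivity ('D_(delta_mx ord0 i) (cst 0 : 'rV[R]_n -> R) x); last exact: derive_cst.
apply: near_eq_derive.
have : open (~` K) by exact: closed_openC.
rewrite openE => /(_ _ Kx); apply: filterS => y Ky.
exact: IH.
Qed.

(** Its square is dominated by a multiple of the indicator of a cube. *)
Lemma continuous_compact_support_L2 D K f : open D -> compact K ->
  continuous f -> (forall x, ~ K x -> f x = 0) -> L2 D f.
Proof.
move=> oD cK cf f0.
have [M M0 fM] : exists2 M : R, 0 < M & forall x, K x -> `|f x| <= M.
  have /compact_bounded : compact (f @` K).
    by apply: continuous_compact => //; exact: continuous_subspaceT.
  move=> /pinfty_ex_gt0[M M0 H]; exists M => // x Kx.
  by apply: H; exists x.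
have [B B0 KB] : exists2 B : R, 0 < B & K `<=` cube 0 B.
  have /compact_bounded/pinfty_ex_gt0[B B0 H] := cK.
  exists (B + 1); first by rewrite addr_gt0.
  move=> x Kx i; rewrite mxE sub0r normrN.
  apply: le_lt_trans (_ : B < _); last by rewrite ltrDl.
  apply: le_trans (H _ Kx).
  have -> : `|x| = \big[Num.max/0]_ij `|x ij.1 ij.2| by exact: mx_normrE.
  exact: (le_bigmax _ (fun ij => `|x ij.1 ij.2|) (ord0, i)).
have mfD : measurable_fun setT (f \_ D).
  apply: (measurable_restrictT f (measurable_open_rV oD)).1.
  by apply: measurable_funTS; exact: measurable_continuous_rV.
apply/L2P; split=> //.
have M1 x : 0 <= M ^+ 2 * \1_(cube 0 B) x by exact: mulr_ge0 (sqr_ge0 M) _.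
apply: (@le_integrable _ _ _ _ _ _ _ (EFin \o (fun x => M ^+ 2 * \1_(cube 0 B) x))) => //.
- exact/measurable_EFinP/measurable_funX.
- move=> x _ /=; rewrite lee_fin ger0_norm ?sqr_ge0// ger0_norm ?M1//.
  rewrite patchE0; case: ifPn => _; last by rewrite expr0n M1.
  have [Kx|Kx] := pselect (K x); last first.
    by rewrite f0// expr0n M1.
  rewrite indicE mem_set; last exact: KB.
  rewrite mulr1 -[f x ^+ 2]real_normK ?num_real//.
  by rewrite ler_sqr ?nnegrE ?(ltW M0)//; exact: fM.
- suff i1 : (lebesgue_rV R n).-integrable setT (EFin \o \1_(cube 0 B)).
    have := integrableZl measurableT (M ^+ 2) i1.
    by congr (integrable _ _ _); apply/funext => x; rewrite /= EFinM.
  apply/integrableP; split.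
    by apply/measurable_EFinP/measurable_indic; exact: measurable_cube.
  rewrite (eq_integral (fun x => (\1_(cube 0 B) x)%:E)); last first.
    by move=> x _; rewrite /= ger0_norm.
  rewrite integral_indic ?setIT//; last exact: measurable_cube.
  exact: lebesgue_rV_cube_fin.
Qed.

Lemma test_function_L2 D f a : open D -> test_function D f ->
  L2 D (partials a f).
Proof.
move=> oD [fC [K [cK KD f0]]].
apply: (@continuous_compact_support_L2 D K) => //.
  by move=> x; have [/(_ x I)] := fC (size a) a (leqnn _).
by apply: partials_vanish => //; exact: compact_closed.
Qed.

End TestFunctions.

(** * Slobodeckij forms *)

Section Slobodeckij.
Context {R : realType} {n : nat}.
Variable D : set 'rV[R]_n.
Hypothesis oD : open D.
Variable sigma : R.
Local Notation nu := ((lebesgue_rV R n \x lebesgue_rV R n)%E).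
Local Notation D2 := (D `*` D).
Implicit Types (u v w : 'rV[R]_n -> R).

Let mD : measurable D. Proof. exact: measurable_open_rV. Qed.
Let mD2 : measurable D2. Proof. exact: measurableX. Qed.

Let weight (z : 'rV[R]_n * 'rV[R]_n) : R :=
  (euclid (z.1 - z.2) `^ (n%:R + sigma *+ 2))^-1.

Lemma measurable_slob_weight : measurable_fun setT weight.
Proof.
rewrite (_ : weight = (fun z => (\sum_i (z.1 ord0 i - z.2 ord0 i) ^+ 2) `^
    (2^-1 * - (n%:R + sigma *+ 2)))).
  apply: (measurableT_comp (measurable_powR _)); apply: measurable_sum => i.
  apply: measurable_funX; apply: measurable_funB.
    exact: (measurableT_comp (measurable_coord i) measurable_fst).
  exact: (measurableT_comp (measurable_coord i) measurable_snd).
apply/funext => z; rewrite /weight powRrM powR12_sqrt.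
  rewrite powRN /euclid; congr (Num.sqrt _ `^ _)^-1.
  by apply: eq_bigr => i _; rewrite !mxE.
by apply: sumr_ge0 => i _; exact: sqr_ge0.
Qed.

Lemma slob_weight_ge0 z : 0 <= weight z.
Proof. by rewrite invr_ge0 powR_ge0. Qed.

Lemma L2_measurable_on u : L2 D u -> measurable_fun D u.
Proof. by move=> /L2_measurable /(measurable_restrictT u mD). Qed.

Lemma measurable_slob_kernel u v : L2 D u -> L2 D v ->
  measurable_fun D2 (slobodeckij_kernel sigma u v).
Proof.
move=> /L2_measurable_on mu_ /L2_measurable_on mv.
have m1 w : measurable_fun D w ->
    measurable_fun D2 (fun z => w z.1 - w z.2).
  move=> mw; apply: measurable_funB.
    apply: (measurable_comp mD _ mw); last exact: measurable_funTS.
    by move=> _ [z [z1 z2] <-].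
  apply: (measurable_comp mD _ mw); last exact: measurable_funTS.
  by move=> _ [z [z1 z2] <-].
apply: measurable_funM; first by apply: measurable_funM; exact: m1.
by apply: measurable_funTS; exact: measurable_slob_weight.
Qed.

Lemma slob_kernel_ge0 u z : 0 <= slobodeckij_kernel sigma u u z.
Proof. by rewrite mulr_ge0 ?slob_weight_ge0// -expr2 sqr_ge0. Qed.

Lemma slob_finite_integrable u : L2 D u -> slobodeckij_finite D sigma u ->
  nu.-integrable D2 (EFin \o slobodeckij_kernel sigma u u).
Proof.
move=> uL fu; apply/integrableP; split.
  by apply/measurable_EFinP; exact: measurable_slob_kernel.
move: fu; congr (_ < _)%E; apply: eq_integral => z _.
by rewrite /= ger0_norm ?slob_kernel_ge0.
Qed.

(** By the pointwise bound [2 a b <= a ^ 2 + b ^ 2] on increments. *)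
Lemma slob_integrable u v : L2 D u -> L2 D v ->
  slobodeckij_finite D sigma u -> slobodeckij_finite D sigma v ->
  nu.-integrable D2 (EFin \o slobodeckij_kernel sigma u v).
Proof.
move=> uL vL /(slob_finite_integrable uL) iu /(slob_finite_integrable vL) iv.
apply: (@le_integrable _ _ _ _ _ mD2 _ (fun z => (slobodeckij_kernel sigma u u z)%:E +
   (slobodeckij_kernel sigma v v z)%:E)%E).
- by apply/measurable_EFinP; exact: measurable_slob_kernel.
- move=> z _ /=; rewrite lee_fin.
  rewrite [leRHS]ger0_norm ?addr_ge0 ?slob_kernel_ge0//.
  rewrite /slobodeckij_kernel -mulrDl normrM.
  rewrite (ger0_norm (slob_weight_ge0 z)) ler_wpM2r ?slob_weight_ge0//.
  set a := u z.1 - u z.2; set b := v z.1 - v z.2.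
  rewrite ler_norml; have := sqr_ge0 (a + b); have := sqr_ge0 (a - b).
  have := sqr_ge0 a; have := sqr_ge0 b; rewrite sqrrD sqrrB -!expr2.
  by lra.
- exact: integrableD.
Qed.

Lemma slobC u v : slobodeckij D sigma u v = slobodeckij D sigma v u.
Proof.
by apply: eq_Rintegral => z _; rewrite /slobodeckij_kernel [_ * (v _ - _)]mulrC.
Qed.

Lemma slobDl u v w c : L2 D u -> L2 D v -> L2 D w ->
  slobodeckij_finite D sigma u -> slobodeckij_finite D sigma v ->
  slobodeckij_finite D sigma w ->
  slobodeckij D sigma (fun x => c * u x + v x) w =
  c * slobodeckij D sigma u w + slobodeckij D sigma v w.
Proof.
move=> uL vL wL fu fv fw; rewrite /slobodeckij.
have iu := slob_integrable uL wL fu fw.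
have iv := slob_integrable vL wL fv fw.
rewrite -RintegralZl// -RintegralD//; last first.
  have := integrableZl mD2 c iu.
  by rewrite (_ : (fun _ => _) = EFin \o (fun z => c * slobodeckij_kernel sigma u w z)).
by apply: eq_Rintegral => z _; rewrite /slobodeckij_kernel; ring.
Qed.

Lemma slob_finiteD u v c : L2 D u -> L2 D v ->
  slobodeckij_finite D sigma u -> slobodeckij_finite D sigma v ->
  slobodeckij_finite D sigma (fun x => c * u x + v x).
Proof.
move=> uL vL fu fv.
have iu := slob_finite_integrable uL fu.
have iv := slob_finite_integrable vL fv.
have iw := integrableD mD2 (integrableZl mD2 (2 * c ^+ 2) iu) (integrableZl mD2 2 iv).
have uvL : L2 D (fun x => c * u x + v x) by exact: L2D (L2Z c uL) vL.
have : nu.-integrable D2 (EFin \o slobodeckij_kernel sigma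
    (fun x => c * u x + v x) (fun x => c * u x + v x)).
  apply: (le_integrable mD2 _ _ iw).
    by apply/measurable_EFinP; exact: measurable_slob_kernel.
  move=> z _ /=; rewrite lee_fin ger0_norm ?slob_kernel_ge0//.
  apply: le_trans (ler_norm _); rewrite /slobodeckij_kernel.
  rewrite !mulrA -mulrDl ler_wpM2r ?slob_weight_ge0//.
  set a := u z.1 - u z.2; set b := v z.1 - v z.2.
  rewrite (_ : c * u z.1 + v z.1 - (c * u z.2 + v z.2) = c * a + b); last first.
    by rewrite /a /b; ring.
  rewrite -subr_ge0 (_ : _ - _ = (c * a - b) ^+ 2) ?sqr_ge0//.
  by ring.
move=> /integrableP[_]; congr (_ < _)%E; apply: eq_integral => z _.
by rewrite /= ger0_norm ?slob_kernel_ge0.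
Qed.

Lemma slob_finite0 : slobodeckij_finite D sigma (fun _ => 0).
Proof.
rewrite /slobodeckij_finite.
rewrite (_ : (fun _ => _) = cst 0%E) ?integral0 ?ltry//.
by apply/funext => z; rewrite /slobodeckij_kernel subrr !mul0r.
Qed.

Lemma slob0l u : slobodeckij D sigma (fun _ => 0) u = 0.
Proof.
rewrite /slobodeckij /Rintegral.
rewrite (_ : (fun _ => _) = cst 0%E) ?integral0//.
by apply/funext => z; rewrite /slobodeckij_kernel subrr !mul0r.
Qed.

Section Combination.
Context (I : Type) (c : I -> R) (F : I -> 'rV[R]_n -> R).
Hypotheses (FL : forall i, L2 D (F i))
  (fF : forall i, slobodeckij_finite D sigma (F i)).

Lemma slob_finite_lin (r : seq I) :
  slobodeckij_finite D sigma (fun x => \sum_(i <- r) c i * F i x).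
Proof.
elim: r => [|i r IH].
  rewrite (_ : (fun _ => _) = (fun=> 0)); first exact: slob_finite0.
  by apply/funext => x; rewrite big_nil.
rewrite (_ : (fun _ => _) = (fun x => c i * F i x + \sum_(i <- r) c i * F i x)).
  by apply: slob_finiteD => //; exact: L2_lin.
by apply/funext => x; rewrite big_cons.
Qed.

Lemma slob_suml (r : seq I) w : L2 D w -> slobodeckij_finite D sigma w ->
  slobodeckij D sigma (fun x => \sum_(i <- r) c i * F i x) w =
  \sum_(i <- r) c i * slobodeckij D sigma (F i) w.
Proof.
move=> wL fw; elim: r => [|i r IH].
  rewrite big_nil -[RHS](slob0l w); congr slobodeckij.
  by apply/funext => x; rewrite big_nil.
rewrite big_cons -IH -slobDl//; [|exact: L2_lin|exact: slob_finite_lin].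
by congr slobodeckij; apply/funext => x; rewrite big_cons.
Qed.

End Combination.

End Slobodeckij.

(** * Gram kernels of Sobolev scalar products *)

Section SobolevForm.
Context {R : realType} {n : nat} (D : set 'rV[R]_n) (s : R).
Hypothesis oD : open D.

Lemma sob_dot_ge0 (u : sobolev D s) : 0 <= sob_dot u u.
Proof.
rewrite /sob_dot addr_ge0 ?sumr_ge0// => [a _|]; first exact: dot2_ge0.
case: ifP => // _; apply: sumr_ge0 => a _.
by apply: Rintegral_ge0 => z _; exact: slob_kernel_ge0.
Qed.

Lemma sob_norm_sqr (u : sobolev D s) : sob_norm u ^+ 2 = sob_dot u u.
Proof. by rewrite sqr_sqrtr// sob_dot_ge0. Qed.

Lemma sder_L2 (u : sobolev D s) a : (\sum_i a i <= int_part s)%N -> L2 D (sder u a).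
Proof. by move=> /(sobolev_der u) []. Qed.

Section Combination.
Context (Q : finType) (c : Q -> R) (u : Q -> sobolev D s).

Lemma weak_derivative_lin a : (\sum_i a i <= int_part s)%N ->
  weak_derivative D a (fun x => \sum_q c q * u q x)
    (fun x => \sum_q c q * sder (u q) a x).
Proof.
move=> ha; split; first by apply: L2_lin => q _; exact: sder_L2.
move=> phi tphi.
rewrite (@dot2_suml _ _ _ _ _ _ c _ _ (fun q _ => sobolev_L2 (u q)) (test_function_L2 _ oD tphi)).
rewrite (@dot2_suml _ _ _ _ _ _ c _ _ (fun q _ => sder_L2 (u q) ha) (test_function_L2 [::] oD tphi)).
rewrite mulr_sumr; apply: eq_bigr => q _.
by rewrite (sobolev_der (u q) ha).2// mulrCA.
Qed.

(** Linear combinations stay in the Sobolev space. A quadratic form in the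
    coefficients of a family, such as its Gram form, is thereby the value of
    one function, so that estimates for single functions become inequalities
    in the Loewner order. *)
Definition sob_lin : sobolev D s :=
  @Sobolev R n D s (fun x => \sum_q c q * u q x)
    (fun a x => \sum_q c q * sder (u q) a x)
    (@L2_lin _ _ _ _ _ _ c _ (fun q _ => sobolev_L2 (u q)))
    weak_derivative_lin
    (fun s0 a ha => @slob_finite_lin _ _ _ oD _ _ c _
      (fun q => sder_L2 (u q) (eq_leq ha))
      (fun q => sobolev_frac (u q) s0 ha) (index_enum Q)).

Lemma qform_sob_dot :
  qform (fun p q => sob_dot (u p) (u q)) c = sob_dot sob_lin sob_lin.
Proof.
rewrite /sob_dot qformD; congr (_ + _).
  transitivity (\sum_(a : {ffun 'I_n -> 'I_(int_part s).+1} |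
      (\sum_i a i <= int_part s)%N)
    qform (fun p q => dot2 D (sder (u p) (fun i => a i)) (sder (u q) (fun i => a i))) c).
    rewrite /qform [RHS]exchange_big/=; apply: eq_bigr => p _.
    rewrite [RHS]exchange_big/=; apply: eq_bigr => q _.
    by rewrite mulr_sumr.
  apply: eq_bigr => a ha; rewrite -norm2_lin_sqr ?norm2_sqr// => q.
  exact: sder_L2.
case: ifPn => s0; last first.
  by rewrite /qform big1// => p _; rewrite big1// => q _; rewrite mulr0.
transitivity (\sum_(a : {ffun 'I_n -> 'I_(int_part s).+1} |
      (\sum_i a i == int_part s)%N)
    qform (fun p q => slobodeckij D (frac_part s)
       (sder (u p) (fun i => a i)) (sder (u q) (fun i => a i))) c).
  rewrite /qform [RHS]exchange_big/=; apply: eq_bigr => p _.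
  rewrite [RHS]exchange_big/=; apply: eq_bigr => q _.
  by rewrite mulr_sumr.
apply: eq_bigr => a /eqP ha.
have L q : L2 D (sder (u q) (fun i => a i)) by apply: sder_L2; rewrite ha.
have F q : slobodeckij_finite D (frac_part s) (sder (u q) (fun i => a i)).
  exact: sobolev_frac.
rewrite [RHS]slob_suml//; last 2 first.
- exact: L2_lin.
- exact: slob_finite_lin.
apply: eq_bigr => p _; rewrite slobC slob_suml// mulr_sumr.
by apply: eq_bigr => q _; rewrite mulrA slobC.
Qed.

Lemma psd_sob_dot_nonneg : 0 <= qform (fun p q => sob_dot (u p) (u q)) c.
Proof. by rewrite qform_sob_dot sob_dot_ge0. Qed.

End Combination.

Lemma sob_dotC (u v : sobolev D s) : sob_dot u v = sob_dot v u.
Proof.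
rewrite /sob_dot; congr (_ + _); first by apply: eq_bigr => a _; exact: dot2C.
by case: ifP => // _; apply: eq_bigr => a _; exact: slobC.
Qed.

Lemma psd_sob_dot (Q : finType) (u : Q -> sobolev D s) :
  psd (fun p q => sob_dot (u p) (u q)).
Proof. by split=> [p q|c]; [exact: sob_dotC|exact: psd_sob_dot_nonneg]. Qed.

End SobolevForm.

(** * Wavelet coefficients in one variable *)

Section Multiscale.
Context {R : realType} {n : nat} {D : set 'rV[R]_n} {r : nat}.
Variable ms : multiscale D r.
Implicit Types (u v w : 'rV[R]_n -> R) (J : nat).

Definition wcoef j (k : ms_index ms j) u : R := dot2 D u (dpsi k).

Definition wsum J (a : forall j, ms_index ms j -> R) : 'rV[R]_n -> R :=
  fun x => \sum_(j < J) \sum_k a j k * psi k x.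

Definition wproj J u : 'rV[R]_n -> R := wsum J (fun j k => wcoef k u).

Lemma L2_wsum J a : L2 D (wsum J a).
Proof. by apply: L2_sum => j _; apply: L2_lin => k _; exact: psi_L2. Qed.

Lemma wcoef_psi j j' (k : ms_index ms j) (k' : ms_index ms j') :
  wcoef k' (psi k) = (Tagged (fun j => ms_index ms j : Type) k ==
    Tagged (fun j => ms_index ms j : Type) k' :> {j & ms_index ms j})%:R.
Proof. exact: psi_biorthogonal. Qed.

Lemma wcoef_level j (a : ms_index ms j -> R) j' (k' : ms_index ms j') :
  dot2 D (fun x => \sum_k a k * psi k x) (dpsi k') =
  \sum_k a k * wcoef k' (psi k).
Proof.
by rewrite dot2_suml//; [move=> k _; exact: psi_L2|exact: dpsi_L2].
Qed.

Lemma wcoef_level_same j (a : ms_index ms j -> R) (k' : ms_index ms j) :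
  dot2 D (fun x => \sum_k a k * psi k x) (dpsi k') = a k'.
Proof.
rewrite wcoef_level (bigD1 k')//= wcoef_psi eqxx mulr1 big1 ?addr0// => k kk'.
by rewrite wcoef_psi -tag_eqE /tag_eq eqxx/= tagged_asE (negbTE kk') mulr0.
Qed.

Lemma wcoef_level_neq j (a : ms_index ms j -> R) j' (k' : ms_index ms j') :
  j != j' -> dot2 D (fun x => \sum_k a k * psi k x) (dpsi k') = 0.
Proof.
move=> jj'; rewrite wcoef_level big1// => k _.
by rewrite wcoef_psi -tag_eqE /tag_eq/= (negbTE jj') mulr0.
Qed.

Lemma wcoef_wsum J a j (k : ms_index ms j) :
  wcoef k (wsum J a) = if (j < J)%N then a j k else 0.
Proof.
rewrite /wcoef /wsum.
rewrite (_ : (fun x => _) = (fun x => \sum_(i < J) 1 *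
    (fun x => \sum_k a i k * psi k x) x)); last first.
  by apply/funext => x; apply: eq_bigr => i _; rewrite mul1r.
rewrite dot2_suml; [|by move=> i _; apply: L2_lin => k' _; exact: psi_L2|
  exact: dpsi_L2].
case: ifPn => jJ.
  rewrite (bigD1 (Ordinal jJ))//= mul1r wcoef_level_same big1 ?addr0// => i ij.
  by rewrite wcoef_level_neq ?mulr0.
rewrite big1// => i _; rewrite wcoef_level_neq ?mulr0//.
by apply: contra jJ => /eqP <-.
Qed.

Lemma wproj_wsum J J' a : (J' <= J)%N -> wproj J (wsum J' a) = wsum J' a.
Proof.
move=> JJ; apply/funext => x; rewrite /wproj /wsum.
rewrite (big_ord_widen _ (fun j => \sum_(k : ms_index ms j) a j k * psi k x) JJ).
rewrite [RHS]big_mkcond; apply: eq_bigr => j _.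
rewrite -/(wsum J' a); under eq_bigr do rewrite wcoef_wsum.
by case: ifP => // _; rewrite big1// => k _; rewrite mul0r.
Qed.

Lemma wcoefB j (k : ms_index ms j) u v : L2 D u -> L2 D v ->
  wcoef k (u \- v) = wcoef k u - wcoef k v.
Proof. by move=> uL vL; rewrite /wcoef dot2Bl//; exact: dpsi_L2. Qed.

Lemma wprojB J u v : L2 D u -> L2 D v ->
  wproj J (u \- v) = wproj J u \- wproj J v.
Proof.
move=> uL vL; apply/funext => x; rewrite /wproj /wsum /= -sumrB.
apply: eq_bigr => j _; rewrite -sumrB; apply: eq_bigr => k _.
by rewrite wcoefB// mulrBl.
Qed.

Definition wenergy J u : R := \sum_(j < J) \sum_(k : ms_index ms j) wcoef k u ^+ 2.

Lemma wenergy_wsum J J' a :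
  wenergy J (wsum J' a) <= \sum_(j < J') \sum_(k : ms_index ms j) a j k ^+ 2.
Proof.
rewrite /wenergy; have H j : \sum_(k : ms_index ms j) wcoef k (wsum J' a) ^+ 2 =
    if (j < J')%N then \sum_(k : ms_index ms j) a j k ^+ 2 else 0.
  under eq_bigr do rewrite wcoef_wsum.
  by case: ifP => // _; rewrite big1// => k _; rewrite expr0n.
rewrite (eq_bigr _ (fun (j : 'I_J) _ => H j)) -big_mkcond/=.
have [JJ|/ltnW JJ] := leqP J J'.
  rewrite (eq_bigl xpredT); last by move=> j; rewrite (leq_trans (ltn_ord j)).
  rewrite (big_ord_widen _ (fun j => \sum_(k : ms_index ms j) a j k ^+ 2) JJ).
  rewrite big_mkcond/=; apply: ler_sum => j _; case: ifP => // _.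
  by apply: sumr_ge0 => k _; exact: sqr_ge0.
by rewrite -(big_ord_widen _ (fun j => \sum_(k : ms_index ms j) a j k ^+ 2) JJ).
Qed.

(** The lower Riesz bound controls the coefficients of finite combinations
    only. It extends to L2 by density: the remainder is absorbed with the
    Cauchy-Schwarz bound, which depends on [J], so the approximation has to be
    chosen after [J]. *)
Lemma wenergy_bound : exists2 K : R, 0 < K &
  forall J u, L2 D u -> wenergy J u <= K * norm2 D u ^+ 2.
Proof.
have [c [C [c0 C0 riesz]]] := psi_riesz ms.
(* [(x + y) ^ 2 <= 2 x ^ 2 + 2 y ^ 2] separates the approximation, of norm at
   most twice that of [u], from the remainder. *)
exists (8 / c + 2); first by rewrite addr_gt0 ?divr_gt0.
move=> J u uL.
pose M : R := \sum_(j < J) \sum_(k : ms_index ms j) norm2 D (dpsi k) ^+ 2.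
have M0 : 0 <= M by apply: sumr_ge0 => j _; apply: sumr_ge0 => k _; exact: sqr_ge0.
have crude w : L2 D w -> wenergy J w <= M * norm2 D w ^+ 2.
  move=> wL; rewrite mulr_suml; apply: ler_sum => j _.
  rewrite mulr_suml; apply: ler_sum => k _.
  rewrite -[wcoef k w ^+ 2]real_normK ?num_real// -exprMn.
  rewrite ler_sqr ?nnegrE ?mulr_ge0 ?norm2_ge0// mulrC.
  exact: dot2_CS (dpsi_L2 k).
have [u0|u0] := eqVneq (norm2 D u) 0.
  by apply: le_trans (crude u uL) _; rewrite u0 expr0n !mulr0.
have up : 0 < norm2 D u by rewrite lt_def u0 norm2_ge0.
have [|J' [a ua]] := @psi_dense _ _ _ _ ms u uL (norm2 D u / (1 + M)).
  by rewrite divr_gt0// ltr_wpDr.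
set v := wsum J' a in ua.
have vL : L2 D v by exact: L2_wsum.
have uvL : L2 D (u \- v) by exact: L2B.
have {}ua : norm2 D (u \- v) < norm2 D u / (1 + M) by exact: ua.
have e2 : M * norm2 D (u \- v) ^+ 2 <= norm2 D u ^+ 2.
  have h : norm2 D (u \- v) ^+ 2 <= (norm2 D u / (1 + M)) ^+ 2.
    by rewrite ler_sqr ?nnegrE ?norm2_ge0 ?(ltW ua)// divr_ge0 ?addr_ge0 ?norm2_ge0.
  apply: le_trans (ler_wpM2l M0 h) _.
  rewrite expr_div_n mulrCA ler_piMr ?sqr_ge0//.
  rewrite ler_pdivrMr ?mul1r ?exprn_gt0 ?ltr_wpDr//.
  by rewrite sqrrD expr1n mul1r -subr_ge0; have := sqr_ge0 M; lra.
have nv : norm2 D v <= 2 * norm2 D u.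
  rewrite (_ : v = u \+ (v \- u)); last by apply/funext => x /=; rewrite addrC subrK.
  apply: le_trans (norm2D uL (L2B vL uL)) _.
  rewrite norm2BC; have : norm2 D u / (1 + M) <= norm2 D u.
    by rewrite ler_pdivrMr ?ltr_wpDr// ler_peMr ?norm2_ge0// lerDl.
  by move: ua; lra.
have Ev : wenergy J v <= 4 / c * norm2 D u ^+ 2.
  apply: le_trans (wenergy_wsum _ _ _) _.
  rewrite mulrAC ler_pdivlMr// mulrC.
  have /andP[h _] := riesz J' a; apply: le_trans h _.
  by rewrite (_ : 4 = 2 ^+ 2 :> R) -?exprMn ?ler_sqr ?nnegrE ?mulr_ge0 ?norm2_ge0//; ring.
have E2 : wenergy J u <= 2 * wenergy J v + 2 * wenergy J (u \- v).
  rewrite /wenergy !mulr_sumr -big_split/=; apply: ler_sum => j _.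
  rewrite !mulr_sumr -big_split/=; apply: ler_sum => k _.
  rewrite wcoefB//; set x := wcoef k u; set y := wcoef k v.
  have := sqr_ge0 (x - 2 * y); rewrite -subr_ge0 => h.
  rewrite -subr_ge0 (_ : _ - _ = (x - 2 * y) ^+ 2) ?sqr_ge0//.
  by ring.
have := crude _ uvL => E3; apply: le_trans E2 _.
rewrite (_ : (8 / c + 2) * _ =
  2 * (4 / c * norm2 D u ^+ 2) + 2 * norm2 D u ^+ 2); last by ring.
by apply: lerD; rewrite ler_pM2l//; exact: le_trans E3 e2.
Qed.

Lemma wproj_bound : exists2 K : R, 0 < K &
  forall J u, L2 D u -> norm2 D (wproj J u) <= K * norm2 D u.
Proof.
have [K K0 KE] := wenergy_bound.
have [c [C [c0 C0 riesz]]] := psi_riesz ms.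
exists (Num.sqrt (C * K)) => [|J u uL]; first by rewrite sqrtr_gt0 mulr_gt0.
rewrite -ler_sqr ?nnegrE ?mulr_ge0 ?sqrtr_ge0 ?norm2_ge0//.
rewrite exprMn sqr_sqrtr ?(ltW (mulr_gt0 C0 K0))// -mulrA.
have /andP[_ h] := riesz J (fun j k => wcoef k u).
by apply: le_trans h _; rewrite ler_pM2l//; exact: KE.
Qed.

(** The projections are uniformly bounded and reproduce finite combinations,
    which are dense. *)
Lemma wproj_cvg u : L2 D u -> forall e : R, 0 < e ->
  exists J0, forall J, (J0 <= J)%N -> norm2 D (u \- wproj J u) < e.
Proof.
move=> uL e e0; have [K K0 KP] := wproj_bound.
have [|J' [a ua]] := @psi_dense _ _ _ _ ms u uL (e / (1 + K)).
  by rewrite divr_gt0// addr_gt0.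
exists J' => J JJ; set v := wsum J' a in ua.
have vL : L2 D v by exact: L2_wsum.
have uvL : L2 D (u \- v) by exact: L2B.
rewrite (_ : _ \- _ = (u \- v) \- wproj J (u \- v)); last first.
  rewrite wprojB// wproj_wsum//; apply/funext => x /=.
  by rewrite opprB addrA subrK.
have wL : L2 D (wproj J (u \- v)) by exact: L2_wsum.
apply: le_lt_trans (norm2_leB uvL wL) _.
apply: le_lt_trans (lerD (lexx _) (KP J _ uvL)) _.
rewrite -[X in X + _]mul1r -mulrDl mulrC -ltr_pdivlMr// ?addr_gt0//.
Qed.

Section Sobolev.
Variable s : R.
Hypothesis hs : 0 <= s <= r%:R.

(** On a single level the lower Riesz bound turns the decay of the projections
    onto the complement spaces into decay of the coefficients. *)
Lemma wcoef_decay : exists2 C : R, 0 < C & forall j (u : sobolev D s),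
  \sum_(k : ms_index ms j) wcoef k u ^+ 2 <=
    C * (2 `^ (- (j%:R * s))) ^+ 2 * sob_dot u u.
Proof.
have [c [C [c0 C0 riesz]]] := psi_riesz ms.
have [C' QB] := msQ_bound ms hs.
exists ((1 + C' ^+ 2) / c) => [|j u]; first by rewrite divr_gt0// ltr_wpDr ?sqr_ge0.
pose a j' (k : ms_index ms j') : R := if j' == j then wcoef k u else 0.
have /andP[h _] := riesz j.+1 a.
have E1 : \sum_(j' < j.+1) \sum_k a j' k ^+ 2 =
    \sum_(k : ms_index ms j) wcoef k u ^+ 2.
  rewrite big_ord_recr /= big1 ?add0r/a ?eqxx// => i _.
  by rewrite big1// => k _; rewrite ltn_eqF// expr0n.
have E2 : (fun x => \sum_(j' < j.+1) \sum_k a j' k * psi k x) =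
    (fun x => \sum_(k : ms_index ms j) dot2 D u (dpsi k) * psi k x).
  apply/funext => x; rewrite big_ord_recr /= big1 ?add0r/a ?eqxx// => i _.
  by rewrite big1// => k _; rewrite ltn_eqF// mul0r.
rewrite E1 E2 in h.
rewrite [leRHS](_ : _ = ((1 + C' ^+ 2) * (2 `^ (- (j%:R * s))) ^+ 2 *
  sob_dot u u) / c); last by ring.
rewrite ler_pdivlMr// mulrC.
apply: le_trans h _.
rewrite -(sob_norm_sqr u).
apply: (@le_trans _ _ ((C' * 2 `^ (- (j%:R * s)) * sob_norm u) ^+ 2)).
  have := QB j u; move: (norm2_ge0 D (fun x => \sum_(k : ms_index ms j)
     dot2 D u (dpsi k) * psi k x)) => n0 nl.
  by rewrite ler_sqr ?nnegrE//; exact: le_trans nl.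
rewrite [leLHS](_ : _ = C' ^+ 2 * ((2 `^ (- (j%:R * s))) ^+ 2 *
  sob_norm u ^+ 2)); last by ring.
rewrite -[leRHS]mulrA; apply: ler_wpM2r; first by rewrite mulr_ge0 ?sqr_ge0.
by rewrite lerDr.
Qed.

(** The scaling factors of the approximation estimates are 1 at level 0: there,
    Jackson's estimate controls [u - P u] and the stability of [P] controls
    [P u], for the projection [P] onto the coarsest space. This route avoids
    identifying the weak derivative of order zero of [u] with [u]. *)
Lemma L2_sobolev_bound : exists2 C : R, 0 < C & forall u : sobolev D s,
  norm2 D u <= C * sob_norm u.
Proof.
have [K K0 KP] := wproj_bound.
have [C1 QB] := msQ_bound ms hs.
have [C2 JB] := ms_jackson ms hs.
exists (1 + (1 + K) * `|C2| + `|C1|) => [|u].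
  by rewrite ltr_wpDr// ltr_wpDr// mulr_ge0// addr_ge0// ltW.
have uL := sobolev_L2 u.
have sn0 : 0 <= sob_norm u by exact: sqrtr_ge0.
have P1 : norm2 D (wproj 1 u) <= `|C1| * sob_norm u.
  rewrite (_ : wproj 1 u = (fun x => \sum_(k : ms_index ms 0%N)
    dot2 D u (dpsi k) * psi k x)); last first.
    by apply/funext => x; rewrite /wproj /wsum big_ord1.
  apply: le_trans (QB 0%N u) _; rewrite mul0r oppr0 powRr0 mulr1.
  by rewrite ler_wpM2r// ler_norm.
have V0 v : msV ms 0 v -> norm2 D (u \- wproj 1 u) <= (1 + K) * norm2 D (u \- v).
  rewrite -ms_W0 ms_W_span => -[vL [a va]].
  pose v' := wsum 1 (fun j k => (if j is 0%N as j0 return ms_index ms j0 -> R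
    then a else fun=> 0) k).
  have v'L : L2 D v' by exact: L2_wsum.
  have vv : ae_eq (lebesgue_rV R n) D v v'.
    by apply: filterS va => x H Dx; rewrite H// /v' /wsum big_ord1.
  rewrite (ae_eq_norm2B vL v'L uL vv).
  have uvL : L2 D (u \- v') by exact: L2B.
  have wL : L2 D (wproj 1 (u \- v')) by exact: L2_wsum.
  rewrite (_ : _ \- _ = (u \- v') \- wproj 1 (u \- v')); last first.
    by rewrite wprojB// wproj_wsum//; apply/funext => x /=; rewrite opprB addrA subrK.
  apply: le_trans (norm2_leB uvL wL) _.
  by rewrite mulrDl mul1r lerD2l; exact: KP.
have P2 : norm2 D (u \- wproj 1 u) <= (1 + K) * (`|C2| * sob_norm u).
  rewrite -ler_pdivrMl ?addr_gt0//.
  have := JB 0%N u; rewrite mul0r oppr0 powRr0 mulr1 => H.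
  apply: (@le_trans _ _ (C2 * sob_norm u)); last by rewrite ler_wpM2r// ler_norm.
  apply: le_trans H; apply: lb_le_inf.
    exists (norm2 D (u \- cst 0)); exists (cst 0) => //.
    rewrite -ms_W0 ms_W_span; split; first exact: L20.
    exists (fun=> 0); apply/nearW => x _ /=.
    by rewrite big1// => k _; rewrite mul0r.
  move=> _ [v /V0 H <-]; rewrite ler_pdivrMl ?addr_gt0//.
have wL : L2 D (wproj 1 u) by exact: L2_wsum.
have E : (u : 'rV[R]_n -> R) = (u \- wproj 1 u) \+ wproj 1 u.
  by apply/funext => x /=; rewrite subrK.
rewrite [X in norm2 D X <= _]E.
apply: le_trans (norm2D (L2B uL wL) wL) _.
move: P1 P2; rewrite !mulrDl mul1r !mulrA; lra.
Qed.

End Sobolev.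

End Multiscale.

(** * Numbered wavelets and coefficient kernels *)

Section FlatWavelets.
Context {R : realType} {n : nat} {D : set 'rV[R]_n} {r : nat}.
Variable ms : multiscale D r.
Implicit Types (u v w : 'rV[R]_n -> R).

Definition wcard j := #|ms_index ms j|.

Lemma msW_sub_msV j : msW ms j `<=` msV ms j.
Proof.
case: j => [|j]; first by rewrite ms_W0.
have [E _] := ms_sum ms j; rewrite E => u uW; split.
  by move: uW; rewrite ms_W_span => -[].
exists (cst 0), u; split=> //; last by apply/nearW => x _ /=; rewrite add0r.
have [d [/(_ j) [b [_ _ ->]] _]] := ms_dim ms.
split; first exact: L20.
by exists (fun=> 0); apply/nearW => x _ /=; rewrite big1// => k _; rewrite mul0r.
Qed.

Lemma psi_msV j (k : ms_index ms j) : msV ms j (psi k).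
Proof.
apply: msW_sub_msV; rewrite ms_W_span; split; first exact: psi_L2.
exists (fun k' => (k' == k)%:R); apply/nearW => x _.
rewrite (bigD1 k)//= eqxx mul1r big1 ?addr0// => k' /negbTE ->.
by rewrite mul0r.
Qed.

(** Biorthogonality makes the wavelets of a level linearly independent, so
    there are at most as many of them as the dimension of the space. *)
Lemma wcard_bound : exists2 C : R, 0 < C &
  forall j, (wcard j)%:R <= C * 2 ^+ (j * n).
Proof.
have [d [hd [c [C [_ C0 dC]]]]] := ms_dim ms.
exists C => // j; have /andP[_] := dC j; apply: le_trans; rewrite ler_nat.
have [b [bL _ VE]] := hd j.
have H (k : ms_index ms j) : exists a : 'I_(d j) -> R,
    ae_eq (lebesgue_rV R n) D (psi k) (fun x => \sum_l a l * b l x).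
  by have := psi_msV k; rewrite VE => -[_].
have [a aE] := choice H.
pose A : 'M[R]_(wcard j, d j) := \matrix_(k, l) a (enum_val k) l.
suff : row_free A by move=> /eqP <-; exact: rank_leq_col.
apply: inj_row_free => v vA; apply/rowP => k'; rewrite mxE.
have -> : v ord0 k' = dot2 D (fun x => \sum_k v ord0 (enum_rank k) * psi k x)
    (dpsi (enum_val k')) by rewrite wcoef_level_same enum_valK.
rewrite (@ae_eq_dot2 _ _ _ _ (cst 0)) ?dot20l//.
- by apply: L2_lin => k _; exact: psi_L2.
- exact: L20.
- exact: dpsi_L2.
have aeA : {ae lebesgue_rV R n, forall x, forall k : ms_index ms j,
    D x -> psi k x = \sum_l a k l * b l x} by exact: filter_forall aE.
apply: filterS aeA => x ax Dx.
rewrite (eq_bigr (fun k => \sum_l v ord0 (enum_rank k) * a k l * b l x)); last first.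
  by move=> k _; rewrite ax// mulr_sumr; apply: eq_bigr => l _; rewrite mulrA.
rewrite exchange_big big1// => l _; rewrite -mulr_suml.
suff -> : \sum_k v ord0 (enum_rank k) * a k l = 0 by rewrite mul0r.
transitivity ((v *m A) ord0 l); last by rewrite vA mxE.
rewrite mxE big_enum_val/=; apply: eq_bigr => k _.
by rewrite mxE enum_valK.
Qed.

(** The wavelets of each level are numbered and padded with zero, so that a
    single finite type ['I_B * 'I_M] indexes those of the levels below [B] for
    every variable at once. *)
Definition npsi j k : 'rV[R]_n -> R :=
  if insub k : option 'I_(wcard j) is Some k' then psi (enum_val k') else cst 0.

Definition ndpsi j k : 'rV[R]_n -> R :=
  if insub k : option 'I_(wcard j) is Some k' then dpsi (enum_val k') else cst 0.

Lemma npsi_L2 j k : L2 D (npsi j k).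
Proof. by rewrite /npsi; case: insub => [k'|]; [exact: psi_L2|exact: L20]. Qed.

Lemma ndpsi_L2 j k : L2 D (ndpsi j k).
Proof. by rewrite /ndpsi; case: insub => [k'|]; [exact: dpsi_L2|exact: L20]. Qed.

Lemma npsi_out j k : (wcard j <= k)%N -> npsi j k = cst 0.
Proof. by move=> jk; rewrite /npsi insubF// ltnNge jk. Qed.

Lemma sum_insub j M (F : ms_index ms j -> R) : (wcard j <= M)%N ->
  \sum_(k < M) (if insub (k : nat) : option 'I_(wcard j) is Some k'
     then F (enum_val k') else 0) = \sum_k F k.
Proof.
move=> jM; rewrite [RHS]big_enum_val/=.
pose G (k : nat) := if insub k : option 'I_(wcard j) is Some k'
     then F (enum_val k') else 0.
have -> : \sum_(i < wcard j) F (enum_val i) = \sum_(i < wcard j) G i.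
  by apply: eq_bigr => i _; rewrite /G valK.
rewrite (big_ord_widen _ G jM) [RHS]big_mkcond; apply: eq_bigr => k _.
by rewrite -/(G k); case: ifPn => // jk; rewrite /G insubF//; exact: negbTE.
Qed.

Lemma npsi_proj j M u x : (wcard j <= M)%N ->
  \sum_(k < M) dot2 D u (ndpsi j k) * npsi j k x =
  \sum_(k : ms_index ms j) wcoef k u * psi k x.
Proof.
move=> jM; rewrite -(sum_insub _ jM); apply: eq_bigr => k _.
by rewrite /npsi /ndpsi; case: insub => //; rewrite mulr0.
Qed.

Lemma npsi_energy j M u : (wcard j <= M)%N ->
  \sum_(k < M) dot2 D u (ndpsi j k) ^+ 2 = \sum_(k : ms_index ms j) wcoef k u ^+ 2.
Proof.
move=> jM; rewrite -(sum_insub _ jM); apply: eq_bigr => k _.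
rewrite /npsi /ndpsi; case: insub => //.
by rewrite dot2C dot20l expr0n.
Qed.

(** Under this condition no wavelet below level [B] is lost. *)
Definition wlarge B M := forall j, (j < B)%N -> (wcard j <= M)%N.

Lemma npsi_riesz : exists2 C : R, 0 < C & forall B M, wlarge B M ->
  forall a : 'I_B * 'I_M -> R,
  norm2 D (fun x => \sum_lam a lam * npsi lam.1 lam.2 x) ^+ 2 <=
  C * \sum_lam a lam ^+ 2.
Proof.
have [c [C [c0 C0 riesz]]] := psi_riesz ms; exists C => // B M BM a.
pose a' j (k : ms_index ms j) : R :=
  if insub j : option 'I_B is Some j' then
    if insub (enum_rank k : nat) : option 'I_M is Some k' then a (j', k') else 0
  else 0.
have a'E (j : 'I_B) (k : 'I_M) (k' : 'I_(wcard j)) : insub (k : nat) = Some k' ->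
    a' j (enum_val k') = a (j, k).
  by case: insubP => // k2 _ k2k [<-]; rewrite /a' valK enum_valK k2k valK.
have pairE (F : 'I_B -> 'I_M -> R) :
    \sum_(lam : 'I_B * 'I_M) F lam.1 lam.2 = \sum_(j < B) \sum_(k < M) F j k.
  by rewrite pair_bigA.
have psiE : (fun x => \sum_lam a lam * npsi lam.1 lam.2 x) = wsum B a'.
  apply/funext => x.
  rewrite (eq_bigr (fun lam => a (lam.1, lam.2) * npsi lam.1 lam.2 x));
    last by case.
  rewrite (pairE (fun j k => a (j, k) * npsi j k x)); apply: eq_bigr => j _.
  rewrite -(sum_insub _ (BM j (ltn_ord j))); apply: eq_bigr => k _.
  rewrite /npsi; case E: insub => [k'|]; last by rewrite mulr0.
  by rewrite (a'E _ _ _ E).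
rewrite psiE; have /andP[_] := riesz B a'; move/le_trans; apply.
rewrite ler_pM2l// [leRHS](eq_bigr (fun lam => a (lam.1, lam.2) ^+ 2));
  last by case.
rewrite (pairE (fun j k => a (j, k) ^+ 2)); apply: ler_sum => j _.
rewrite -(sum_insub _ (BM j (ltn_ord j))); apply: ler_sum => k _.
case E: insub => [k'|]; last exact: sqr_ge0.
by rewrite (a'E _ _ _ E).
Qed.

Lemma npsi_cvg u : L2 D u -> forall e : R, 0 < e ->
  exists B0, forall B M, (B0 <= B)%N -> wlarge B M ->
  norm2 D (u \- (fun x => \sum_(lam : 'I_B * 'I_M)
     dot2 D u (ndpsi lam.1 lam.2) * npsi lam.1 lam.2 x)) < e.
Proof.
move=> uL e e0; have [B0 H] := wproj_cvg ms uL e0.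
exists B0 => B M BB BM; have := H B BB; congr (norm2 D (u \- _) < e).
apply/funext => x; rewrite /wproj /wsum.
rewrite -(pair_bigA _ (fun (j : 'I_B) (k : 'I_M) =>
  dot2 D u (ndpsi j k) * npsi j k x))/=.
by apply: eq_bigr => j _; rewrite npsi_proj//; exact: BM.
Qed.

Section Forms.
Variable s : R.
Hypotheses (oD : open D) (hs : 0 <= s <= r%:R).

(** The Gram kernel of the vectors of coefficients of level [j]. *)
Definition level_form (Q : finType) (u : Q -> sobolev D s) M j (p q : Q) : R :=
  \sum_(k < M) dot2 D (u p) (ndpsi j k) * dot2 D (u q) (ndpsi j k).

Lemma psd_level_form (Q : finType) (u : Q -> sobolev D s) M j :
  psd (level_form u M j).
Proof. by apply: psd_sum => k _; exact: psd_rank1. Qed.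

Lemma qform_level_form (Q : finType) (u : Q -> sobolev D s) M j c :
  (wcard j <= M)%N ->
  qform (level_form u M j) c =
  \sum_(k : ms_index ms j) wcoef k (sob_lin oD c u) ^+ 2.
Proof.
move=> jM; rewrite -(npsi_energy _ jM).
rewrite /qform; under eq_bigr do under eq_bigr do rewrite mulr_sumr.
under eq_bigr do rewrite exchange_big/=.
rewrite exchange_big/=; apply: eq_bigr => k _.
rewrite [in RHS]dot2_suml; [|by move=> q _; exact: sobolev_L2|exact: ndpsi_L2].
by rewrite -qform_rank1.
Qed.

(** Both forms are evaluated on the linear combination [sob_lin] of the family,
    where the inequality is the decay for a single function. *)
Lemma level_form_decay : exists2 C : R, 0 < C &
  forall (Q : finType) (u : Q -> sobolev D s) M j, (wcard j <= M)%N ->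
  psd_le (level_form u M j)
    (fun p q => C * (2 `^ (- (j%:R * s))) ^+ 2 * sob_dot (u p) (u q)).
Proof.
have [C C0 CE] := wcoef_decay ms hs; exists C => // Q u M j jM.
split=> [p q|c].
  by rewrite (psd_level_form u M j).1 sob_dotC.
rewrite qformB qformZ subr_ge0 (qform_level_form _ _ jM) qform_sob_dot.
exact: CE.
Qed.

Lemma L2_form_bound : exists2 C : R, 0 < C &
  forall (Q : finType) (u : Q -> sobolev D s),
  psd_le (fun p q => dot2 D (u p) (u q))
         (fun p q => C * sob_dot (u p) (u q)).
Proof.
have [C C0 CE] := L2_sobolev_bound ms hs; exists (C ^+ 2) => [|Q u].
  by rewrite exprn_gt0.
split=> [p q|c]; first by rewrite dot2C sob_dotC.
rewrite qformB qformZ subr_ge0 (qform_sob_dot oD) -norm2_lin_sqr; last first.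
  by move=> q; exact: sobolev_L2.
rewrite -sob_norm_sqr -exprMn.
have := CE (sob_lin oD c u) => H.
by rewrite ler_sqr ?nnegrE ?norm2_ge0// mulr_ge0 ?sqrtr_ge0// ltW.
Qed.

(** The sum over all levels is bounded with no loss in the number of levels,
    which summing the level bounds would incur for [s = 0]. *)
Lemma level_form_sum : exists2 C : R, 0 < C &
  forall (Q : finType) (u : Q -> sobolev D s) B M, wlarge B M ->
  psd_le (fun p q => \sum_(j < B) level_form u M j p q)
         (fun p q => C * sob_dot (u p) (u q)).
Proof.
have [K K0 KE] := wenergy_bound ms.
have [C C0 CE] := L2_sobolev_bound ms hs.
exists (K * C ^+ 2) => [|Q u B M BM]; first by rewrite mulr_gt0 ?exprn_gt0.
split=> [p q|c].
  rewrite sob_dotC; congr (_ - _); apply: eq_bigr => j _.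
  exact: (psd_level_form u M j).1.
rewrite qformB qformZ subr_ge0 (qform_sob_dot oD).
rewrite (_ : qform _ c = wenergy ms B (sob_lin oD c u)); last first.
  rewrite /qform; under eq_bigr do under eq_bigr do rewrite mulr_sumr.
  under eq_bigr do rewrite exchange_big/=.
  rewrite exchange_big/=; apply: eq_bigr => j _.
  by rewrite -/(qform _ c) qform_level_form//; exact: BM.
apply: le_trans (KE B _ (sobolev_L2 _)) _.
rewrite -mulrA ler_pM2l// -sob_norm_sqr -exprMn.
have := CE (sob_lin oD c u) => H.
by rewrite ler_sqr ?nnegrE ?norm2_ge0// mulr_ge0 ?sqrtr_ge0// ltW.
Qed.

End Forms.

End FlatWavelets.

(** * Sums of levels over a group of variables *)

Section Groups.
Context {R : realType}.

Lemma family_minP p (x : 'I_p -> R) : (0 < p)%N ->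
  exists i0, x i0 = family_min x /\ forall i, family_min x <= x i.
Proof.
case: p x => // p x _.
pose i0 := [arg min_(i < ord0) x i]%O.
have min0 i : x i0 <= x i by rewrite /i0; case: arg_minP => // k _; exact.
have E : family_min x = x i0.
  apply/eqP; rewrite eq_le; apply/andP; split.
    by apply: ge_inf; [exists (x i0) => _ [i _ <-]; exact: min0|exists i0].
  by apply: lb_le_inf; [exists (x i0), i0|move=> _ [i _ <-]; exact: min0].
by exists i0; rewrite E.
Qed.

(** If the minimal ratio is positive, the levels of the sparse grid adapted to
    the group are kept. If it is zero, no decay is asked for: nothing is kept,
    and the sum over all levels is bounded. *)
Lemma group_tail p (n : 'I_p -> nat) (s : 'I_p -> R) :
  (0 < p)%N -> (forall i, (0 < n i)%N) -> (forall i, 0 <= s i) ->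
  let ratio := fun i => s i / (n i)%:R in
  exists2 C : R, 0 < C & forall J : nat,
  exists I : forall B, pred {ffun 'I_p -> 'I_B},
  (forall B, \sum_(j : {ffun 'I_p -> 'I_B} | I B j) \prod_i 2 ^+ (j i * n i) <=
     C * 2 ^+ J * (1 + J%:R) ^+ (min_count ratio).-1) /\
  forall B (Q : finType) (K : 'I_p -> 'I_B -> Q -> Q -> R) (G : 'I_p -> Q -> Q -> R),
    (forall i x, psd (K i x)) ->
    (forall i, psd (G i)) ->
    (forall i x, psd_le (K i x)
      (fun q q' => (2 `^ (- (x%:R * s i))) ^+ 2 * G i q q')) ->
    (forall i, psd_le (fun q q' => \sum_x K i x q q') (G i)) ->
    psd_le (fun q q' => \sum_(j | ~~ I B j) \prod_i K i (j i) q q')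
      (fun q q' => C * (2 `^ (- (family_min ratio * J%:R))) ^+ 2 *
         (1 + J%:R) ^+ p.-1 * \prod_i G i q q').
Proof.
move=> p0 n0 s0 ratio.
have [i0 [i0E imin]] := family_minP ratio p0.
set a := family_min ratio in i0E imin *.
have nR i : 0 < (n i)%:R :> R by rewrite ltr0n.
have a_ge0 : 0 <= a by rewrite -i0E divr_ge0// ltW.
have [a0|a0] := eqVneq a 0.
  exists 1 => // J; exists (fun _ => pred0); split=> [B|B Q K G pK pG KG KS].
    by rewrite big_pred0_eq mulr_ge0// ?mulr_ge0 ?exprn_ge0// addr_ge0.
  rewrite a0 mul0r oppr0 powRr0 expr1n mulr1 mul1r.
  have H := psd_le_prod (index_enum 'I_p)
    (fun i => psd_sum (index_enum 'I_B) (fun x _ => pK i x)) KS.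
  apply: (@psd_le_trans _ _ _ (fun q q' => \prod_i G i q q')).
    apply: eq_psd H => q q'; congr (_ - _).
    by rewrite bigA_distr_bigA.
  apply: (@eq_psd _ _ (fun q q' => ((1 + J%:R) ^+ p.-1 - 1) * \prod_i G i q q')).
    by move=> q q'; rewrite mulrBl mul1r.
  apply: psdZ; last exact: psd_prod.
  by rewrite subr_ge0 exprn_ege1// lerDl.
have ap : 0 < a by rewrite lt_def a0.
have sa i : a * (n i)%:R <= s i by rewrite -ler_pdivlMr//; exact: imin.
have si0 : s i0 = a * (n i0)%:R by rewrite -i0E /ratio divfK// gt_eqF.
have [C1 C10 H1] := sparse_grid_dim ap n0 sa si0.
have [C2 C20 H2] := sparse_grid_tail i0 ap n0 sa.
exists (C1 + C2) => [|J]; first exact: addr_gt0.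
exists (fun B j => wlevel s j <= a * J%:R); split=> [B|B Q K G pK pG KG KS].
  apply: le_trans (H1 J B) _.
  have -> : min_count ratio = #|(fun i => s i == a * (n i)%:R)|.
    apply: eq_card => i; rewrite inE -/a /ratio; apply/eqP/eqP => [<-|->].
      by rewrite divfK ?gt_eqF.
    by rewrite mulfK ?gt_eqF.
  rewrite -!mulrA; apply: ler_wpM2r; last by rewrite lerDl ltW.
  by rewrite mulr_ge0 ?exprn_ge0// addr_ge0.
have pPG : psd (fun q q' => \prod_i G i q q') by exact: psd_prod.
apply: (@psd_le_trans _ _ _ (fun q q' => (\sum_(j : {ffun 'I_p -> 'I_B} |
    ~~ (wlevel s j <= a * J%:R))
     \prod_i (2 `^ (- ((j i)%:R * s i))) ^+ 2) * \prod_i G i q q')).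
  have := @psd_le_sum _ _ _ (index_enum {ffun 'I_p -> 'I_B})
    (fun j => ~~ (wlevel s j <= a * J%:R))
    (fun j q q' => \prod_i K i (j i) q q')
    (fun j q q' => \prod_i ((2 `^ (- ((j i)%:R * s i))) ^+ 2 * G i q q'))
    (fun j _ => psd_le_prod _ (fun i => pK i (j i)) (fun i => KG i (j i))).
  apply: eq_psd => q q'; congr (_ - _); rewrite mulr_suml.
  by apply: eq_bigr => j _; rewrite big_split.
set t := \sum_(j | _) _.
apply: (@eq_psd _ _ (fun q q' => ((C1 + C2) * (2 `^ (- (a * J%:R))) ^+ 2 *
    (1 + J%:R) ^+ p.-1 - t) * \prod_i G i q q')).
  by move=> q q'; rewrite mulrBl.
apply: psdZ => //; rewrite subr_ge0; apply: le_trans (H2 J B) _.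
rewrite -[leLHS]mulrA -[leRHS]mulrA; apply: ler_wpM2r; last by rewrite lerDr ltW.
by rewrite mulr_ge0 ?sqr_ge0 ?exprn_ge0// addr_ge0.
Qed.

(** Multi-indices are pairs (levels, positions within the levels); summing the
    positions out distributes over the coordinates. *)
Lemma sum_levels p B M (I : pred {ffun 'I_p -> 'I_B})
    (F : 'I_p -> 'I_B * 'I_M -> R) :
  \sum_(f : {ffun 'I_p -> 'I_B * 'I_M} | I [ffun k => (f k).1]) \prod_k F k (f k) =
  \sum_(j | I j) \prod_k \sum_(x < M) F k (j k, x).
Proof.
rewrite (partition_big (fun f : {ffun 'I_p -> 'I_B * 'I_M} => [ffun k => (f k).1]) I)//=.
apply: eq_bigr => j Ij; rewrite bigA_distr_bigA/=.
rewrite (reindex_onto (fun h : {ffun 'I_p -> 'I_M} => [ffun k => (j k, h k)])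
   (fun f : {ffun 'I_p -> 'I_B * 'I_M} => [ffun k => (f k).2])) /=.
  apply: eq_big => [h|h _]; last by apply: eq_bigr => k _; rewrite ffunE.
  have -> : [ffun k => ([ffun k => (j k, h k)] k).1] = j.
    by apply/ffunP => k; rewrite !ffunE.
  rewrite Ij eqxx/=; apply/eqP/ffunP => k; by rewrite !ffunE.
move=> f /andP[_ /eqP fj]; apply/ffunP => k.
by rewrite -fj !ffunE; case: (f k).
Qed.

End Groups.

(** * Two groups of variables *)

Section GroupJoin.
Context {l m : nat} (lm : (l < m)%N).
Local Notation e1 := (group1 lm).
Local Notation e2 := (group2 lm).

Lemma big_groups (T : Type) (idx : T) (op : Monoid.law idx) (F : 'I_m -> T) :
  \big[op/idx]_(i < m) F i =
  op (\big[op/idx]_(k < l) F (e1 k)) (\big[op/idx]_(k < m - l) F (e2 k)).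
Proof.
have lmE : (l + (m - l) = m)%N by rewrite subnKC// ltnW.
have -> : \big[op/idx]_(i < m) F i =
    \big[op/idx]_(i < l + (m - l)) F (cast_ord lmE i).
  move: (l + (m - l))%N lmE => N lmE; case: _ / lmE F => F.
  by apply: eq_bigr => i _; rewrite cast_ord_id.
rewrite big_split_ord/=; congr (op _ _); apply: eq_bigr => k _; congr F;
  exact/val_inj.
Qed.

Definition join {T : Type} (f : 'I_l -> T) (g : 'I_(m - l) -> T) (i : 'I_m) : T :=
  match fintype.split (cast_ord (esym (subnKC (ltnW lm))) i) with
  | inl k => f k
  | inr k => g k
  end.

Lemma join1 (T : Type) (f : 'I_l -> T) g k : join f g (e1 k) = f k.
Proof.
rewrite /join (_ : cast_ord _ _ = unsplit (inl k)) ?unsplitK//.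
exact/val_inj.
Qed.

Lemma join2 (T : Type) (f : 'I_l -> T) g k : join f g (e2 k) = g k.
Proof.
rewrite /join (_ : cast_ord _ _ = unsplit (inr k)) ?unsplitK//.
exact/val_inj.
Qed.

End GroupJoin.

Section Blocks.
Context {R : realType} {l m : nat} (lm : (l < m)%N) (n : 'I_m -> nat).
Local Notation e1 := (group1 lm).
Local Notation e2 := (group2 lm).

Lemma submxrow_blocks p (e : 'I_p -> 'I_m) (x : 'rV[R]_(\sum_i n i)) k :
  submxrow (blocks e x) k = submxrow x (e k).
Proof. by rewrite /blocks mxrowK. Qed.

Lemma tensor_blocks (u : forall i, 'rV[R]_(n i) -> R) x :
  tensor u x = tensor (fun k => u (e1 k)) (blocks e1 x) *
               tensor (fun k => u (e2 k)) (blocks e2 x).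
Proof.
rewrite /tensor (big_groups lm); congr (_ * _); apply: eq_bigr => k _;
  by rewrite submxrow_blocks.
Qed.

End Blocks.

(** A Riesz upper bound stays valid when a coefficient family repeats basis
    elements: the repeated coefficients add up. *)
Lemma psd_riesz_pull (R : realType) n (D : set 'rV[R]_n) (La T : finType)
    (psi : La -> 'rV[R]_n -> R) (C : R) (lam : T -> La) :
  (forall k, L2 D (psi k)) ->
  (forall a : La -> R, norm2 D (fun x => \sum_k a k * psi k x) ^+ 2 <=
     C * \sum_k a k ^+ 2) ->
  psd_le (fun t t' => dot2 D (psi (lam t)) (psi (lam t')))
         (fun t t' => C * (lam t == lam t')%:R).
Proof.
move=> psiL riesz; split=> [t t'|a]; first by rewrite dot2C eq_sym.
pose b k := \sum_(t | lam t == k) a t.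
rewrite qformB qformZ subr_ge0 -norm2_lin_sqr//.
rewrite (_ : (fun x => _) = (fun x => \sum_k b k * psi k x)); last first.
  apply/funext => x; rewrite (partition_big lam xpredT)//=.
  apply: eq_bigr => k _; rewrite mulr_suml.
  by apply: eq_bigr => t /eqP ->.
apply: le_trans (riesz b) _; rewrite le_eqVlt; apply/orP; left; apply/eqP.
congr (_ * _); rewrite /qform [RHS](partition_big lam xpredT)//=.
apply: eq_bigr => k _; rewrite expr2 {1}/b mulr_suml.
apply: eq_bigr => t /eqP tk; rewrite /b mulr_sumr [LHS]big_mkcond.
apply: eq_bigr => t' _; rewrite tk eq_sym.
by case: eqP => _; rewrite ?mulr1 ?mulr0.
Qed.

(** Surplus ranks are filled with zero functions. *)
Lemma rank_pack (R : realType) (Y Z : Type) (T : finType) (A : {set T}) rk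
    (h1 : T -> Y -> R) (h2 : T -> Z -> R) : (#|A| <= rk)%N ->
  exists (g1 : 'I_rk -> Y -> R) (g2 : 'I_rk -> Z -> R),
    (forall q, (exists2 a, a \in A & g1 q = h1 a /\ g2 q = h2 a) \/
               (g1 q = cst 0 /\ g2 q = cst 0)) /\
    forall y z, \sum_q g1 q y * g2 q z = \sum_(a in A) h1 a y * h2 a z.
Proof.
move=> Ark.
pose pick (U : Type) (h : T -> U -> R) (q : nat) : U -> R :=
  if insub q : option 'I_#|A| is Some k then h (enum_val k) else cst 0.
exists (fun q => pick _ h1 q), (fun q => pick _ h2 q); split=> [q|y z].
  rewrite /pick; case: insubP => [k _ _|_]; last by right.
  by left; exists (enum_val k) => //; exact: enum_valP.
rewrite [RHS]big_enum_val/=.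
transitivity (\sum_(i < #|A|) pick _ h1 i y * pick _ h2 i z); last first.
  by apply: eq_bigr => i _; rewrite /pick valK.
rewrite (big_ord_widen _ (fun i => pick _ h1 i y * pick _ h2 i z) Ark).
rewrite [RHS]big_mkcond; apply: eq_bigr => i _; case: ifPn => // iA.
by rewrite /pick insubF ?mul0r//; exact: negbTE.
Qed.

(** * Tensor product wavelets *)

Section TensorWavelets.
Context {R : realType} {m l : nat} (lm : (l < m)%N) (n r : 'I_m -> nat)
  (Omega : forall i, set 'rV[R]_(n i)) (s : 'I_m -> R).
Arguments Omega : clear implicits.
Hypothesis oO : forall i, open (Omega i).
Variable ms : forall i, multiscale (Omega i) (r i).
Arguments ms : clear implicits.

Local Notation e1 := (group1 lm).
Local Notation e2 := (group2 lm).
Local Notation Omega12 := (prod_domain Omega).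
Local Notation Omega1 := (prod_domain (fun k => Omega (e1 k))).
Local Notation Omega2 := (prod_domain (fun k => Omega (e2 k))).

Variables (B M : nat).
Local Notation La := ('I_B * 'I_M)%type.
Local Notation F1 := {ffun 'I_l -> La}.
Local Notation F2 := {ffun 'I_(m - l) -> La}.

Let psi i (k : La) := npsi (ms i) k.1 k.2.
Let cf i (k : La) (v : 'rV[R]_(n i) -> R) := dot2 (Omega i) v (ndpsi (ms i) k.1 k.2).
Local Arguments psi : clear implicits.
Local Arguments cf : clear implicits.

Definition tpsi1 (f : F1) := tensor (fun k => psi (e1 k) (f k)).
Definition tpsi2 (g : F2) := tensor (fun k => psi (e2 k) (g k)).

Lemma tpsi1_L2 f : L2 Omega1 (tpsi1 f).
Proof. by apply: L2_tensor => k; exact: npsi_L2. Qed.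

Lemma tpsi2_L2 g : L2 Omega2 (tpsi2 g).
Proof. by apply: L2_tensor => k; exact: npsi_L2. Qed.

Lemma tpsi12 (f : F1) (g : F2) x :
  tpsi1 f (blocks e1 x) * tpsi2 g (blocks e2 x) =
  tensor (fun i => psi i (join lm f g i)) x.
Proof.
rewrite (tensor_blocks lm); congr (_ * _); apply: eq_bigr => k _.
  by rewrite join1.
by rewrite join2.
Qed.

Variable t : alg_tensor Omega s.

Definition tcoef1 (q : 'I_(trank t)) (f : F1) : R :=
  \prod_k cf (e1 k) (f k) (tfactor q (e1 k)).
Definition tcoef2 (q : 'I_(trank t)) (g : F2) : R :=
  \prod_k cf (e2 k) (g k) (tfactor q (e2 k)).
Definition tcoef (f : F1) (g : F2) : R := \sum_q tcoef1 q f * tcoef2 q g.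

(** The part of the wavelet expansion of the tensor [t] that is selected by
    [P]. *)
Definition tpartial (P : F1 -> F2 -> bool) (x : 'rV[R]_(\sum_i n i)) : R :=
  \sum_f \sum_(g | P f g) tcoef f g * (tpsi1 f (blocks e1 x) * tpsi2 g (blocks e2 x)).

(** The complete expansion of a product is the product of the expansions. *)
Lemma tpartialT x : tpartial (fun _ _ => true) x =
  \sum_(q < trank t) tensor (fun (i : 'I_m) (y : 'rV[R]_(n i)) =>
    \sum_k cf i k (tfactor q i) * psi i k y) x.
Proof.
rewrite /tpartial.
transitivity (\sum_q \sum_(f : F1) \sum_(g : F2)
   (tcoef1 q f * tpsi1 f (blocks e1 x)) * (tcoef2 q g * tpsi2 g (blocks e2 x))).
  rewrite [RHS]exchange_big/=; apply: eq_bigr => f _.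
  rewrite [RHS]exchange_big/=; apply: eq_bigr => g _.
  by rewrite /tcoef mulr_suml; apply: eq_bigr => q _; rewrite mulrACA.
apply: eq_bigr => q _; rewrite (tensor_blocks lm) /tensor !bigA_distr_bigA/=.
rewrite mulr_suml; apply: eq_bigr => f _.
rewrite mulr_sumr; apply: eq_bigr => g _.
by rewrite !big_split.
Qed.

Lemma tpartialE (P : F1 -> F2 -> bool) :
  tpartial P = fun x => \sum_(tau : F1 * F2)
    (if P tau.1 tau.2 then tcoef tau.1 tau.2 else 0) *
    tensor (fun i => psi i (join lm tau.1 tau.2 i)) x.
Proof.
apply/funext => x; rewrite /tpartial.
rewrite -(pair_bigA _ (fun f g => (if P f g then tcoef f g else 0) *
  tensor (fun i => psi i (join lm f g i)) x))/=.
apply: eq_bigr => f _; rewrite big_mkcond; apply: eq_bigr => g _.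
by rewrite tpsi12; case: ifP => // _; rewrite mul0r.
Qed.

Lemma tensor_psi_L2 (tau : F1 * F2) :
  L2 Omega12 (tensor (fun i => psi i (join lm tau.1 tau.2 i))).
Proof. by apply: L2_tensor => i; exact: npsi_L2. Qed.

Lemma tpartial_L2 P : L2 Omega12 (tpartial P).
Proof. by rewrite tpartialE; apply: L2_lin => tau _; exact: tensor_psi_L2. Qed.

(** The tensor products of the wavelets inherit the Riesz bound: their Gram
    matrix is the entrywise product of the Gram matrices of the factors. *)
Lemma tpartial_riesz (C : 'I_m -> R) (P : F1 -> F2 -> bool) :
  (forall i, 0 < C i) ->
  (forall i (a : La -> R),
     norm2 (Omega i) (fun x => \sum_k a k * psi i k x) ^+ 2 <=
     C i * \sum_k a k ^+ 2) ->
  norm2 Omega12 (tpartial P) ^+ 2 <=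
  (\prod_i C i) * \sum_f \sum_(g | P f g) tcoef f g ^+ 2.
Proof.
move=> C0 riesz; rewrite tpartialE.
pose a (tau : F1 * F2) : R := if P tau.1 tau.2 then tcoef tau.1 tau.2 else 0.
rewrite (@norm2_lin_sqr _ _ _ _ a _ tensor_psi_L2).
pose jn (tau : F1 * F2) i := join lm tau.1 tau.2 i.
have jnI tau tau' : [forall i, jn tau i == jn tau' i] = (tau == tau').
  apply/forallP/eqP => [H|-> i //]; case: tau tau' H => f g [f' g'] H.
  congr pair; apply/ffunP => k.
    by have /eqP := H (e1 k); rewrite /jn !join1.
  by have /eqP := H (e2 k); rewrite /jn !join2.
have psiL i k : L2 (Omega i) (psi i k) by exact: npsi_L2.
have H := psd_le_prod (index_enum 'I_m)
  (fun i => psd_dot2 (fun tau => psiL i (jn tau i)))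
  (fun i => psd_riesz_pull (fun tau => jn tau i) (psiL i) (riesz i)).
rewrite (eq_qform _ (B := fun tau tau' => \prod_i dot2 (Omega i)
   (psi i (jn tau i)) (psi i (jn tau' i)))); last first.
  by move=> tau tau'; apply: dot2_tensor => i; exact: psiL.
have HL : qform (fun tau tau' => \prod_i dot2 (Omega i)
    (psi i (jn tau i)) (psi i (jn tau' i))) a <=
  qform (fun tau tau' => \prod_i (C i * (jn tau i == jn tau' i)%:R)) a.
  exact: (psd_leP H a).
apply: le_trans HL _.
rewrite (eq_qform _ (B := fun tau tau' => (\prod_i C i) * (tau == tau')%:R)).
  rewrite qformZ ler_wpM2l//; first by apply: prodr_ge0 => i _; exact: ltW.
  rewrite /qform le_eqVlt; apply/orP; left; apply/eqP.
  transitivity (\sum_tau a tau ^+ 2).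
    apply: eq_bigr => tau _; rewrite (bigD1 tau)//= eqxx mulr1 -expr2.
    rewrite big1 ?addr0// => tau' /negbTE; rewrite eq_sym => ->.
    by rewrite mulr0.
  rewrite -(pair_bigA _ (fun f g => a (f, g) ^+ 2))/=.
  apply: eq_bigr => f _; rewrite [RHS]big_mkcond; apply: eq_bigr => g _.
  by rewrite /a/=; case: ifP => // _; rewrite expr0n.
move=> tau tau'; rewrite big_split/= -jnI; congr (_ * _).
case: (boolP [forall i, _]) => [/forallP H'|].
  by rewrite big1// => i _; rewrite (eqP (H' i)) eqxx.
rewrite negb_forall => /existsP[i /negbTE ii].
by rewrite (bigD1 i)//= ii mul0r.
Qed.

(** A square expands into pairs of elementary tensors, and for each pair the
    sum over a product of index sets factorises over the groups. *)
Lemma tcoef_energy (O1 : pred F1) (O2 : pred F2) :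
  \sum_(f | O1 f) \sum_(g | O2 g) tcoef f g ^+ 2 =
  qform (fun q q' => (\sum_(f | O1 f) tcoef1 q f * tcoef1 q' f) *
                     (\sum_(g | O2 g) tcoef2 q g * tcoef2 q' g)) (cst 1).
Proof.
rewrite /qform.
transitivity (\sum_(f | O1 f) \sum_(g | O2 g) \sum_q \sum_q'
   (tcoef1 q f * tcoef1 q' f) * (tcoef2 q g * tcoef2 q' g)).
  apply: eq_bigr => f _; apply: eq_bigr => g _.
  rewrite expr2 {1}/tcoef mulr_suml; apply: eq_bigr => q _.
  by rewrite /tcoef mulr_sumr; apply: eq_bigr => q' _; rewrite mulrACA.
under eq_bigr do rewrite exchange_big/=.
rewrite exchange_big/=; apply: eq_bigr => q _.
under eq_bigr do rewrite exchange_big/=.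
rewrite exchange_big/=; apply: eq_bigr => q' _.
rewrite mul1r mul1r mulr_suml; apply: eq_bigr => f _.
by rewrite mulr_sumr.
Qed.

(** The energy outside both truncations is the form of an entrywise product of
    two tail kernels, one for each group. As entrywise products are monotone,
    each kernel may be replaced by its bound, and the Sobolev Gram kernels of
    the groups multiply up to that of the tensor. This is how a bound for the
    factors becomes one in the cross norm. *)
Lemma tcoef_tail (C : 'I_m -> R) (I1 : pred {ffun 'I_l -> 'I_B})
    (I2 : pred {ffun 'I_(m - l) -> 'I_B}) (t1 t2 : R) :
  0 <= t1 -> 0 <= t2 ->
  let u i (q : 'I_(trank t)) := tfactor q i in
  let G i (q q' : 'I_(trank t)) := C i * sob_dot (u i q) (u i q') in
  (forall i, 0 < C i) ->
  psd_le (fun q q' => \sum_(j | ~~ I1 j) \prod_k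
      level_form (ms (e1 k)) (u (e1 k)) M (j k) q q')
    (fun q q' => t1 * \prod_k G (e1 k) q q') ->
  psd_le (fun q q' => \sum_(j | ~~ I2 j) \prod_k
      level_form (ms (e2 k)) (u (e2 k)) M (j k) q q')
    (fun q q' => t2 * \prod_k G (e2 k) q q') ->
  \sum_(f : F1) \sum_(g : F2 | ~~ I1 [ffun k => (f k).1] && ~~ I2 [ffun k => (g k).1])
     tcoef f g ^+ 2 <=
  t1 * t2 * (\prod_i C i) * tdot t t.
Proof.
move=> t10 t20 u G C0 H1 H2.
have pG i : psd (G i) by apply: psdZ; [exact: ltW|exact: psd_sob_dot].
rewrite (_ : \sum_f _ = \sum_(f : F1 | ~~ I1 [ffun k => (f k).1])
    \sum_(g : F2 | ~~ I2 [ffun k => (g k).1]) tcoef f g ^+ 2); last first.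
  rewrite [RHS]big_mkcond; apply: eq_bigr => f _.
  by case: (I1 _) => //=; rewrite big_pred0_eq.
rewrite (tcoef_energy (fun f : F1 => ~~ I1 [ffun k => (f k).1])
  (fun g : F2 => ~~ I2 [ffun k => (g k).1])).
have E1 q q' : \sum_(f : F1 | ~~ I1 [ffun k => (f k).1]) tcoef1 q f * tcoef1 q' f =
    \sum_(j | ~~ I1 j) \prod_k level_form (ms (e1 k)) (u (e1 k)) M (j k) q q'.
  rewrite /level_form -(sum_levels (fun j => ~~ I1 j)
    (fun k x => cf (e1 k) x (u (e1 k) q) * cf (e1 k) x (u (e1 k) q'))).
  by apply: eq_bigr => f _; rewrite big_split.
have E2 q q' : \sum_(g : F2 | ~~ I2 [ffun k => (g k).1]) tcoef2 q g * tcoef2 q' g =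
    \sum_(j | ~~ I2 j) \prod_k level_form (ms (e2 k)) (u (e2 k)) M (j k) q q'.
  rewrite /level_form -(sum_levels (fun j => ~~ I2 j)
    (fun k x => cf (e2 k) x (u (e2 k) q) * cf (e2 k) x (u (e2 k) q'))).
  by apply: eq_bigr => f _; rewrite big_split.
set A1 := fun q q' => \sum_(j | ~~ I1 j) _ in H1.
set A2 := fun q q' => \sum_(j | ~~ I2 j) _ in H2.
(* The two groups are the factors of a product indexed by [bool]. *)
rewrite (eq_qform _ (B := fun q q' => \prod_(b : bool) (if b then A1 else A2) q q'));
  last by move=> q q'; rewrite big_bool/= E1 E2.
have pA1 : psd A1.
  by apply: psd_sum => j _; apply: psd_prod => k; exact: psd_level_form.
have pA2 : psd A2.
  by apply: psd_sum => j _; apply: psd_prod => k; exact: psd_level_form.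
have := @psd_le_prod _ _ bool (index_enum bool) (fun b => if b then A1 else A2)
  (fun b q q' => if b then t1 * \prod_k G (e1 k) q q' else t2 * \prod_k G (e2 k) q q').
move=> /(_ _ _)/psd_leP/(_ (cst 1)) H.
apply: le_trans (H _ _) _; [by case|by case|].
rewrite (eq_qform _ (B := fun q q' => (t1 * t2 * \prod_i C i) *
  \prod_i sob_dot (u i q) (u i q'))); last first.
  move=> q q'; rewrite big_bool/= mulrACA -[RHS]mulrA; congr (_ * _).
  by rewrite -[RHS]big_split/= [RHS](big_groups lm).
rewrite qformZ le_eqVlt; apply/orP; left; apply/eqP; congr (_ * _).
by rewrite /qform /tdot; apply: eq_bigr => q _; apply: eq_bigr => q' _; rewrite !mul1r.
Qed.

End TensorWavelets.

(** * Limits of tensor products *)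

Section TensorLimit.
Context {R : realType}.

Lemma cvg_dot2 n (D : set 'rV[R]_n) (u v : 'rV[R]_n -> R)
    (uk vk : nat -> 'rV[R]_n -> R) :
  L2 D u -> L2 D v -> (forall k, L2 D (uk k)) -> (forall k, L2 D (vk k)) ->
  (fun k => norm2 D (u \- uk k)) @ \oo --> (0 : R) ->
  (fun k => norm2 D (v \- vk k)) @ \oo --> (0 : R) ->
  (fun k => dot2 D (uk k) (vk k)) @ \oo --> dot2 D u v.
Proof.
move=> uL vL ukL vkL cu cv.
have E k : dot2 D (uk k) (vk k) - dot2 D u v =
    dot2 D (u \- uk k) (v \- vk k) - dot2 D u (v \- vk k) - dot2 D (u \- uk k) v.
  rewrite (dot2C D u (v \- _)) (@dot2Bl _ _ _ u (uk k)) ?(@dot2Bl _ _ _ v (vk k))//; last exact: L2B.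
  rewrite (@dot2Bl _ _ _ u (uk k) v)// !(dot2C D _ (v \- vk k)) !(@dot2Bl _ _ _ v (vk k))//.
  by rewrite !(dot2C D v) !(dot2C D (vk k)); ring.
apply/subr_cvg0/norm_cvg0P.
apply: (@squeeze_cvgr _ _ _ _ (cst 0) (fun k =>
    norm2 D (u \- uk k) * norm2 D (v \- vk k) + norm2 D u * norm2 D (v \- vk k) +
    norm2 D (u \- uk k) * norm2 D v)).
- apply: nearW => k /=; rewrite normr_ge0/= E.
  apply: le_trans (ler_normB _ _) _; apply: lerD; last by apply: dot2_CS => //; exact: L2B.
  apply: le_trans (ler_normB _ _) _.
  by apply: lerD; apply: dot2_CS => //; exact: L2B.
- exact: cvg_cst.
- rewrite [X in _ --> X](_ : 0 = 0 * 0 + norm2 D u * 0 + 0 * norm2 D v); last by ring.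
  apply: cvgD; last by apply: cvgM => //; exact: cvg_cst.
  by apply: cvgD; apply: cvgM => //; exact: cvg_cst.
Qed.

Lemma norm2B_sqr n (D : set 'rV[R]_n) (u v : 'rV[R]_n -> R) : L2 D u -> L2 D v ->
  norm2 D (u \- v) ^+ 2 = dot2 D u u - 2 * dot2 D u v + dot2 D v v.
Proof.
move=> uL vL; have wL := L2B uL vL.
rewrite norm2_sqr dot2Bl// ![dot2 D _ (_ \- _)]dot2C !dot2Bl//.
by rewrite (dot2C D v u); ring.
Qed.

(** The squared norm of a difference of tensors is a polynomial in scalar
    products of the factors, each of which converges. *)
Lemma cvg_tensor m (n : 'I_m -> nat) (Omega : forall i, set 'rV[R]_(n i))
    (u : forall i, 'rV[R]_(n i) -> R) (uk : nat -> forall i, 'rV[R]_(n i) -> R) :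
  (forall i, L2 (Omega i) (u i)) -> (forall k i, L2 (Omega i) (uk k i)) ->
  (forall i, (fun k => norm2 (Omega i) (u i \- uk k i)) @ \oo --> (0 : R)) ->
  (fun k => norm2 (prod_domain Omega) (tensor u \- tensor (uk k))) @ \oo --> (0 : R).
Proof.
move=> uL ukL cu.
have tuL : L2 (prod_domain Omega) (tensor u) by exact: L2_tensor.
have tukL k : L2 (prod_domain Omega) (tensor (uk k)) by exact: L2_tensor.
have E k : norm2 (prod_domain Omega) (tensor u \- tensor (uk k)) = Num.sqrt
    (\prod_i dot2 (Omega i) (u i) (u i) -
     2 * \prod_i dot2 (Omega i) (u i) (uk k i) +
     \prod_i dot2 (Omega i) (uk k i) (uk k i)).
  rewrite -!dot2_tensor// -norm2B_sqr// sqrtr_sqr ger0_norm//.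
  exact: norm2_ge0.
rewrite (_ : (fun k => _) = (fun k => Num.sqrt
    (\prod_i dot2 (Omega i) (u i) (u i) -
     2 * \prod_i dot2 (Omega i) (u i) (uk k i) +
     \prod_i dot2 (Omega i) (uk k i) (uk k i)))); last by apply/funext => k; exact: E.
rewrite -[X in _ --> X]sqrtr0.
apply: continuous_cvg; first exact: sqrt_continuous.
rewrite [X in _ --> X](_ : 0 = \prod_i dot2 (Omega i) (u i) (u i) -
  2 * \prod_i dot2 (Omega i) (u i) (u i) + \prod_i dot2 (Omega i) (u i) (u i)); last by ring.
have c0 i : (fun _ : nat => norm2 (Omega i) (u i \- u i)) @ \oo --> (0 : R).
  rewrite (_ : norm2 _ _ = 0); first exact: cvg_cst.
  rewrite norm2E (_ : u i \- u i = cst 0) ?dot20l ?sqrtr0//.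
  by apply/funext => x /=; rewrite subrr.
apply: cvgD.
  apply: cvgB; first exact: cvg_cst.
  apply: cvgM; first exact: cvg_cst.
  by apply: cvg_big => [|i _]; [exact: mul_continuous|exact: cvg_dot2].
by apply: cvg_big => [|i _]; [exact: mul_continuous|exact: cvg_dot2].
Qed.

End TensorLimit.

(** * Truncation of low rank *)

Lemma norm2_sum (R : realType) n (D : set 'rV[R]_n) (I : Type) (r : seq I)
    (F : I -> 'rV[R]_n -> R) : (forall i, L2 D (F i)) ->
  norm2 D (fun x => \sum_(i <- r) F i x) <= \sum_(i <- r) norm2 D (F i).
Proof.
move=> FL; elim: r => [|i r IH].
  rewrite big_nil norm2E (_ : (fun x => _) = cst 0) ?dot20l ?sqrtr0//.
  by apply/funext => x; rewrite big_nil.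
rewrite big_cons (_ : (fun x => _) = F i \+ (fun x => \sum_(i <- r) F i x)).
  apply: le_trans (norm2D (FL i) _) _; first exact: L2_sum.
  by rewrite lerD2l.
by apply/funext => x; rewrite big_cons.
Qed.

Section LowRank.
Context {R : realType} {m l : nat} (lm : (l < m)%N) (n r : 'I_m -> nat)
  (Omega : forall i, set 'rV[R]_(n i)) (s : 'I_m -> R).
Arguments Omega : clear implicits.
Variable ms : forall i, multiscale (Omega i) (r i).
Arguments ms : clear implicits.

Local Notation e1 := (group1 lm).
Local Notation e2 := (group2 lm).
Local Notation Omega12 := (prod_domain Omega).
Local Notation Omega1 := (prod_domain (fun k => Omega (e1 k))).
Local Notation Omega2 := (prod_domain (fun k => Omega (e2 k))).

Lemma tfun_L2 (t : alg_tensor Omega s) : L2 Omega12 (tfun t).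
Proof.
apply: L2_sum => q _; apply: (L2_tensor (u := fun i => Defs.sfun (tfactor q i))).
by move=> i; exact: sobolev_L2.
Qed.

Let Msize B := (\sum_i \sum_(j < B) wcard (ms i) j)%N.

Let Msize_large B i : wlarge (ms i) B (Msize B).
Proof.
move=> j jB; rewrite /Msize (bigD1 i)//= (bigD1 (Ordinal jB))//= -addnA.
exact: leq_addr.
Qed.

(** A large enough box of levels makes the remainder of the expansion as small
    as desired, so all sums over levels may be taken finite. *)
Lemma tpartial_cvg (t : alg_tensor Omega s) (e : R) : 0 < e ->
  exists B M, (forall i, wlarge (ms i) B M) /\
  norm2 Omega12 (tfun t \- tpartial lm ms (B := B) (M := M) t (fun _ _ => true)) < e.
Proof.
move=> e0.
pose v B (q : 'I_(trank t)) i (y : 'rV[R]_(n i)) : R :=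
  \sum_(lam : 'I_B * 'I_(Msize B))
    dot2 (Omega i) (tfactor q i) (ndpsi (ms i) lam.1 lam.2) *
    npsi (ms i) lam.1 lam.2 y.
have vL B q i : L2 (Omega i) (v B q i) by apply: L2_lin => lam _; exact: npsi_L2.
have uL (q : 'I_(trank t)) i : L2 (Omega i) (Defs.sfun (tfactor q i)) by exact: sobolev_L2.
have cq (q : 'I_(trank t)) : (fun B => norm2 Omega12
    (tensor (fun i => Defs.sfun (tfactor q i)) \- tensor (v B q))) @ \oo --> (0 : R).
  apply: cvg_tensor => // i; apply/cvgr0Pnorm_lt => d d0.
  have [B0 HB] := npsi_cvg (ms i) (uL q i) d0.
  near=> B; rewrite ger0_norm ?norm2_ge0//; apply: HB; last exact: Msize_large.
  by near: B; exact: nbhs_infty_ge.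
have : (fun B => \sum_q norm2 Omega12
    (tensor (fun i => Defs.sfun (tfactor q i)) \- tensor (v B q))) @ \oo -->
    \sum_(q < trank t) (0 : R).
  by apply: cvg_big => [|q _]; [exact: add_continuous|exact: cq].
have -> : \sum_(q < trank t) (0 : R) = 0 by exact: big1_eq.
move=> /cvgr0Pnorm_lt /(_ e e0) [B _ /(_ B (leqnn B)) HB].
exists B, (Msize B); split; first by move=> i; exact: Msize_large.
apply: le_lt_trans HB; rewrite ger0_norm; last first.
  by apply: sumr_ge0 => q _; exact: norm2_ge0.
apply: le_trans (norm2_sum _ _); last first.
  by move=> q; apply: L2B; exact: L2_tensor.
rewrite le_eqVlt; apply/orP; left; apply/eqP; congr (norm2 _ _).
apply/funext => x /=; rewrite tpartialT sumrB; congr (_ - _).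
Unshelve. all: by end_near. Qed.

Section FixedLevel.
Variables (B M : nat) (t : alg_tensor Omega s).
Hypothesis BM : forall i, wlarge (ms i) B M.
Local Notation F1 := {ffun 'I_l -> 'I_B * 'I_M}.
Local Notation F2 := {ffun 'I_(m - l) -> 'I_B * 'I_M}.
Variables (I1 : pred {ffun 'I_l -> 'I_B}) (I2 : pred {ffun 'I_(m - l) -> 'I_B}).

Definition level_of p (f : {ffun 'I_p -> 'I_B * 'I_M}) : {ffun 'I_p -> 'I_B} :=
  [ffun k => (f k).1].

(** The multi-indices of actual wavelets, as opposed to padding: only these
    contribute to the rank. *)
Definition genuine p (e : 'I_p -> 'I_m) (f : {ffun 'I_p -> 'I_B * 'I_M}) : bool :=
  [forall k, (f k).2 < wcard (ms (e k)) (f k).1]%N.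

(** The terms of the low rank approximation: one for each wavelet of either
    group that belongs to the truncation of its group. *)
Definition kept : {set F1 + F2} :=
  [set a | match a with
           | inl f => I1 (level_of f) && genuine e1 f
           | inr g => I2 (level_of g) && genuine e2 g
           end].

Lemma card_genuine p (e : 'I_p -> 'I_m) (I : pred {ffun 'I_p -> 'I_B}) (Cw : 'I_m -> R) :
  (forall i j, (wcard (ms i) j)%:R <= Cw i * 2 ^+ (j * n i)) ->
  #|[pred f | I (level_of f) && genuine e f]|%:R <=
  (\prod_k Cw (e k)) * \sum_(j : {ffun 'I_p -> 'I_B} | I j) \prod_k (2 : R) ^+ (j k * n (e k)).
Proof.
move=> Hw; rewrite -sum1_card natr_sum.
have -> : \sum_(f in [pred f | I (level_of f) && genuine e f]) (1%:R : R) =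
    \sum_(f : {ffun 'I_p -> 'I_B * 'I_M} | I (level_of f))
      \prod_k ((f k).2 < wcard (ms (e k)) (f k).1)%N%:R.
  rewrite big_mkcond [RHS]big_mkcond; apply: eq_bigr => f _; rewrite inE.
  case: (I _) => //=; rewrite /genuine; case: forallP => [H|H].
    by rewrite big1// => k _; rewrite H.
  have /existsNP[k /negP/negbTE kf] := H.
  by rewrite (bigD1 k)//= kf mul0r.
rewrite (sum_levels I (fun k lam => (lam.2 < wcard (ms (e k)) lam.1)%N%:R)).
rewrite mulr_sumr; apply: ler_sum => j _; rewrite -big_split/=.
apply: ler_prod => k _; rewrite sumr_ge0//=; apply: le_trans (Hw _ _).
rewrite -natr_sum ler_nat; have jM := BM (e k) (ltn_ord (j k)).
rewrite -[leqRHS]card_ord -sum1_card (big_ord_widen M (fun=> 1%N) jM).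
by rewrite [leqRHS]big_mkcond; apply: leq_sum => x _; case: ifP.
Qed.

Lemma card_kept (Cw : 'I_m -> R) :
  (forall i j, (wcard (ms i) j)%:R <= Cw i * 2 ^+ (j * n i)) ->
  (#|kept|)%:R <=
  (\prod_k Cw (e1 k)) * (\sum_(j : {ffun 'I_l -> 'I_B} | I1 j) \prod_k (2 : R) ^+ (j k * n (e1 k))) +
  (\prod_k Cw (e2 k)) * (\sum_(j : {ffun 'I_(m - l) -> 'I_B} | I2 j) \prod_k (2 : R) ^+ (j k * n (e2 k))).
Proof.
move=> Hw; apply: le_trans (lerD (card_genuine e1 I1 Hw) (card_genuine e2 I2 Hw)).
rewrite -natrD ler_nat -!sum1_card big_sumType/=.
rewrite (eq_bigl (fun f => f \in [pred f | I1 (level_of f) && genuine e1 f])).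
  rewrite (eq_bigl (fun f => f \in [pred f | I2 (level_of f) && genuine e2 f]))//.
  by move=> f; rewrite !inE.
by move=> f; rewrite !inE.
Qed.

Let h1 (a : F1 + F2) : 'rV[R]_(\sum_k n (e1 k)) -> R :=
  match a with
  | inl f => tpsi1 ms f
  | inr g => fun y => \sum_(f : F1 | ~~ I1 (level_of f)) tcoef lm ms t f g * tpsi1 ms f y
  end.

Let h2 (a : F1 + F2) : 'rV[R]_(\sum_k n (e2 k)) -> R :=
  match a with
  | inl f => fun z => \sum_(g : F2) tcoef lm ms t f g * tpsi2 ms g z
  | inr g => tpsi2 ms g
  end.

Lemma tensor_genuine0 p (e : 'I_p -> 'I_m) (f : {ffun 'I_p -> 'I_B * 'I_M}) y :
  ~~ genuine e f -> tensor (fun k => npsi (ms (e k)) (f k).1 (f k).2) y = 0.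
Proof.
rewrite negb_forall => /existsP[k]; rewrite -leqNgt => kf.
by rewrite /tensor (bigD1 k)//= npsi_out// mul0r.
Qed.

(** Only the coefficients outside both truncations are dropped; the kept ones
    are grouped by their first multi-index if it lies in the first truncation,
    and by their second one otherwise. *)
Lemma tpartial_split x :
  tpartial lm ms (B := B) (M := M) t (fun _ _ => true) x =
  \sum_(a in kept) h1 a (blocks e1 x) * h2 a (blocks e2 x) +
  tpartial lm ms (B := B) (M := M) t (fun f g => ~~ I1 (level_of f) && ~~ I2 (level_of g)) x.
Proof.
rewrite big_sumType/= /tpartial.
have S1 : \sum_(f : F1 | inl f \in kept) tpsi1 ms f (blocks e1 x) *
    (\sum_(g : F2) tcoef lm ms t f g * tpsi2 ms g (blocks e2 x)) =
  \sum_(f : F1) \sum_(g : F2 | I1 (level_of f)) tcoef lm ms t f g *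
    (tpsi1 ms f (blocks e1 x) * tpsi2 ms g (blocks e2 x)).
  rewrite big_mkcond; apply: eq_bigr => f _; rewrite inE.
  case: (I1 _) => /=; last by rewrite big_pred0_eq.
  case: ifPn => [_|/tensor_genuine0 f0]; last first.
    by rewrite big1// => g _; rewrite /tpsi1 f0 mul0r mulr0.
  by rewrite mulr_sumr; apply: eq_bigr => g _; rewrite mulrCA.
have S2 : \sum_(g : F2 | inr g \in kept)
    (\sum_(f : F1 | ~~ I1 (level_of f)) tcoef lm ms t f g * tpsi1 ms f (blocks e1 x)) *
    tpsi2 ms g (blocks e2 x) =
  \sum_(f : F1) \sum_(g : F2 | ~~ I1 (level_of f) && I2 (level_of g)) tcoef lm ms t f g *
    (tpsi1 ms f (blocks e1 x) * tpsi2 ms g (blocks e2 x)).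
  transitivity (\sum_(g : F2) \sum_(f : F1)
     if ~~ I1 (level_of f) && I2 (level_of g) then tcoef lm ms t f g *
    (tpsi1 ms f (blocks e1 x) * tpsi2 ms g (blocks e2 x)) else 0); last first.
    by rewrite exchange_big/=; apply: eq_bigr => f _; rewrite -big_mkcond.
  rewrite big_mkcond; apply: eq_bigr => g _; rewrite inE.
  rewrite -big_mkcond/=; case: (I2 _) => /=; last first.
    by rewrite big_pred0// => f; rewrite ?andbF.
  case: ifPn => [_|/tensor_genuine0 g0]; last first.
    by rewrite big1// => f _; rewrite /tpsi2 g0 !mulr0.
  rewrite mulr_suml.
  by apply: eq_big => [f|f _]; rewrite ?andbT// mulrA.
rewrite S1 S2 -!big_split/=; apply: eq_bigr => f _.
case: (I1 _) => /=; first by rewrite !big_pred0_eq !addr0.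
rewrite big_pred0_eq add0r (bigID (fun g => I2 (level_of g)))/=.
by congr (_ + _); apply: eq_bigl => g.
Qed.

Lemma low_rank_truncation rk : (#|kept| <= rk)%N ->
  exists (g1 : 'I_rk -> 'rV[R]_(\sum_j n (e1 j)) -> R)
         (g2 : 'I_rk -> 'rV[R]_(\sum_j n (e2 j)) -> R),
  [/\ forall q, L2 Omega1 (g1 q), forall q, L2 Omega2 (g2 q) &
      (fun x => \sum_(q < rk) g1 q (blocks e1 x) * g2 q (blocks e2 x)) =
      tpartial lm ms (B := B) (M := M) t (fun _ _ => true) \-
      tpartial lm ms (B := B) (M := M) t (fun f g => ~~ I1 (level_of f) && ~~ I2 (level_of g))].
Proof.
move=> /(rank_pack h1 h2)[g1 [g2 [gh gE]]].
exists g1, g2; split.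
- move=> q; case: (gh q) => [[a _ [-> _]]|[-> _]]; last exact: L20.
  case: a => [f|g] /=; first exact: tpsi1_L2.
  by apply: L2_lin => f _; exact: tpsi1_L2.
- move=> q; case: (gh q) => [[a _ [_ ->]]|[_ ->]]; last exact: L20.
  case: a => [f|g] /=; last exact: tpsi2_L2.
  by apply: L2_lin => g _; exact: tpsi2_L2.
- by apply/funext => x; rewrite gE /= tpartial_split addrK.
Qed.

End FixedLevel.
End LowRank.

(** * Error and rank at a given level *)

Section Approximation.
Context {R : realType} {m l : nat} (lm : (l < m)%N) (n r : 'I_m -> nat)
  (Omega : forall i, set 'rV[R]_(n i)) (s : 'I_m -> R).
Arguments Omega : clear implicits.
Hypothesis oO : forall i, open (Omega i).
Variable ms : forall i, multiscale (Omega i) (r i).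
Hypothesis hs : forall i, 0 <= s i <= (r i)%:R.
Hypothesis hn : forall i, (0 < n i)%N.
Hypothesis hl : (0 < l)%N.
Arguments ms : clear implicits.
Arguments oO : clear implicits.

Local Notation e1 := (group1 lm).
Local Notation e2 := (group2 lm).
Local Notation Omega12 := (prod_domain Omega).
Local Notation Omega1 := (prod_domain (fun k => Omega (e1 k))).
Local Notation Omega2 := (prod_domain (fun k => Omega (e2 k))).

Let ratio1 j := s (e1 j) / (n (e1 j))%:R.
Let ratio2 j := s (e2 j) / (n (e2 j))%:R.
Let beta := family_min ratio1 + family_min ratio2.
Let Pmax := maxn (min_count ratio1) (min_count ratio2).

Lemma tdot_ge0 (t : alg_tensor Omega s) : 0 <= tdot t t.
Proof.
have := psd_prod (index_enum 'I_m)
  (fun i => psd_sob_dot (oO i) (fun q : 'I_(trank t) => tfactor q i)).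
move=> [_ /(_ (cst 1))]; congr (_ <= _).
by apply: eq_bigr => q _; apply: eq_bigr => q' _; rewrite !mul1r.
Qed.

Lemma tnorm_ge0 (t : alg_tensor Omega s) : 0 <= tnorm t.
Proof. exact: sqrtr_ge0. Qed.

(** The embedding of the tensor product into L2 is bounded for the cross norm:
    entrywise products of the Gram kernels preserve the bounds of the
    factors. *)
Lemma tfun_norm_bound : exists2 C : R, 0 < C &
  forall t : alg_tensor Omega s, norm2 Omega12 (tfun t) <= C * tnorm t.
Proof.
have /choice[C CP] i : exists c : R, 0 < c /\ forall (Q : finType)
    (u : Q -> sobolev (Omega i) (s i)),
    psd_le (fun p q => dot2 (Omega i) (u p) (u q))
           (fun p q => c * sob_dot (u p) (u q)).
  by have [c c0 H] := L2_form_bound (ms i) (oO i) (hs i); exists c.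
have C0 : 0 < \prod_i C i by apply: prodr_gt0 => i _; have [] := CP i.
exists (Num.sqrt (\prod_i C i)) => [|t]; first by rewrite sqrtr_gt0.
rewrite -ler_sqr ?nnegrE ?norm2_ge0 ?mulr_ge0 ?sqrtr_ge0//.
rewrite exprMn !sqr_sqrtr ?tdot_ge0 ?(ltW C0)//.
pose u i (q : 'I_(trank t)) : 'rV[R]_(n i) -> R := tfactor q i.
have uL i q : L2 (Omega i) (u i q) by exact: sobolev_L2.
have -> : tfun t = fun x => \sum_(q < trank t) cst 1 q * tensor (u^~ q) x.
  by apply/funext => x; apply: eq_bigr => q _; rewrite mul1r.
rewrite norm2_lin_sqr; last by move=> q; apply: L2_tensor => i; exact: uL.
have H := psd_le_prod (index_enum 'I_m) (fun i => psd_dot2 (uL i))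
  (fun i => (CP i).2 _ (fun q => tfactor q i)).
have HL : qform (fun q q' : 'I_(trank t) => \prod_i dot2 (Omega i) (u i q) (u i q')) (cst 1)
   <= qform (fun q q' : 'I_(trank t) => \prod_i (C i * sob_dot (tfactor q i) (tfactor q' i))) (cst 1).
  exact: (psd_leP H (cst 1)).
rewrite (eq_qform _ (B := fun q q' => \prod_i dot2 (Omega i) (u i q) (u i q'))).
  apply: le_trans HL _.
  rewrite (eq_qform _ (B := fun q q' => (\prod_i C i) *
    \prod_i sob_dot (tfactor q i) (tfactor q' i))); last first.
    by move=> q q'; rewrite big_split.
  rewrite qformZ le_eqVlt; apply/orP; left; apply/eqP; congr (_ * _).
  by apply: eq_bigr => q _; apply: eq_bigr => q' _; rewrite !mul1r.
by move=> q q'; apply: dot2_tensor => i; exact: uL.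
Qed.

Let l2 : (0 < m - l)%N. Proof. by rewrite subn_gt0. Qed.

Let expE : (m - 2 = l.-1 + (m - l).-1)%N.
Proof. by move: hl lm; lia. Qed.

Let regroup (a g c1 c2 p q x y z : R) :
  a * ((c1 * p ^+ 2 * x) * (c2 * q ^+ 2 * y) * g * z) =
  a * g * (c1 * c2) * (p * q) ^+ 2 * (x * y) * z.
Proof. by ring. Qed.

Definition low_rank_approx rk (h : 'rV[R]_(\sum_i n i) -> R) (e : R) : Prop :=
  exists (g1 : 'I_rk -> 'rV[R]_(\sum_j n (e1 j)) -> R)
         (g2 : 'I_rk -> 'rV[R]_(\sum_j n (e2 j)) -> R),
    let fR := fun x => \sum_(q < rk) g1 q (blocks e1 x) * g2 q (blocks e2 x) in
    [/\ forall q, L2 Omega1 (g1 q), forall q, L2 Omega2 (g2 q), L2 Omega12 fR &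
        norm2 Omega12 (h \- fR) <= e].

(** Both truncations are taken at the same level [J]. The rank is the sum of
    the numbers of wavelets kept in the groups, each of order
    [2 ^ J (1 + J) ^ (P - 1)]; the squared error is the product of the tails of
    the groups, of order [4 ^ (- beta J) (1 + J) ^ (m - 2)]. The summand [e]
    accounts for the levels outside a large box. *)
Lemma low_rank_approx_level : exists Ke Kr : R, [/\ 0 < Ke, 0 < Kr &
  forall (J rk : nat) (t : alg_tensor Omega s) (e : R), 0 < e ->
    Kr * 2 ^+ J * (1 + J%:R) ^+ Pmax.-1 <= rk%:R ->
    low_rank_approx rk (tfun t)
      (Ke * 2 `^ (- (beta * J%:R)) * Num.sqrt ((1 + J%:R) ^+ (m - 2)) * tnorm t + e)].
Proof.
have /choice[Cr CrP] i : exists c : R, 0 < c /\ forall B M, wlarge (ms i) B M ->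
    forall a : 'I_B * 'I_M -> R,
    norm2 (Omega i) (fun x => \sum_lam a lam * npsi (ms i) lam.1 lam.2 x) ^+ 2 <=
    c * \sum_lam a lam ^+ 2.
  by have [c c0 H] := npsi_riesz (ms i); exists c.
have /choice[Cw CwP] i : exists c : R, 0 < c /\
    forall j, (wcard (ms i) j)%:R <= c * 2 ^+ (j * n i).
  by have [c c0 H] := wcard_bound (ms i); exists c.
have /choice[Cg CgP] i : exists c : R, [/\ 0 < c,
    forall (Q : finType) (u : Q -> sobolev (Omega i) (s i)) M j,
      (wcard (ms i) j <= M)%N ->
      psd_le (level_form (ms i) u M j) (fun p q =>
        (2 `^ (- (j%:R * s i))) ^+ 2 * (c * sob_dot (u p) (u q))) &
    forall (Q : finType) (u : Q -> sobolev (Omega i) (s i)) B M,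
      wlarge (ms i) B M ->
      psd_le (fun p q => \sum_(j < B) level_form (ms i) u M j p q)
         (fun p q => c * sob_dot (u p) (u q))].
  have [c1 c10 H1] := level_form_decay (ms i) (oO i) (hs i).
  have [c2 c20 H2] := level_form_sum (ms i) (oO i) (hs i).
  exists (c1 + c2); split=> [|Q u M j jM|Q u B M BM]; first exact: addr_gt0.
    apply: psd_le_trans (H1 Q u M j jM) _.
    apply: eq_psd (psdZ _ (psd_sob_dot (oO i) u)); last first.
      exact: mulr_ge0 (ltW c20) (sqr_ge0 (2 `^ (- (j%:R * s i)))).
    by move=> p q; ring.
  apply: psd_le_trans (H2 Q u B M BM) _.
  apply: eq_psd (psdZ (ltW c10) (psd_sob_dot (oO i) u)).
  by move=> p q; ring.
have s0 i : 0 <= s i by have /andP[] := hs i.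
have [C1 C10 T1] := group_tail hl (fun k => hn (e1 k)) (fun k => s0 (e1 k)).
have [C2 C20 T2] := group_tail l2 (fun k => hn (e2 k)) (fun k => s0 (e2 k)).
have Cr0 : 0 < \prod_i Cr i by apply: prodr_gt0 => i _; have [] := CrP i.
have Cg0 : 0 < \prod_i Cg i by apply: prodr_gt0 => i _; have [] := CgP i.
have Cw1 : 0 < \prod_k Cw (e1 k) by apply: prodr_gt0 => i _; have [] := CwP (e1 i).
have Cw2 : 0 < \prod_k Cw (e2 k) by apply: prodr_gt0 => i _; have [] := CwP (e2 i).
exists (Num.sqrt ((\prod_i Cr i) * (\prod_i Cg i) * (C1 * C2))).
exists ((\prod_k Cw (e1 k)) * C1 + (\prod_k Cw (e2 k)) * C2); split.
- by rewrite sqrtr_gt0 !mulr_gt0.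
- by rewrite addr_gt0// mulr_gt0.
move=> J rk t e e0 Jrk.
have [I1 [D1 L1]] := T1 J.
have [I2 [D2 L2']] := T2 J.
have [B [M [BM cvgBM]]] := tpartial_cvg lm ms t e0.
have J1 : 1 <= 1 + J%:R :> R by rewrite lerDl.
have J0 : 0 <= 1 + J%:R :> R := le_trans ler01 J1.
have pw k : (k <= Pmax)%N -> (1 + J%:R : R) ^+ k.-1 <= (1 + J%:R) ^+ Pmax.-1.
  by move=> kP; apply: ler_weXn2l => //; rewrite -!subn1 leq_sub2r.
have kept_rk : (#|kept lm ms M (I1 B) (I2 B)| <= rk)%N.
  rewrite -(ler_nat R); apply: le_trans Jrk.
  apply: le_trans (card_kept lm BM (I1 B) (I2 B) (fun i => (CwP i).2)) _.
  rewrite [leRHS](_ : _ = (\prod_k Cw (e1 k)) * (C1 * 2 ^+ J * (1 + J%:R) ^+ Pmax.-1) +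
    (\prod_k Cw (e2 k)) * (C2 * 2 ^+ J * (1 + J%:R) ^+ Pmax.-1)); last first.
    by rewrite !mulrDl !mulrA.
  apply: lerD; rewrite ler_pM2l//.
    apply: le_trans (D1 B) _; apply: ler_wpM2l; last exact: pw (leq_maxl _ _).
    by rewrite mulr_ge0 ?ltW// exprn_gt0.
  apply: le_trans (D2 B) _; apply: ler_wpM2l; last exact: pw (leq_maxr _ _).
  by rewrite mulr_ge0 ?ltW// exprn_gt0.
have [g1 [g2 [g1L g2L gE]]] := low_rank_truncation t kept_rk.
exists g1, g2; rewrite gE; split=> //; first by apply: L2B; exact: tpartial_L2.
set S := tpartial lm ms t (fun _ _ => true) in cvgBM *.
set E := tpartial lm ms t (fun _ _ => ~~ _ && ~~ _).
have SL : L2 Omega12 S by exact: tpartial_L2.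
have EL : L2 Omega12 E by exact: tpartial_L2.
have tL : L2 Omega12 (tfun t) by exact: tfun_L2.
rewrite (_ : tfun t \- (S \- E) = E \+ (tfun t \- S)); last first.
  by apply/funext => x /=; ring.
apply: le_trans (norm2D EL (L2B tL SL)) _; apply: lerD; last exact: ltW.
rewrite -ler_sqr ?nnegrE ?norm2_ge0//; last first.
  by rewrite !mulr_ge0 ?sqrtr_ge0 ?powR_ge0.
have RZ := tpartial_riesz lm t
  (fun f g => ~~ I1 B (level_of f) && ~~ I2 B (level_of g))
  (fun i => (CrP i).1) (fun i => (CrP i).2 B M (BM i)).
apply: le_trans RZ _.
pose t1 : R := C1 * 2 `^ (- (family_min ratio1 * J%:R)) ^+ 2 * (1 + J%:R) ^+ l.-1.
pose t2 : R := C2 * 2 `^ (- (family_min ratio2 * J%:R)) ^+ 2 * (1 + J%:R) ^+ (m - l).-1.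
have t10 : 0 <= t1 := mulr_ge0 (mulr_ge0 (ltW C10) (sqr_ge0 _)) (exprn_ge0 _ J0).
have t20 : 0 <= t2 := mulr_ge0 (mulr_ge0 (ltW C20) (sqr_ge0 _)) (exprn_ge0 _ J0).
pose u i (q : 'I_(trank t)) := tfactor q i.
have G1 := L1 B _ (fun k x => level_form (ms (e1 k)) (u (e1 k)) M x)
  (fun k q q' => Cg (e1 k) * sob_dot (u (e1 k) q) (u (e1 k) q')).
have G2 := L2' B _ (fun k x => level_form (ms (e2 k)) (u (e2 k)) M x)
  (fun k q q' => Cg (e2 k) * sob_dot (u (e2 k) q) (u (e2 k) q')).
have psdG i : psd (fun q q' => Cg i * sob_dot (u i q) (u i q')).
  by apply: psdZ; [have [/ltW] := CgP i|exact: psd_sob_dot].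
have bound := tcoef_tail oO t10 t20 (fun i => let: And3 c _ _ := CgP i in c)
  (G1 (fun k x => psd_level_form _ _ _ _) (fun k => psdG (e1 k))
     (fun k x => let: And3 _ H _ := CgP (e1 k) in H _ _ M x (BM _ _ (ltn_ord x)))
     (fun k => let: And3 _ _ H := CgP (e1 k) in H _ _ B M (BM _)))
  (G2 (fun k x => psd_level_form _ _ _ _) (fun k => psdG (e2 k))
     (fun k x => let: And3 _ H _ := CgP (e2 k) in H _ _ M x (BM _ _ (ltn_ord x)))
     (fun k => let: And3 _ _ H := CgP (e2 k) in H _ _ B M (BM _))).
apply: le_trans (ler_wpM2l (ltW Cr0) bound) _.
have K0 : 0 <= (\prod_i Cr i) * (\prod_i Cg i) * (C1 * C2) :=
  mulr_ge0 (mulr_ge0 (ltW Cr0) (ltW Cg0)) (mulr_ge0 (ltW C10) (ltW C20)).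
rewrite !exprMn (sqr_sqrtr K0) (sqr_sqrtr (exprn_ge0 _ J0)) (sqr_sqrtr (tdot_ge0 t)).
have -> : (1 + J%:R : R) ^+ (m - 2) = (1 + J%:R) ^+ l.-1 * (1 + J%:R) ^+ (m - l).-1.
  by rewrite -exprD -expE.
rewrite /beta mulrDl opprD powRD; last by apply/implyP => _; rewrite pnatr_eq0.
by rewrite le_eqVlt; apply/orP; left; apply/eqP; exact: regroup.
Qed.

End Approximation.

(** * From the level to the rank *)

Section Rate.
Context {R : realType}.
Variables (beta : R) (m P : nat).
Hypotheses (b0 : 0 <= beta) (m2 : (2 <= m)%N) (P0 : (0 < P)%N).

Let gam : R := (m%:R - 1) / 2 + beta * (P%:R - 1).

Definition rate (rk : nat) : R := rk%:R `^ (- beta) * ln rk%:R `^ gam.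

Let P1 : (P.-1)%:R = P%:R - 1 :> R.
Proof. by rewrite -subn1 natrB. Qed.

Let gam0 : 0 <= gam.
Proof.
rewrite addr_ge0// ?mulr_ge0// ?invr_ge0// -?P1//.
by rewrite subr_ge0 ler1n ltnW.
Qed.

Let L : R := ln 2.
Let L0 : 0 < L. Proof. by rewrite ln_gt0// ltr1n. Qed.

Let ln_rk rk : (2 <= rk)%N -> L <= ln (rk%:R : R).
Proof. by move=> rk2; rewrite ler_ln ?posrE ?ltr0n ?ler_nat//; exact: ltn_trans rk2. Qed.

Lemma rate_gt0 rk : (2 <= rk)%N -> 0 < rate rk.
Proof.
move=> rk2; have rk0 : (0 < rk)%N by exact: leq_trans rk2.
by rewrite mulr_gt0 ?powR_gt0 ?ltr0n//; exact: lt_le_trans (ln_rk rk2).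
Qed.

(** The level is the largest one whose number of terms
    [K 2 ^ J (1 + J) ^ (P - 1)] is within the rank. By maximality the rank is,
    up to constants, at most [2 ^ J (log rk) ^ (P - 1)], which turns
    [2 ^ (- beta J)] into the rate. If not even level 0 fits, the rank is
    bounded and the rate is bounded below. *)
Lemma choose_level (K : R) : 0 < K -> exists2 C : R, 0 < C &
  forall rk, (2 <= rk)%N ->
    1 <= C * rate rk \/
    exists J : nat, K * 2 ^+ J * (1 + J%:R) ^+ P.-1 <= rk%:R /\
      2 `^ (- (beta * J%:R)) * Num.sqrt ((1 + J%:R) ^+ (m - 2)) <= C * rate rk.
Proof.
move=> K0; (* As [K1 >= 1], a level [J] that fits satisfies [2 ^ J <= rk]. *)
pose K1 := 1 + K.
have K11 : 1 <= K1 by rewrite lerDl ltW.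
have K10 : 0 < K1 by exact: lt_le_trans K11.
(* This constant makes [y] below at least [2 + J], hence at least 1. *)
pose c3 : R := 3 / L.
have c30 : 0 < c3 by rewrite divr_gt0.
have D0 : 0 < 2 * K1 by rewrite mulr_gt0.
exists ((2 * K1) `^ beta * c3 `^ gam) => [|rk rk2]; first by rewrite mulr_gt0 ?powR_gt0.
have rk0 : 0 < rk%:R :> R by rewrite ltr0n; exact: leq_trans rk2.
set x := ln (rk%:R : R).
have xL : L <= x by exact: ln_rk.
have x0 : 0 < x by exact: lt_le_trans xL.
pose y := c3 * x.
have y3 : 3 <= y by rewrite /y /c3 mulrAC ler_pdivlMr// ler_pM2l.
have y1 : 1 <= y by apply: le_trans y3; rewrite ler1n.
have y0 : 0 < y by exact: lt_le_trans y1.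
have CE : (2 * K1) `^ beta * c3 `^ gam * rate rk =
    (2 * K1) `^ beta * rk%:R `^ (- beta) * y `^ gam.
  by rewrite /rate -/x /y [(c3 * x) `^ gam]powRM ?(ltW c30) ?(ltW x0)//; ring.
have quot (a b : R) : 0 < a -> 0 < b -> a <= b -> 1 <= b `^ beta * a `^ (- beta).
  move=> a0 b0' ab; rewrite powRN ler_pdivlMr ?powR_gt0// mul1r.
  by apply: ge0_ler_powR => //; rewrite nnegrE ltW.
rewrite CE.
pose phi (J : nat) : R := K1 * 2 ^+ J * (1 + J%:R) ^+ P.-1.
have J11 (J : nat) : 1 <= 1 + J%:R :> R by rewrite lerDl.
have [K1rk|rkK1] := leP K1 rk%:R; last first.
  left; apply: (@le_trans _ _ (1 * 1)); first by rewrite mulr1.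
  apply: ler_pM => //.
    apply: quot => //; apply: le_trans (ltW rkK1) _.
    by rewrite ler_peMl ?(ltW K10)// ler1n.
  by rewrite -[leLHS](powRr0 y) ler_powR.
right.
have ex0 : exists J, phi J <= rk%:R.
  by exists 0%N; rewrite /phi expr0 mulr1 addr0 expr1n mulr1.
have pow2_phi J : 2 ^+ J <= phi J.
  rewrite /phi -mulrA mulrCA ler_peMr ?exprn_ge0// -[leLHS]mulr1.
  by apply: ler_pM => //; exact: exprn_ege1.
have exB J : phi J <= rk%:R -> (J <= rk)%N.
  move=> H; rewrite -(ler_nat R); apply: le_trans H; apply: le_trans (pow2_phi J).
  by rewrite -natrX ler_nat ltnW// ltn_expl.
case: (ex_maxnP ex0 exB) => J JP Jmax; exists J; split.
  apply: le_trans JP; rewrite /phi -!mulrA; apply: ler_wpM2r; last by rewrite /K1 lerDr.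
  by rewrite mulr_ge0 ?exprn_ge0// (le_trans ler01).
have Jx : J%:R * L <= x.
  have : 2 ^+ J <= rk%:R :> R by exact: le_trans (pow2_phi J) JP.
  rewrite -ler_ln ?posrE ?exprn_gt0// lnXn// => H.
  by apply: le_trans H; rewrite mulr_natl.
have Jy : 2 + J%:R <= y.
  rewrite /y /c3 mulrAC ler_pdivlMr// mulrDl; have := xL; have := Jx; lra.
have rkphi : rk%:R <= 2 * K1 * 2 ^+ J * y ^+ P.-1.
  have : ~~ (phi J.+1 <= rk%:R) by apply/negP => /Jmax; rewrite ltnn.
  rewrite -ltNge => /ltW/le_trans; apply; rewrite /phi exprS.
  rewrite [leRHS](_ : _ = K1 * (2 * 2 ^+ J) * y ^+ P.-1); last by ring.
  apply: ler_wpM2l; first by rewrite !mulr_ge0// ?ltW// exprn_gt0.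
  rewrite lerXn2r ?nnegrE ?(ltW y0) ?(le_trans ler01 (J11 _))//.
  by rewrite -natr1; move: Jy; lra.
have zE : 2 `^ (- (beta * J%:R)) = (2 ^+ J) `^ (- beta).
  by rewrite -powR_mulrn// -powRrM; congr (_ `^ _); ring.
have step1 : 2 `^ (- (beta * J%:R)) <=
    (2 * K1) `^ beta * rk%:R `^ (- beta) * y `^ (beta * (P%:R - 1)).
  have z0 : 0 < 2 ^+ J :> R by rewrite exprn_gt0.
  have yP0 : 0 < y ^+ P.-1 by rewrite exprn_gt0.
  have Dz0 : 0 < 2 * K1 * 2 ^+ J by exact: mulr_gt0.
  have := quot _ _ rk0 (mulr_gt0 Dz0 yP0) rkphi.
  rewrite (powRM _ (ltW Dz0) (ltW yP0)) (powRM _ (ltW D0) (ltW z0)) => H.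
  rewrite zE powRN -[leLHS]mul1r ler_pdivrMr ?powR_gt0//.
  apply: le_trans H _.
  rewrite (_ : y `^ (beta * (P%:R - 1)) = (y ^+ P.-1) `^ beta).
    by rewrite le_eqVlt; apply/orP; left; apply/eqP; ring.
  by rewrite -powR_mulrn ?(ltW y0)// -powRrM P1 mulrC.
have step2 : Num.sqrt ((1 + J%:R) ^+ (m - 2)) <= y `^ ((m%:R - 1) / 2).
  apply: (@le_trans _ _ (y `^ ((m - 2)%:R / 2))).
    rewrite powRrM powR_mulrn ?(ltW y0)// powR12_sqrt ?exprn_ge0 ?(ltW y0)//.
    rewrite ler_wsqrtr// lerXn2r ?nnegrE ?(ltW y0) ?(le_trans ler01)//.
    by move: Jy; lra.
  apply: ler_powR => //; rewrite natrB// ler_pM2r ?invr_gt0//.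
  by rewrite lerD2l lerN2 ler1n.
apply: le_trans (ler_pM (powR_ge0 _ _) (sqrtr_ge0 _) step1 step2) _.
rewrite /gam powRD; last by apply/implyP => _; rewrite gt_eqF.
by rewrite le_eqVlt; apply/orP; left; apply/eqP; ring.
Qed.

End Rate.

(** * Passage to the completion *)

Section Limit.
Context {R : realType} {m : nat} (n : 'I_m -> nat)
  (Omega : forall i, set 'rV[R]_(n i)) (s : 'I_m -> R).
Arguments Omega : clear implicits.
Hypothesis oO : forall i, open (Omega i).
Arguments oO : clear implicits.

(** The Gram kernel of the two tensors together is positive semidefinite,
    whence the reverse triangle inequality for the cross norm. *)
Lemma tnorm_dist (t t' : alg_tensor Omega s) :
  `|tnorm t - tnorm t'| <= tdist t t'.
Proof.
pose u (q : 'I_(trank t) + 'I_(trank t')) i : sobolev (Omega i) (s i) :=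
  match q with inl k => tfactor k i | inr k => tfactor k i end.
have [_ pA] := psd_prod (index_enum 'I_m)
  (fun i => psd_sob_dot (oO i) (fun q => u q i)).
have td (v w : alg_tensor Omega s) (c : R) :
    \sum_(q < trank v) \sum_(q' < trank w)
      c * \prod_i sob_dot (tfactor q i) (tfactor q' i) = c * tdot v w.
  by rewrite /tdot mulr_sumr; apply: eq_bigr => q _; rewrite mulr_sumr.
have tC : tdot t' t = tdot t t'.
  rewrite /tdot exchange_big/=; apply: eq_bigr => q _; apply: eq_bigr => q' _.
  by apply: eq_bigr => i _; exact: sob_dotC.
have E (a b : R) : 0 <= a ^+ 2 * tdot t t + 2 * a * b * tdot t t' + b ^+ 2 * tdot t' t'.
  have := pA (fun q => if q is inl _ then a else b); congr (_ <= _).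
  transitivity (
    \sum_(q < trank t) (
      \sum_(q' < trank t) a * a * \prod_i sob_dot (tfactor q i) (tfactor q' i) +
      \sum_(q' < trank t') a * b * \prod_i sob_dot (tfactor q i) (tfactor q' i)) +
    \sum_(q < trank t') (
      \sum_(q' < trank t) b * a * \prod_i sob_dot (tfactor q i) (tfactor q' i) +
      \sum_(q' < trank t') b * b * \prod_i sob_dot (tfactor q i) (tfactor q' i))).
    rewrite /qform big_sumType/=; congr (_ + _); apply: eq_bigr => q _;
      by rewrite big_sumType.
  by rewrite !big_split/= !td tC; ring.
have p0 := E 1 0; have p1 := E 0 1; have pm := E 1 (-1).
have t0 : 0 <= tdot t t by move: p0; lra.
have t'0 : 0 <= tdot t' t' by move: p1; lra.
have nt : tnorm t ^+ 2 = tdot t t by rewrite sqr_sqrtr.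
have nt' : tnorm t' ^+ 2 = tdot t' t' by rewrite sqr_sqrtr.
have n0 : 0 <= tnorm t by exact: sqrtr_ge0.
have n'0 : 0 <= tnorm t' by exact: sqrtr_ge0.
have CS : `|tdot t t'| <= tnorm t * tnorm t'.
  rewrite -[leRHS]ger0_norm ?mulr_ge0// -ler_sqr ?nnegrE//.
  rewrite !real_normK ?num_real// exprMn nt nt'.
  apply: discriminant_le => // x; have := E 1 x.
  by rewrite expr1n mul1r mulr1.
rewrite -ler_sqr ?nnegrE ?sqrtr_ge0// real_normK ?num_real//.
rewrite sqr_sqrtr; last by move: pm; lra.
have := le_trans (ler_norm _) CS; rewrite sqrrB nt nt'; lra.
Qed.

Lemma tnorm_cvg f (t : nat -> alg_tensor Omega s) : tensor_approx f t ->
  cvg ((fun k => tnorm (t k)) @ \oo).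
Proof.
move=> [_ tC _]; apply/cauchy_cvgP; apply: cauchy_exP => e e0.
have [K KP] := tC e e0; exists (tnorm (t K)); exists K => // k /= Kk.
by rewrite /ball/=; apply: le_lt_trans (tnorm_dist _ _) _; exact: KP.
Qed.

End Limit.

Theorem theorem5p2 (R : realType) (m l : nat) (n : 'I_m -> nat)
    (r : 'I_m -> nat) (k : nat) (Omega : forall i, set 'rV[R]_(n i))
    (s : 'I_m -> R)
    (hm : (2 <= m)%N) (hl : (1 <= l)%N) (lm : (l < m)%N)
    (hn : forall i, (0 < n i)%N) (hr : forall i, (0 < r i)%N)
    (hk : (0 < k)%N) (hOmega : forall i, Ck_domain k (Omega i))
    (ms : forall i, multiscale (Omega i) (r i))
    (hs : forall i, 0 <= s i <= (r i)%:R) :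
  let e1 := group1 lm in
  let e2 := group2 lm in
  let ratio1 := fun j => s (e1 j) / (n (e1 j))%:R in
  let ratio2 := fun j => s (e2 j) / (n (e2 j))%:R in
  let beta := family_min ratio1 + family_min ratio2 in
  let P1 := min_count ratio1 in
  let P2 := min_count ratio2 in
  let Omega12 := prod_domain Omega in
  let Omega1 := prod_domain (fun j => Omega (e1 j)) in
  let Omega2 := prod_domain (fun j => Omega (e2 j)) in
  exists C : R,
    forall f : 'rV[R]_(\sum_i n i) -> R, mixed_sobolev Omega s f ->
    forall rk : nat, (2 <= rk)%N ->
    exists (g1 : 'I_rk -> 'rV[R]_(\sum_j n (e1 j)) -> R)
           (g2 : 'I_rk -> 'rV[R]_(\sum_j n (e2 j)) -> R),
      let fR := fun x => \sum_(q < rk) g1 q (blocks e1 x) * g2 q (blocks e2 x) in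
      [/\ forall q, L2 Omega1 (g1 q),
          forall q, L2 Omega2 (g2 q),
          L2 Omega12 fR
        & norm2 Omega12 (f \- fR) <=
            C * rk%:R `^ (- beta)
              * ln rk%:R `^ ((m%:R - 1) / 2 + beta * ((maxn P1 P2)%:R - 1))
              * mixed_norm Omega s f].
Proof.
move=> e1 e2 ratio1 ratio2 beta P1 P2 Omega12 Omega1 Omega2.
have oO i : open (Omega i) by have [] := hOmega i.
have l2 : (0 < m - l)%N by rewrite subn_gt0.
have b0 : 0 <= beta.
  have s0 i : 0 <= s i / (n i)%:R.
    by have /andP[? _] := hs i; rewrite divr_ge0.
  have [i1 [E1 _]] := family_minP ratio1 hl.
  have [i2 [E2 _]] := family_minP ratio2 l2.
  by apply: addr_ge0; [rewrite -E1|rewrite -E2]; exact: s0.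
have P0 : (0 < maxn P1 P2)%N.
  rewrite leq_max; apply/orP; left.
  have [i1 [E1 _]] := family_minP ratio1 hl.
  by apply/card_gt0P; exists i1; rewrite inE E1.
have [Ke [Kr [Ke0 Kr0 HJ]]] := low_rank_approx_level lm oO ms hs hn hl.
have [Cn Cn0 HN] := tfun_norm_bound oO ms hs.
have [C C0 HC] := choose_level b0 hm P0 Kr0.
pose rt := rate beta m (maxn P1 P2).
have rt0 rk : (2 <= rk)%N -> 0 < rt rk by exact: rate_gt0.
have zero_approx rk h : L2 Omega12 h -> low_rank_approx lm Omega rk h (norm2 Omega12 h).
  move=> hL; exists (fun _ => cst 0), (fun _ => cst 0); split.
  - by move=> _; exact: L20.
  - by move=> _; exact: L20.
  - by apply: L2_sum => q _; rewrite (_ : (fun _ => _) = cst 0);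
      [exact: L20|apply/funext => x; rewrite mul0r].
  rewrite (_ : _ \- _ = h)//; apply/funext => x /=.
  by rewrite big1 ?subr0// => q _; rewrite mul0r.
have algebraic rk (t : alg_tensor Omega s) (e : R) : (2 <= rk)%N -> 0 < e ->
    low_rank_approx lm Omega rk (tfun t) ((Cn + Ke) * C * rt rk * tnorm t + e).
  move=> rk2 e0; have tn0 := tnorm_ge0 t.
  have rk0 := rt0 rk rk2.
  case: (HC rk rk2) => [small|[J [JK JR]]].
    have [g1 [g2 [g1L g2L gL gE]]] := zero_approx rk _ (tfun_L2 t).
    exists g1, g2; split=> //; apply: le_trans gE _.
    apply: le_trans (HN t) _; rewrite -[leLHS]addr0; apply: lerD (ltW e0).
    apply: ler_wpM2r => //; rewrite -mulrA -[leLHS]mulr1.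
    by apply: ler_pM => //; [exact: ltW|rewrite lerDl ltW].
  have [g1 [g2 [g1L g2L gL gE]]] := HJ J rk t e e0 JK.
  exists g1, g2; split=> //; apply: le_trans gE _; rewrite lerD2r.
  apply: ler_wpM2r => //; rewrite -!mulrA; apply: ler_pM.
  - exact: ltW.
  - by rewrite mulr_ge0 ?powR_ge0 ?sqrtr_ge0.
  - by rewrite lerDr ltW.
  - exact: JR.
(* The factor 2 leaves room for replacing [f] by a tensor of norm less than
   twice that of [f], the summand 2 for the two errors that this causes. *)
exists (2 * ((Cn + Ke) * C) + 2) => f [t0 ft0] rk rk2.
set N := mixed_norm Omega s f.
have : exists2 t : nat -> alg_tensor Omega s, tensor_approx f t &
    (fun k => tnorm (t k)) @ \oo --> N.
  (* The norm of [f] is the limit along some sequence, possibly not [t0]. *)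
  pose S := [set N' : R | exists2 t : nat -> alg_tensor Omega s, tensor_approx f t &
    (fun k => tnorm (t k)) @ \oo --> N'].
  have SN : S (lim ((fun k => tnorm (t0 k)) @ \oo)).
    by exists t0 => //; exact: tnorm_cvg ft0.
  exact: (getPex (ex_intro S _ SN)).
case=> t ft tN; have [fL tC tf] := ft.
have N0 : 0 <= N.
  by apply: (closed_cvg _ (@closed_ge R 0) _ _ tN); apply: nearW => j; exact: tnorm_ge0.
have rk0 := rt0 rk rk2.
(* If the norm vanishes, there is no room for an error; but then [f] vanishes
   almost everywhere. *)
have [Nz|Nz] := eqVneq N 0.
  suff f0 : norm2 Omega12 f = 0.
    have [g1 [g2 [g1L g2L gL gE]]] := zero_approx rk f fL.
    by exists g1, g2; split=> //; rewrite Nz mulr0; apply: le_trans gE _; rewrite f0.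
  apply/eqP; rewrite eq_le norm2_ge0 andbT.
  have bk j : norm2 Omega12 f <= norm2 Omega12 (f \- tfun (t j)) + Cn * tnorm (t j).
    have tL : L2 Omega12 (tfun (t j)) by exact: tfun_L2.
    rewrite [X in norm2 _ X <= _](_ : f = (f \- tfun (t j)) \+ tfun (t j)).
      by apply: le_trans (norm2D (L2B fL tL) tL) _; rewrite lerD2l.
    by apply/funext => x /=; rewrite subrK.
  have lim0 : (fun j => norm2 Omega12 (f \- tfun (t j)) + Cn * tnorm (t j)) @ \oo --> (0 : R).
    have := cvgD tf (cvgMl_tmp (a := Cn) tN).
    by rewrite Nz mulr0 addr0; exact.
  apply: (closed_cvg _ (@closed_ge R (norm2 Omega12 f)) _ _ lim0).
  by apply: nearW => j; exact: bk.
have Np : 0 < N by rewrite lt_def Nz.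
have e0 : 0 < rt rk * N by exact: mulr_gt0.
have [j [fj tj]] : exists j, norm2 Omega12 (f \- tfun (t j)) < rt rk * N /\ tnorm (t j) < 2 * N.
  have [j [H1 H2]] : exists j, norm2 Omega12 (f \- tfun (t j)) < rt rk * N /\ `|N - tnorm (t j)| < N.
    move: tf => /cvgr0Pnorm_lt /(_ _ e0) tf; move: tN => /cvgrPdist_lt /(_ _ Np) tN.
    have [K _ KP] := filterI tf tN; have [H1 H2] := KP K (leqnn K).
    exists K; split=> //; exact: le_lt_trans (ler_norm _) H1.
  exists j; split=> //; move: H2; rewrite distrC => /(le_lt_trans (ler_norm _)).
  by lra.
have [g1 [g2 [g1L g2L gL gE]]] := algebraic rk (t j) _ rk2 e0.
exists g1, g2; split=> //.
apply: le_trans (norm2_triangle fL (tfun_L2 (t j)) gL) _.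
apply: le_trans (lerD (ltW fj) gE) _.
have K0 : 0 <= (Cn + Ke) * C * rt rk.
  apply: mulr_ge0 (ltW rk0); apply: mulr_ge0 (ltW C0).
  exact: addr_ge0 (ltW Cn0) (ltW Ke0).
have := ler_wpM2l K0 (ltW tj).
rewrite -[_ * _ `^ _ * _ `^ _]mulrA -/(rate beta m (maxn P1 P2) rk) -/(rt rk).
set A := (Cn + Ke) * C * rt rk * tnorm (t j).
move=> HA; rewrite [leRHS](_ : _ = (Cn + Ke) * C * rt rk * (2 * N) + 2 * (rt rk * N)); last by ring.
by move: HA; lra.
Qed.
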